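(* Let $(\mathcal{E},i,q)$ be a twist over an effective Hausdorff étale groupoid $\mathcal{G}$. Then $C_r^*(\mathcal{G};\mathcal{E})$ is simple if and only if $\mathcal{G}$ is minimal.
   Context: A Hausdorff étale groupoid is a second-countable locally compact Hausdorff topological groupoid $\mathcal{G}$ with unit space $\mathcal{G}^{(0)}$ whose range and source maps $r,s\colon\mathcal{G}\to\mathcal{G}^{(0)}$ are local homeomorphisms. For a groupoid $\mathcal{G}$ and $u\in\mathcal{G}^{(0)}$: $\mathcal{G}_u=s^{-1}(u)$, $\mathrm{Iso}(\mathcal{G})=\{\gamma\in\mathcal{G}: r(\gamma)=s(\gamma)\}$. $\mathcal{G}$ is effective if the topological interior of $\mathrm{Iso}(\mathcal{G})$ in $\mathcal{G}$ equals $\mathcal{G}^{(0)}$. A subset $U\subseteq\mathcal{G}^{(0)}$ is invariant if $s(\gamma)\in U$ implies $r(\gamma)\in U$ for all $\gamma\in\mathcal{G}$; $\mathcal{G}$ is minimal if $\mathcal{G}^{(0)}$ has no nonempty proper open (equivalently, closed) invariant subsets. A C*-algebra is simple if it has no nonzero proper closed two-sided ideals. A twist $(\mathcal{E},i,q)$ over $\mathcal{G}$ is a sequence $\mathcal{G}^{(0)}\times\mathbb{T}\xrightarrow{i}\mathcal{E}\xrightarrow{q}\mathcal{G}$, where $\mathcal{G}^{(0)}\times\mathbb{T}$ is the trivial group bundle with fibres $\mathbb{T}$ and $\mathcal{E}$ is a locally compact Hausdorff groupoid with $\mathcal{E}^{(0)}=i(\mathcal{G}^{(0)}\times\{1\})$,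 such that: (a) $i,q$ are continuous groupoid homomorphisms restricting to homeomorphisms of unit spaces ($\mathcal{E}^{(0)}$ is identified with $\mathcal{G}^{(0)}$ via $q$); (b) $i(\{x\}\times\mathbb{T})=q^{-1}(x)$ for $x\in\mathcal{G}^{(0)}$, $i$ is injective, $q$ is surjective; (c) each $\alpha\in\mathcal{G}$ has an open neighbourhood $U_\alpha$ and a continuous $P_\alpha\colon U_\alpha\to\mathcal{E}$ with $q\circ P_\alpha=\mathrm{id}_{U_\alpha}$ such that $(\beta,z)\mapsto i(r(\beta),z)P_\alpha(\beta)$ is a homeomorphism $U_\alpha\times\mathbb{T}\to q^{-1}(U_\alpha)$; (d) $i(r(\varepsilon),z)\varepsilon=\varepsilon\, i(s(\varepsilon),z)$ for all $\varepsilon\in\mathcal{E}$, $z\in\mathbb{T}$. Write $z\cdot\varepsilon=i(r(\varepsilon),z)\varepsilon$. For $u\in\mathcal{E}^{(0)}$, $\lambda_u$ is the measure on $\mathcal{E}_u$ that on each $q^{-1}(\gamma)$, $\gamma\in\mathcal{G}_{q(u)}$, is the copy of normalised Haar measure on $\mathbb{T}$ under $z\mapsto z\cdot\varepsilon$ (any $\varepsilon\in q^{-1}(\gamma)$). $\Sigma_c(\mathcal{G};\mathcal{E})$ is the $*$-algebra of $f\in C_c(\mathcal{E})$ with $f(z\cdot\varepsilon)=zf(\varepsilon)$ for all $z\in\mathbb{T},\varepsilon\in\mathcal{E}$, with product $(fg)(\varepsilon)=\int_{\mathcal{E}_{s(\varepsilon)}}f(\varepsilon\zeta^{-1})g(\zeta)\,d\lambda_{s(\varepsilon)}(\zeta)$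 and involution $f^*(\varepsilon)=\overline{f(\varepsilon^{-1})}$. For $u\in\mathcal{E}^{(0)}$, $\pi_u$ is the representation of $\Sigma_c(\mathcal{G};\mathcal{E})$ by the convolution formula on the Hilbert space $L^2(\mathcal{G}_{q(u)};\mathcal{E}_u)$ of square-integrable $\mathbb{T}$-equivariant functions on $\mathcal{E}_u$. $C_r^*(\mathcal{G};\mathcal{E})$ is the completion of $\Sigma_c(\mathcal{G};\mathcal{E})$ in the norm $\|f\|_r=\sup_{u\in\mathcal{E}^{(0)}}\|\pi_u(f)\|$. *)

(* Defs.v *)
From HB Require Import structures.
From mathcomp Require Import all_boot all_order all_algebra.
From mathcomp Require Import complex.
From mathcomp Require Import all_classical all_reals all_analysis.

Set Implicit Arguments.
Unset Strict Implicit.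
Unset Printing Implicit Defensive.
Import Order.TTheory GRing.Theory Num.Theory.
Import numFieldNormedType.Exports.

Local Open Scope classical_set_scope.
Local Open Scope ring_scope.

(* [R[i]^o] carries the topology given by the modulus; [R[i]] alone carries
   none. *)
Notation C R := (R[i]^o)%type (only parsing).

Definition circle (R : realType) : set (C R) := [set z | `|z| = 1].

Section RelativeTopology.
Variables X Y : topologicalType.

Definition open_in (B A : set Y) := exists2 O, open O & A = B `&` O.

(* The last clause, openness of f from A onto B, is continuity of the inverse
   bijection. *)
Definition homeo_on (A : set X) (B : set Y) (f : X -> Y) :=
  [/\ set_bij A B f, {within A, continuous f} &
      forall O, open O -> open_in B (f @` (A `&` O))].

Definition local_homeo (B : set Y) (f : X -> Y) :=
  forall x, exists U, [/\ open U, U x, open_in B (f @` U) &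
                          homeo_on U (f @` U) f].

End RelativeTopology.

(* Units are identified with objects, so src and rng take values in G; mul is
   total, and only its values on composable pairs (src x = rng y) are
   meaningful. *)
Record groupoid (G : Type) := Groupoid {
  src : G -> G;
  rng : G -> G;
  mul : G -> G -> G;
  inv : G -> G;
  src_src : forall x, src (src x) = src x;
  rng_src : forall x, rng (src x) = src x;
  src_rng : forall x, src (rng x) = rng x;
  rng_rng : forall x, rng (rng x) = rng x;
  src_mul : forall x y, src x = rng y -> src (mul x y) = src y;
  rng_mul : forall x y, src x = rng y -> rng (mul x y) = rng x;
  mulA : forall x y z, src x = rng y -> src y = rng z ->
    mul (mul x y) z = mul x (mul y z);
  mul_rng : forall x, mul (rng x) x = x;
  mul_src : forall x, mul x (src x) = x;
  src_inv : forall x, src (inv x) = rng x;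
  rng_inv : forall x, rng (inv x) = src x;
  mul_inv : forall x, mul x (inv x) = rng x;
  inv_mul : forall x, mul (inv x) x = src x }.

Definition units (G : Type) (gG : groupoid G) : set G :=
  [set x | src gG x = x].

Definition composable (G : Type) (gG : groupoid G) : set (G * G) :=
  [set p | src gG p.1 = rng gG p.2].

Definition src_fibre (G : Type) (gG : groupoid G) (u : G) : set G :=
  [set x | src gG x = u].

Definition Iso (G : Type) (gG : groupoid G) : set G :=
  [set x | rng gG x = src gG x].

Section TopologicalGroupoid.
Variables (G : topologicalType) (gG : groupoid G).

Definition topological_groupoid :=
  {within composable gG, continuous (fun p : G * G => mul gG p.1 p.2)} /\
  continuous (inv gG).

Record hausdorff_etale : Prop := {
  etale_second_countable : @second_countable G;
  etale_locally_compact : locally_compact [set: G];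
  etale_hausdorff : hausdorff_space G;
  etale_topological : topological_groupoid;
  etale_rng : local_homeo (units gG) (rng gG);
  etale_src : local_homeo (units gG) (src gG) }.

Definition effective := interior (Iso gG) = units gG.

Definition invariant (U : set G) :=
  forall x, U (src gG x) -> U (rng gG x).

Definition minimal :=
  forall U : set G, open_in (units gG) U -> invariant U ->
    U = set0 \/ U = units gG.

End TopologicalGroupoid.

Section Twist.
Variables (R : realType) (G E : topologicalType).
Variables (gG : groupoid G) (gE : groupoid E).
Variables (i : G * C R -> E) (q : E -> G).

(* Only the values of i on units gG `*` circle are meaningful. Unit spaces are
   identified via q, so r(e) as a point of G^(0) is q (rng gE e). *)
Definition phase (z : C R) (e : E) : E := mul gE (i (q (rng gE e), z)) e.

Record twist : Prop := {
  twist_locally_compact : locally_compact [set: E];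
  twist_hausdorff : hausdorff_space E;
  twist_topological : topological_groupoid gE;
  twist_units : units gE = i @` (units gG `*` [set (1 : C R)]);
  twist_i_continuous : {within units gG `*` @circle R, continuous i};
  twist_i_hom : forall x z w, units gG x -> circle z -> circle w ->
    src gE (i (x, z)) = rng gE (i (x, w)) /\
    i (x, z * w) = mul gE (i (x, z)) (i (x, w));
  twist_i_units : homeo_on (units gG `*` [set (1 : C R)]) (units gE) i;
  twist_q_continuous : continuous q;
  twist_q_hom : forall a b, src gE a = rng gE b ->
    src gG (q a) = rng gG (q b) /\ q (mul gE a b) = mul gG (q a) (q b);
  twist_q_units : homeo_on (units gE) (units gG) q;
  twist_fibre : forall x, units gG x ->
    i @` ([set x] `*` @circle R) = q @^-1` [set x];
  twist_i_inj : set_inj (units gG `*` @circle R) i;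
  twist_q_surj : set_surj [set: E] [set: G] q;
  twist_locally_trivial : forall a : G, exists (U : set G) (P : G -> E),
    [/\ open U, U a, {within U, continuous P}, (forall b, U b -> q (P b) = b) &
        homeo_on (U `*` @circle R) (q @^-1` U)
          (fun p => mul gE (i (rng gG p.1, p.2)) (P p.1))];
  twist_central : forall e z, circle z ->
    mul gE (i (q (rng gE e), z)) e = mul gE e (i (q (src gE e), z)) }.

End Twist.

(* Measurable types in the library are pointed; here the point is supplied by
   the element at which the integral is based. The sigma-algebra is the Borel
   one whatever u is. *)
Definition pointed_at (E : topologicalType) (u : E) : Type := E.

HB.instance Definition _ (E : topologicalType) (u : E) :=
  Choice.on (pointed_at u).
HB.instance Definition _ (E : topologicalType) (u : E) :=
  isPointed.Build (pointed_at u) (u : E).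

Definition borel_at (E : topologicalType) (u : E) :=
  @g_sigma_algebraType (pointed_at u) (@open E).

HB.instance Definition _ (E : topologicalType) (u : E) :=
  Measurable.on (borel_at u).

(* Normalised Haar measure on the circle: image of Lebesgue measure on [0, 1[
   under t |-> exp (2 i pi t). *)
Definition haar (R : realType) (A : set (C R)) : \bar R :=
  lebesgue_measure [set t : R | 0 <= t < 1 /\
    A (cos (pi *+ 2 * t) +i* sin (pi *+ 2 * t))%C].

(* Data of a normed *-algebra whose elements are those of the set alg_car; no
   axiom is imposed, since only the instances defined below are used. *)
Record normed_star_alg (R : realType) := NormedStarAlg {
  alg_elt : Type;
  alg_car : set alg_elt;
  alg_zero : alg_elt;
  alg_add : alg_elt -> alg_elt -> alg_elt;
  alg_scale : R[i] -> alg_elt -> alg_elt;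
  alg_mul : alg_elt -> alg_elt -> alg_elt;
  alg_star : alg_elt -> alg_elt;
  alg_norm : alg_elt -> \bar R }.

Arguments alg_zero {R}.

Definition alg_dist (R : realType) (A : normed_star_alg R) (a b : alg_elt A) :
  \bar R := alg_norm (alg_add a (alg_scale (- 1) b)).

Section Simple.
Variables (R : realType) (A : normed_star_alg R).

Record two_sided_ideal (I : set (alg_elt A)) : Prop := {
  ideal_sub : I `<=` @alg_car R A;
  ideal0 : I (alg_zero A);
  idealD : forall a b, I a -> I b -> I (alg_add a b);
  idealZ : forall c a, I a -> I (alg_scale c a);
  idealMl : forall a b, alg_car a -> I b -> I (alg_mul a b);
  idealMr : forall a b, I a -> alg_car b -> I (alg_mul a b) }.

Definition norm_closed (I : set (alg_elt A)) :=
  forall a, alg_car a ->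
    (forall eps : R, 0 < eps -> exists2 b, I b & (alg_dist a b < eps%:E)%E) ->
    I a.

Definition simple :=
  forall I, two_sided_ideal I -> norm_closed I ->
    I = [set alg_zero A] \/ I = @alg_car R A.

End Simple.

(* Elements of the completion are the equivalence classes of Cauchy sequences
   modulo sequences tending to 0. *)
Section Completion.
Variables (R : realType) (A : normed_star_alg R).
Implicit Types (s t : nat -> alg_elt A) (a b : set (nat -> alg_elt A)).

Definition alg_cauchy s :=
  (forall n, alg_car (s n)) /\
  forall eps : R, 0 < eps -> exists N, forall m n, (N <= m)%N -> (N <= n)%N ->
    (alg_dist (s m) (s n) < eps%:E)%E.

Definition alg_equiv s t :=
  forall eps : R, 0 < eps -> exists N, forall n, (N <= n)%N ->
    (alg_dist (s n) (t n) < eps%:E)%E.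

Definition alg_class s := [set t | alg_cauchy t /\ alg_equiv s t].

Definition class_map (f : alg_elt A -> alg_elt A) a :=
  \bigcup_(s in a) alg_class (fun n => f (s n)).

Definition class_map2 (f : alg_elt A -> alg_elt A -> alg_elt A) a b :=
  \bigcup_(s in a) \bigcup_(t in b) alg_class (fun n => f (s n) (t n)).

(* The limit in the norm does not depend on the representative s of a; the
   infimum selects this common value. *)
Definition completion : normed_star_alg R := {|
  alg_elt := set (nat -> alg_elt A);
  alg_car := [set alg_class s | s in alg_cauchy];
  alg_zero := alg_class (fun=> alg_zero A);
  alg_add := class_map2 (@alg_add R A);
  alg_scale := fun c => class_map (alg_scale c);
  alg_mul := class_map2 (@alg_mul R A);
  alg_star := class_map (@alg_star R A);
  alg_norm := fun a =>
    ereal_inf [set limn (fun n => alg_norm (s n)) | s in a] |}.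

End Completion.

Section TwistedAlgebra.
Variables (R : realType) (G E : topologicalType).
Variables (gG : groupoid G) (gE : groupoid E).
Variables (i : G * C R -> E) (q : E -> G).
Implicit Types (f g xi : E -> C R) (u e : E).

Definition fibre_point u (x : G) : E := xget u (q @^-1` [set x]).

Definition lambda u (B : set E) : \bar R :=
  \esum_(x in src_fibre gG (q u))
    haar [set z | B (phase gE i q z (fibre_point u x))].

Definition integral_at u (h : E -> \bar R) : \bar R :=
  integral (T := borel_at u) (lambda u) (src_fibre gE u) h.

Definition cintegral_at u f : C R :=
  (fine (integral_at u (fun e => (complex.Re (f e))%:E)) +i*
   fine (integral_at u (fun e => (complex.Im (f e))%:E)))%C.

Definition equivariant_on (D : set E) f :=
  forall z e, circle z -> D e -> f (phase gE i q z e) = z * f e.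

Definition Sigma_c : set (E -> C R) :=
  [set f | [/\ continuous f, compact (closure [set e | f e != 0]) &
               equivariant_on [set: E] f]].

Definition conv f g : E -> C R := fun e =>
  cintegral_at (src gE e) (fun y => f (mul gE e (inv gE y)) * g y).

Definition star f : E -> C R := fun e => conjc (f (inv gE e)).

Definition l2norm u xi : \bar R :=
  sqrte (integral_at u
    (fun e => (complex.ComplexField.Normc.normc (xi e) ^+ 2)%:E)).

(* Vectors are represented by functions on E, of which only the restriction to
   E_u matters. No quotient by null functions is needed: the modulus of an
   equivariant function is constant on each fibre q^-1(x), which has measure
   1. *)
Definition L2 u : set (E -> C R) :=
  [set xi | [/\
    measurable_fun (T := borel_at u) (src_fibre gE u)
      (fun e => complex.Re (xi e)),
    measurable_fun (T := borel_at u) (src_fibre gE u)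
      (fun e => complex.Im (xi e)),
    equivariant_on (src_fibre gE u) xi &
    (l2norm u xi < +oo)%E]].

(* pi_u(f) xi = conv f xi on E_u. *)
Definition pi_norm u f : \bar R :=
  ereal_sup [set l2norm u (conv f xi) | xi in
              L2 u `&` [set xi | (l2norm u xi <= 1)%E]].

(* The supremum is taken in [0, +oo], so that it is 0 when E is empty. *)
Definition reduced_norm f : \bar R :=
  maxe 0%E (ereal_sup [set pi_norm u f | u in units gE]).

Definition Sigma_c_alg : normed_star_alg R := {|
  alg_elt := E -> C R;
  alg_car := Sigma_c;
  alg_zero := fun=> 0;
  alg_add := fun f g e => f e + g e;
  alg_scale := fun c f e => c * f e;
  alg_mul := conv;
  alg_star := star;
  alg_norm := reduced_norm |}.

Definition Cstar_r : normed_star_alg R := completion Sigma_c_alg.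

End TwistedAlgebra.

(* Main.v *)
Require Import Defs.
From mathcomp Require Import all_boot all_order all_algebra.
From mathcomp Require Import complex finmap.
From mathcomp Require Import ring lra.
From mathcomp Require Import all_classical all_reals all_analysis.
From mathcomp Require Import measurable_realfun.

(* A convolution is a finite sum over a fibre of G, and every element of the
   twisted algebra is a finite sum of functions supported over open bisections,
   on which it acts as a weighted partial translation.  This gives the algebra
   laws, the operator bounds, and the inequality |f(e)| <= ||f||.

   If U is a proper nonempty open invariant set of units, the operator norms
   over the units outside U define a second submultiplicative seminorm; its null
   space in the completion is a closed ideal that is neither zero nor everything.

   Conversely let N be the quotient norm by a nonzero closed ideal of the
   completion.  A nonzero element of the ideal has a nonzero value at some point,
   and a bisection moves this point to a unit u.  So there is f with
   N(f) < |f(u)| / 10.  As G is effective, there is a nonempty open set W of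
   units near u that no arrow of the support of f other than a unit maps to
   itself.  For a cutoff h supported in W the compression h f h is then
   f(u) h^2 up to a small error, hence N(h^2) < 1; if p is a function with
   h^2 p = p, then N(p) <= N(h^2) N(p) forces N(p) = 0.  So the ideal contains a
   nonzero function on the units.  By minimality the translates of such
   functions have no common zero; if one of them, k, does not vanish on the
   support of f, then f = k (f / k) lies in the ideal, and every element of the
   algebra is a finite sum of such f. *)

Set Implicit Arguments.
Unset Strict Implicit.
Unset Printing Implicit Defensive.
Import Order.TTheory GRing.Theory Num.Theory.
Import numFieldNormedType.Exports.
Import Defs.

Local Open Scope classical_set_scope.
Local Open Scope ring_scope.

(** No positivity, functional calculus or expectation onto the diagonal is used. That a nonzero
    element of the completion has a nonzero value rests on the fact that the values of a function
    are the matrix coefficients of the representations: a Cauchy sequence whose values all tend to 0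
    tends to 0 in norm. Everything is kept computable by finiteness. A compactly supported function
    meets each range fibre in finitely many circles, so it acts on every equivariant vector by
    finite sums, and norm estimates become estimates on finite blocks. Effectiveness enters twice:
    the units are open, being an interior; and a bisection off the units whose arrows over an open
    set all fixed their source would lie in the interior of the isotropy. A compact set off the
    units is covered by finitely many bisections, so finitely many shrinkings produce [W]; no single
    point with trivial isotropy has to be found. The factor 1/10 leaves room for crude bounds: the
    cutoff has norm at most 1 and is given the bound 2, so the compression divided by f(u) costs 2 *
    (1/10) * 2 = 4/10; the variation of f on [W] costs 1/5; the total 3/5 is below 1. *)

Local Notation normc := ComplexField.Normc.normc.

(** * Complex numbers *)

Section Modulus.
Variable R : realType.
Implicit Types z w : R[i].

Lemma normc_ge0 z : 0 <= normc z.
Proof. by case: z => a b /=; rewrite sqrtr_ge0. Qed.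

Lemma normr_normc z : `|z| = (normc z)%:C%C.
Proof. by case: z => a b; rewrite normc_def. Qed.

Lemma normc0 : normc (0 : R[i]) = 0.
Proof. exact: ComplexField.Normc.normc0. Qed.

Lemma normc1 : normc (1 : R[i]) = 1.
Proof. exact: ComplexField.Normc.normc1. Qed.

Lemma normcM z w : normc (z * w) = normc z * normc w.
Proof. exact: ComplexField.Normc.normcM. Qed.

Lemma normcD z w : normc (z + w) <= normc z + normc w.
Proof. exact: le_normcD. Qed.

Lemma normcN z : normc (- z) = normc z.
Proof. by case: z => a b /=; rewrite !sqrrN. Qed.

Lemma normcB z w : normc (z - w) = normc (w - z).
Proof. by rewrite -opprB normcN. Qed.

Lemma normcV z : normc z^-1 = (normc z)^-1.
Proof. exact: ComplexField.Normc.normcV. Qed.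

Lemma normc_eq0 z : (normc z == 0) = (z == 0).
Proof.
by apply/eqP/eqP => [/ComplexField.Normc.eq0_normc//|->]; rewrite normc0.
Qed.

Lemma normc_gt0 z : (0 < normc z) = (z != 0).
Proof. by rewrite lt_def normc_ge0 andbT normc_eq0. Qed.

Lemma normcJ z : normc (conjc z) = normc z.
Proof. by case: z => a b /=; rewrite sqrrN. Qed.

Lemma normc_real (x : R) : normc x%:C%C = `|x|.
Proof. by rewrite /= expr0n/= addr0 sqrtr_sqr. Qed.

Lemma mulcJ z : z * conjc z = (normc z ^+ 2)%:C%C.
Proof. by rewrite -sqr_normc normr_normc rmorphXn. Qed.

Lemma ge_normc_Re z : `|complex.Re z| <= normc z.
Proof. by have := normc_ge_Re z; rewrite normr_normc lecR. Qed.

Lemma ge_normc_Im z : `|complex.Im z| <= normc z.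
Proof.
case: z => a b /=; rewrite -sqrtr_sqr ler_sqrt ?addr_ge0 ?sqr_ge0//.
by rewrite lerDr sqr_ge0.
Qed.

Lemma le_normc_ReIm z : normc z <= `|complex.Re z| + `|complex.Im z|.
Proof.
case: z => a b /=; rewrite -[leRHS]ger0_norm ?addr_ge0// -sqrtr_sqr.
rewrite ler_sqrt ?sqr_ge0// sqrrD !real_normK ?num_real// lerD2r.
by rewrite lerDl mulrn_wge0// mulr_ge0.
Qed.

Lemma circleE z : circle (z : C R) <-> normc z = 1.
Proof.
by change (`|z : R[i]| = 1 <-> normc z = 1); rewrite normr_normc; split=> [[]//|->//].
Qed.

Lemma circle1 : circle (1 : C R).
Proof. by apply/circleE; rewrite normc1. Qed.

Lemma circleM z w : circle (z : C R) -> circle (w : C R) -> circle (z * w : C R).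
Proof. by move=> /circleE hz /circleE hw; apply/circleE; rewrite normcM hz hw mulr1. Qed.

Lemma circleV z : circle (z : C R) -> circle (z^-1 : C R).
Proof. by move=> /circleE hz; apply/circleE; rewrite normcV hz invr1. Qed.

Lemma circle_neq0 z : circle (z : C R) -> z != 0.
Proof. by move=> /circleE hz; rewrite -normc_eq0 hz oner_eq0. Qed.

End Modulus.

Section ComplexTopology.
Variable R : realType.

(** Balls of [C R] have radii in [R[i]]; a positive radius is real, so real radii and [normc]
    describe the same neighbourhoods. *)
Lemma near_normcP (z : C R) (P : set (C R)) :
  nbhs z P <-> exists2 e : R, 0 < e & forall w : C R, normc (z - w) < e -> P w.
Proof.
split.
  move=> /nbhs_ballP[e e0 h].
  have ereal : e \is Num.real by rewrite gtr0_real.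
  have eE : e = (complex.Re e)%:C%C by rewrite RRe_real.
  exists (complex.Re e); first by move: e0; rewrite eE /= ltcR.
  move=> w hw; apply: h; rewrite -ball_normE /=.
  by rewrite -[X in (X < _)%R]/(`|z - w : R[i]|) normr_normc eE ltcR.
move=> [e e0 h]; apply/nbhs_ballP; exists e%:C%C => /=; first by rewrite ltcR.
move=> w; rewrite -ball_normE /= => hw; apply: h.
by move: hw; rewrite -[X in (X < _)%R]/(`|z - w : R[i]|) normr_normc ltcR.
Qed.

Lemma cvg_normcP (T : Type) (F : set_system T) {FF : Filter F} (f : T -> C R) (z : C R) :
  f @ F --> z <-> forall e : R, 0 < e -> \forall x \near F, normc (z - f x) < e.
Proof.
split=> [fz e e0|h P /near_normcP[e e0 hP]].
  have /fz : nbhs z [set w : C R | normc (z - w) < e].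
    by apply/near_normcP; exists e.
  by [].
by rewrite /= nbhs_filterE; apply: filterS (h _ e0) => x; exact: hP.
Qed.

Lemma continuous_cplx (T : topologicalType) (f g : T -> R) x :
  {for x, continuous f} -> {for x, continuous g} ->
  {for x, continuous (fun y => (f y +i* g y)%C : C R)}.
Proof.
move=> cf cg; apply/cvg_normcP => e e0; have e2 : 0 < e / 2 by rewrite divr_gt0.
move/cvgrPdist_lt : cf => /(_ _ e2) h1; move/cvgrPdist_lt : cg => /(_ _ e2) h2.
apply: filterS2 h1 h2 => y h1 h2.
by apply: le_lt_trans (le_normc_ReIm _) _ => /=; rewrite [e]splitr ltrD.
Qed.

Lemma continuous_Re : continuous (fun z : C R => complex.Re z).
Proof.
move=> z; apply/(@cvgrPdist_lt _ _ _ (nbhs z)) => e e0; apply/near_normcP; exists e => // w.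
by apply: le_lt_trans; have := ge_normc_Re (z - w); rewrite raddfB.
Qed.

Lemma continuous_Im : continuous (fun z : C R => complex.Im z).
Proof.
move=> z; apply/(@cvgrPdist_lt _ _ _ (nbhs z)) => e e0.
apply/near_normcP; exists e => // w.
by apply: le_lt_trans; have := ge_normc_Im (z - w); rewrite raddfB.
Qed.

Lemma ler_dist_normc (z w : R[i]) : `|normc z - normc w| <= normc (z - w).
Proof.
rewrite ler_norml; apply/andP; split.
- rewrite lerNl opprB lerBlDr normcB.
  by have := normcD (w - z) z; rewrite subrK.
- by rewrite lerBlDr; have := normcD (z - w) w; rewrite subrK.
Qed.

Lemma continuous_normc : continuous (fun z : C R => normc z).
Proof.
move=> z; apply/(@cvgrPdist_lt _ _ _ (nbhs z)) => e e0.
apply/near_normcP; exists e => // w.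
by apply: le_lt_trans; exact: ler_dist_normc.
Qed.

Lemma continuous_conjc : continuous (fun z : C R => (conjc z : C R)).
Proof.
move=> z; apply/(@cvg_normcP _ (nbhs z)) => e e0.
apply/near_normcP; exists e => // w.
by rewrite -rmorphB normcJ.
Qed.

Lemma circle_compact : compact (@circle R).
Proof.
pose f (p : R * R) : C R := (p.1 +i* p.2)%C.
have cK : compact (f @` (`[-1, 1] `*` `[-1, 1])).
  apply: continuous_compact; last by apply: compact_setX; exact: segment_compact.
  apply: continuous_subspaceT => p; apply: continuous_cplx; [exact: cvg_fst|exact: cvg_snd].
apply: (subclosed_compact _ cK) => [|z /circleE z1].
  rewrite (_ : @circle R = (fun z : C R => normc z) @^-1` [set 1]).
    by apply: preimage_closed; [by move=> w _; exact: continuous_normc|exact: closed_eq].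
  by apply/seteqP; split=> z /=; rewrite circleE.
exists (complex.Re z, complex.Im z) => /=; last by case: (z).
by split; rewrite /= in_itv/= -ler_norml -z1; [exact: ge_normc_Re|exact: ge_normc_Im].
Qed.

End ComplexTopology.

(** * Completion of a normed algebra *)

Section NormedAlgebra.
Variables (R : realType) (V : lmodType R[i]).
Variables (car : set V) (prod : V -> V -> V).

Record is_algebra : Prop := {
  car0 : car 0;
  carD : forall f g, car f -> car g -> car (f + g);
  carZ : forall c f, car f -> car (c *: f);
  carM : forall f g, car f -> car g -> car (prod f g);
  prodDl : forall f g h, car f -> car g -> car h ->
    prod (f + g) h = prod f h + prod g h;
  prodDr : forall f g h, car f -> car g -> car h ->
    prod f (g + h) = prod f g + prod f h;
  prodZl : forall c f g, car f -> car g -> prod (c *: f) g = c *: prod f g;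
  prodZr : forall c f g, car f -> car g -> prod f (c *: g) = c *: prod f g }.

(** A seminorm, so that the record also covers the operator norm taken over the units outside an
    invariant set, whose kernel is what matters. *)
Record is_algnorm (nu : V -> R) : Prop := {
  nu_ge0 : forall f, 0 <= nu f;
  nuD : forall f g, car f -> car g -> nu (f + g) <= nu f + nu g;
  nuZ : forall c f, car f -> nu (c *: f) = normc c * nu f;
  nuM : forall f g, car f -> car g -> nu (prod f g) <= nu f * nu g }.

Hypothesis alg : is_algebra.

Let carB f g : car f -> car g -> car (f - g).
Proof.
by move=> cf cg; rewrite -scaleN1r; apply: (carD alg) => //; exact: (carZ alg).
Qed.

Section OneNorm.
Variables (nu : V -> R).
Hypothesis nuP : is_algnorm nu.

Lemma algnorm0 : nu 0 = 0.
Proof.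
by have := nuZ nuP 0 (car0 alg); rewrite scale0r normc0 mul0r.
Qed.

Lemma algnormN f : car f -> nu (- f) = nu f.
Proof.
by move=> cf; rewrite -scaleN1r (nuZ nuP)// normcN normc1 mul1r.
Qed.

Lemma algnormB f g : car f -> car g -> nu (f - g) = nu (g - f).
Proof. by move=> cf cg; rewrite -opprB algnormN//; exact: carB. Qed.

Lemma algnorm_triangle h f g : car f -> car g -> car h ->
  nu (f - g) <= nu (f - h) + nu (h - g).
Proof.
move=> cf cg ch; rewrite (_ : f - g = (f - h) + (h - g)).
  by apply: (nuD nuP); exact: carB.
by rewrite addrA subrK.
Qed.

Lemma algnorm_le_add f g : car f -> car g -> nu f <= nu (f - g) + nu g.
Proof.
by move=> cf cg; rewrite -[in X in X <= _](subrK g f); apply: (nuD nuP) => //; exact: carB.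
Qed.

End OneNorm.

Section Completion.
Variables (st : V -> V) (normE : V -> \bar R) (nu : V -> R).
Hypothesis nuP : is_algnorm nu.
Hypothesis normEE : forall f, car f -> normE f = (nu f)%:E.

(** Shaped so that for functions [E -> C R] it is convertible to [Sigma_c_alg]; the two criteria
    below then apply to [Cstar_r] directly. [nu] is the real-valued form of [normE] on [car]. *)
Let A : normed_star_alg R :=
  NormedStarAlg car 0 (fun f g => f + g) (fun c f => c *: f) prod st normE.

Implicit Types s t : nat -> V.

Let dist_nu f g : car f -> car g -> @alg_dist R A f g = (nu (f - g))%:E.
Proof. by move=> cf cg; rewrite /alg_dist/= scaleN1r normEE//; exact: carB. Qed.

Let cauchy s := (forall n, car (s n)) /\
  forall e : R, 0 < e -> exists N, forall m n, (N <= m)%N -> (N <= n)%N ->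
    nu (s m - s n) < e.

Let equivs s t := forall e : R, 0 < e -> exists N, forall n, (N <= n)%N ->
    nu (s n - t n) < e.

Let cauchyE s : @alg_cauchy R A s = cauchy s.
Proof.
rewrite propeqE; split=> -[cs h]; split=> // e /h[N hN]; exists N => m n Nm Nn.
  by have := hN _ _ Nm Nn; rewrite (dist_nu (cs m) (cs n)) lte_fin.
by rewrite (dist_nu (cs m) (cs n)) lte_fin; exact: hN.
Qed.

Let equivE s t : (forall n, car (s n)) -> (forall n, car (t n)) ->
  @alg_equiv R A s t = equivs s t.
Proof.
move=> cs ct; rewrite propeqE; split=> h e /h[N hN]; exists N => n Nn.
  by have := hN _ Nn; rewrite (dist_nu (cs n) (ct n)) lte_fin.
by rewrite (dist_nu (cs n) (ct n)) lte_fin; exact: hN.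
Qed.

Let equivs_sym s t : cauchy s -> cauchy t -> equivs s t -> equivs t s.
Proof.
move=> [cs _] [ct _] h e /h[N hN]; exists N => n Nn.
by rewrite (algnormB nuP)//; exact: hN.
Qed.

Let equivs_trans r s t : cauchy r -> cauchy s -> cauchy t ->
  equivs r s -> equivs s t -> equivs r t.
Proof.
move=> [cr _] [cs _] [ct _] h1 h2 e e0; have e2 : 0 < e / 2 by rewrite divr_gt0.
have [N1 hN1] := h1 _ e2; have [N2 hN2] := h2 _ e2.
exists (maxn N1 N2) => n; rewrite geq_max => /andP[n1 n2].
apply: le_lt_trans (algnorm_triangle nuP (cr n) (ct n) (cs n)) _.
by rewrite [e]splitr ltrD ?hN1 ?hN2.
Qed.

Let equivs_refl s : cauchy s -> equivs s s.
Proof. by move=> _ e e0; exists 0%N => n _; rewrite subrr (algnorm0 nuP). Qed.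

Let cls s : set (nat -> V) := @alg_class R A s.

Let clsE s : cauchy s -> cls s = [set t | cauchy t /\ equivs s t].
Proof.
move=> hs; apply/seteqP; split=> t /=; rewrite /cls /alg_class/= cauchyE => -[ct].
  by rewrite equivE//; [case: hs|case: ct].
by move=> h; split=> //; rewrite equivE//; [case: hs|case: ct].
Qed.

Let cls_self s : cauchy s -> cls s s.
Proof. by move=> hs; rewrite clsE//; split=> //; exact: equivs_refl. Qed.

Let cls_cauchy s t : cauchy s -> cls s t -> cauchy t.
Proof. by move=> hs; rewrite clsE// => -[]. Qed.

Let cls_equiv s t : cauchy s -> cls s t -> equivs s t.
Proof. by move=> hs; rewrite clsE// => -[]. Qed.

Let cls_eq s t : cauchy s -> cauchy t -> equivs s t -> cls s = cls t.
Proof.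
move=> hs ht hst; rewrite !clsE//; apply/seteqP; split=> r /= [hr h]; split=> //.
  by apply: (equivs_trans ht hs) => //; exact: equivs_sym.
by apply: (equivs_trans hs ht).
Qed.

Let cauchy_cst f : car f -> cauchy (fun=> f).
Proof.
by move=> cf; split=> // e e0; exists 0%N => ? ? _ _; rewrite subrr (algnorm0 nuP).
Qed.

Let cauchyD s t : cauchy s -> cauchy t -> cauchy (fun n => s n + t n).
Proof.
move=> [cs hs] [ct ht]; split=> [n|e e0]; first exact: (carD alg).
have e2 : 0 < e / 2 by rewrite divr_gt0.
have [N1 hN1] := hs _ e2; have [N2 hN2] := ht _ e2.
exists (maxn N1 N2) => m n; rewrite !geq_max => /andP[m1 m2] /andP[n1 n2].
rewrite opprD addrACA; apply: le_lt_trans (nuD nuP _ _) _; [exact: carB|exact: carB|].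
by rewrite [e]splitr ltrD ?hN1 ?hN2.
Qed.

Let equivsD s t s' t' : cauchy s -> cauchy t -> cauchy s' -> cauchy t' ->
  equivs s s' -> equivs t t' -> equivs (fun n => s n + t n) (fun n => s' n + t' n).
Proof.
move=> [cs _] [ct _] [cs' _] [ct' _] hs ht e e0.
have e2 : 0 < e / 2 by rewrite divr_gt0.
have [N1 hN1] := hs _ e2; have [N2 hN2] := ht _ e2.
exists (maxn N1 N2) => n; rewrite geq_max => /andP[m1 m2].
rewrite opprD addrACA; apply: le_lt_trans (nuD nuP _ _) _; [exact: carB|exact: carB|].
by rewrite [e]splitr ltrD ?hN1 ?hN2.
Qed.

Let scale_small (c : R[i]) (e : R) : 0 < e ->
  exists2 d, 0 < d & forall x, x < d -> normc c * x < e.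
Proof.
(* The added 1 keeps the denominator positive when [c] is 0. *)
move=> e0; have c1 : 0 < normc c + 1 by rewrite ltr_wpDl ?normc_ge0.
exists (e / (normc c + 1)) => [|x]; first by rewrite divr_gt0.
rewrite ltr_pdivlMr// => xe.
have [x0|x0] := leP x 0; first by rewrite (le_lt_trans _ e0)// mulr_ge0_le0 ?normc_ge0.
by apply: le_lt_trans xe; rewrite mulrDr mulr1 mulrC lerDl ltW.
Qed.

Let cauchyZ c s : cauchy s -> cauchy (fun n => c *: s n).
Proof.
move=> [cs hs]; split=> [n|e e0]; first exact: (carZ alg).
have [d d0 hd] := scale_small c e0; have [N hN] := hs _ d0.
exists N => m n Nm Nn; rewrite -scalerBr (nuZ nuP) ?hd ?hN//; exact: carB.
Qed.

Let equivsZ c s t : cauchy s -> cauchy t -> equivs s t ->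
  equivs (fun n => c *: s n) (fun n => c *: t n).
Proof.
move=> [cs _] [ct _] hs e e0.
have [d d0 hd] := scale_small c e0; have [N hN] := hs _ d0.
exists N => n Nn; rewrite -scalerBr (nuZ nuP) ?hd ?hN//; exact: carB.
Qed.

Let cauchy_bounded s : cauchy s -> exists2 M : R, 0 < M &
  exists N, forall n, (N <= n)%N -> nu (s n) < M.
Proof.
move=> [cs hs]; have [N hN] := hs _ ltr01.
exists (nu (s N) + 1); first by rewrite ltr_wpDl ?(nu_ge0 nuP).
exists N => n Nn; apply: le_lt_trans (algnorm_le_add nuP (cs n) (cs N)) _.
by rewrite addrC ltrD2l hN.
Qed.

(** From fg - f'g' = f(g - g') + (f - f')g'. Only [f] and [g'] have to be bounded when the
    differences tend to 0. *)
Let prodB_nu (nu' : V -> R) f g f' g' : is_algnorm nu' ->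
  car f -> car g -> car f' -> car g' ->
  nu' (prod f g - prod f' g') <= nu' f * nu' (g - g') + nu' (f - f') * nu' g'.
Proof.
move=> nuP' cf cg cf' cg'.
have -> : prod f g - prod f' g' = prod f (g - g') + prod (f - f') g'.
  rewrite -!(scaleN1r f') -(scaleN1r g').
  rewrite (prodDr alg)// ?(prodDl alg)//; [|exact: (carZ alg)..].
  rewrite (prodZl alg)// (prodZr alg)// !scaleN1r.
  by rewrite addrA subrK.
apply: le_trans (nuD nuP' _ _) _; [by apply: (carM alg) => //; exact: carB..|].
by rewrite lerD// (nuM nuP')//; exact: carB.
Qed.

Let cauchyM s t : cauchy s -> cauchy t -> cauchy (fun n => prod (s n) (t n)).
Proof.
move=> hs ht; have [M M0 [N1 hN1]] := cauchy_bounded hs.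
have [K K0 [N2 hN2]] := cauchy_bounded ht.
case: hs ht => [cs hs] [ct ht]; split=> [n|e e0]; first exact: (carM alg).
have eK : 0 < e / 2 / K by rewrite !divr_gt0.
have eM : 0 < e / 2 / M by rewrite !divr_gt0.
have [N3 hN3] := hs _ eK; have [N4 hN4] := ht _ eM.
exists (maxn (maxn N1 N2) (maxn N3 N4)) => m n.
rewrite !geq_max => /andP[/andP[m1 m2] /andP[m3 m4]] /andP[/andP[n1 n2] /andP[n3 n4]].
apply: le_lt_trans (prodB_nu nuP (cs _) (ct _) (cs _) (ct _)) _.
rewrite [e]splitr; apply: ltrD.
  apply: (@le_lt_trans _ _ (M * nu (t m - t n))).
    by rewrite ler_wpM2r ?(nu_ge0 nuP)// ltW ?hN1.
  by rewrite mulrC -ltr_pdivlMr ?hN4.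
apply: (@le_lt_trans _ _ (nu (s m - s n) * K)).
  by rewrite ler_wpM2l ?(nu_ge0 nuP)// ltW ?hN2.
by rewrite -ltr_pdivlMr ?hN3.
Qed.

Let equivsM s t s' t' : cauchy s -> cauchy t -> cauchy s' -> cauchy t' ->
  equivs s s' -> equivs t t' ->
  equivs (fun n => prod (s n) (t n)) (fun n => prod (s' n) (t' n)).
Proof.
move=> hs ht hs' ht' es et; have [M M0 [N1 hN1]] := cauchy_bounded hs.
have [K K0 [N2 hN2]] := cauchy_bounded ht' => e e0.
case: hs ht hs' ht' => [cs _] [ct _] [cs' _] [ct' _].
have eK : 0 < e / 2 / K by rewrite !divr_gt0.
have eM : 0 < e / 2 / M by rewrite !divr_gt0.
have [N3 hN3] := es _ eK; have [N4 hN4] := et _ eM.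
exists (maxn (maxn N1 N2) (maxn N3 N4)) => n.
rewrite !geq_max => /andP[/andP[m1 m2] /andP[m3 m4]].
apply: le_lt_trans (prodB_nu nuP (cs _) (ct _) (cs' _) (ct' _)) _.
rewrite [e]splitr; apply: ltrD.
  apply: (@le_lt_trans _ _ (M * nu (t n - t' n))).
    by rewrite ler_wpM2r ?(nu_ge0 nuP)// ltW ?hN1.
  by rewrite mulrC -ltr_pdivlMr ?hN4.
apply: (@le_lt_trans _ _ (nu (s n - s' n) * K)).
  by rewrite ler_wpM2l ?(nu_ge0 nuP)// ltW ?hN2.
by rewrite -ltr_pdivlMr ?hN3.
Qed.

Let class_mapE (op : V -> V) s : cauchy s ->
  (forall s, cauchy s -> cauchy (fun n => op (s n))) ->
  (forall s t, cauchy s -> cauchy t -> equivs s t ->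
     equivs (fun n => op (s n)) (fun n => op (t n))) ->
  @class_map R A op (cls s) = cls (fun n => op (s n)).
Proof.
move=> hs c1 e1; rewrite /class_map; apply/seteqP; split=> [r [t]|r hr].
  move=> ht; have ct := cls_cauchy hs ht.
  rewrite -[alg_class _]/(cls (fun n => op (t n))).
  rewrite (cls_eq (c1 _ ct) (c1 _ hs))//.
  by apply: e1 => //; apply: equivs_sym => //; exact: cls_equiv.
by exists s => //; exact: cls_self.
Qed.

Let class_map2E (op : V -> V -> V) s t : cauchy s -> cauchy t ->
  (forall s t, cauchy s -> cauchy t -> cauchy (fun n => op (s n) (t n))) ->
  (forall s t s' t', cauchy s -> cauchy t -> cauchy s' -> cauchy t' ->
     equivs s s' -> equivs t t' ->
     equivs (fun n => op (s n) (t n)) (fun n => op (s' n) (t' n))) ->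
  @class_map2 R A op (cls s) (cls t) = cls (fun n => op (s n) (t n)).
Proof.
move=> hs ht c1 e1; rewrite /class_map2; apply/seteqP; split=> [r [s' hs'] [t' ht']|r hr].
  have cs := cls_cauchy hs hs'; have ct := cls_cauchy ht ht'.
  rewrite -[alg_class _]/(cls (fun n => op (s' n) (t' n))).
  rewrite (cls_eq (c1 _ _ cs ct) (c1 _ _ hs ht))//.
  by apply: e1 => //; apply: equivs_sym => //; exact: cls_equiv.
by exists s; [exact: cls_self|exists t => //; exact: cls_self].
Qed.

Let B := completion A.

Let addB s t : cauchy s -> cauchy t ->
  @alg_add R B (cls s) (cls t) = cls (fun n => s n + t n).
Proof. by move=> hs ht; apply: (class_map2E (op := fun f g => f + g)). Qed.

Let scaleB c s : cauchy s -> @alg_scale R B c (cls s) = cls (fun n => c *: s n).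
Proof.
move=> hs; apply: (class_mapE (op := fun f => c *: f)) => //.
- by move=> *; exact: cauchyZ.
- by move=> *; exact: equivsZ.
Qed.

Let mulB s t : cauchy s -> cauchy t ->
  @alg_mul R B (cls s) (cls t) = cls (fun n => prod (s n) (t n)).
Proof. by move=> hs ht; apply: class_map2E. Qed.

Let carBE a : @alg_car R B a <-> exists2 s, cauchy s & cls s = a.
Proof. by split=> -[s hs <-]; exists s => //; rewrite ?cauchyE// -?cauchyE. Qed.

Let cauchyBs s t : cauchy s -> cauchy t -> cauchy (fun n => s n - t n).
Proof.
move=> hs ht; have := cauchyD hs (cauchyZ (-1) ht).
by under [X in cauchy X]eq_fun do rewrite scaleN1r.
Qed.

Let distB s t : cauchy s -> cauchy t ->
  @alg_dist R B (cls s) (cls t) = @alg_norm R B (cls (fun n => s n - t n)).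
Proof.
move=> hs ht; rewrite /alg_dist scaleB// addB//; last exact: cauchyZ.
by congr (@alg_norm R B (cls _)); apply/funext => n; rewrite scaleN1r.
Qed.

Let cvg_nu s : cauchy s -> cvgn (fun n => nu (s n)).
Proof.
move=> [cs hs]; apply/cauchy_cvgP/cauchy_ballP => e e0; near_simpl.
have [N hN] := hs _ e0; exists ([set n | (N <= n)%N], [set n | (N <= n)%N]).
  by split; exists N.
move=> [m n] [Nm Nn]; rewrite -ball_normE /= ltr_norml; apply/andP; split.
- rewrite ltrNl opprB; apply: le_lt_trans (hN _ _ Nn Nm).
  by rewrite lerBlDr (algnorm_le_add nuP).
- apply: le_lt_trans (hN _ _ Nm Nn).
  by rewrite lerBlDr (algnorm_le_add nuP).
Qed.

Let limnE s : cauchy s ->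
  limn (fun n => normE (s n)) = (limn (fun n => nu (s n)))%:E.
Proof.
move=> hs; rewrite -EFin_lim; last exact: cvg_nu.
by congr (limn _); apply/funext => n /=; rewrite normEE//; case: hs.
Qed.

Let normB_lt s (e : R) : cauchy s -> 0 < e ->
  (exists N, forall n, (N <= n)%N -> nu (s n) <= e / 2) ->
  (@alg_norm R B (cls s) < e%:E)%E.
Proof.
move=> hs e0 [N hN]; apply: (@le_lt_trans _ _ (limn (fun n => normE (s n)))).
  by apply: ereal_inf_lbound; exists s => //; exact: cls_self.
rewrite limnE// lte_fin; apply: (@le_lt_trans _ _ (e / 2)).
  by apply: limr_le; [exact: cvg_nu|exists N].
by rewrite ltr_pdivrMr// mulr_natr mulr2n ltrDl.
Qed.

Let normB_ltP s (e : R) : cauchy s -> (@alg_norm R B (cls s) < e%:E)%E ->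
  exists N, forall n, (N <= n)%N -> nu (s n) < e.
Proof.
move=> hs /ereal_inf_lt[_ [r hr <-]].
have cr := cls_cauchy hs hr; rewrite limnE// lte_fin => h.
set l := limn _ in h.
(* The gap between the limit [l] and [e] is split at its midpoint: one half for [r] approaching [l],
   the other for the distance from [s] to [r]. *)
have [N1 _ hN1] : \forall n \near \oo, nu (r n) < (l + e) / 2.
  by apply: (cvgr_lt l); [exact: cvg_nu|rewrite midf_lt].
have e2 : 0 < (e - l) / 2 by rewrite divr_gt0// subr_gt0.
have [N2 hN2] := cls_equiv hs hr e2.
exists (maxn N1 N2) => n; rewrite geq_max => /andP[n1 n2].
apply: le_lt_trans (algnorm_le_add nuP (hs.1 n) (cr.1 n)) _.
have -> : e = (e - l) / 2 + (l + e) / 2 by field.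
by rewrite ltrD ?hN1 ?hN2.
Qed.

Let eps_eq0 (x : R) : 0 <= x -> (forall e, 0 < e -> x < e) -> x = 0.
Proof.
move=> x0 h; apply/eqP; rewrite eq_le x0 andbT leNgt.
by apply/negP => /h; rewrite ltxx.
Qed.

Let tends0 (mu : V -> R) s :=
  forall e : R, 0 < e -> exists N, forall n, (N <= n)%N -> mu (s n) < e.

(** Being dominated by [nu], the seminorm [mu] extends to the completion, where its null space is a
    closed ideal [I]. The two alternatives of simplicity are then read off on constant sequences. *)
Lemma simple_seminorm (mu : V -> R) : is_algnorm mu ->
  (forall f, car f -> mu f <= nu f) -> simple (completion A) ->
  (forall f, car f -> mu f = 0 -> nu f = 0) \/ (forall f, car f -> mu f = 0).
Proof.
move=> muP munu simB.
pose I : set (alg_elt B) :=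
  [set a | exists2 s, cauchy s /\ tends0 mu s & cls s = a].
have cauchy_mubd s : cauchy s -> exists2 M : R, 0 < M &
    exists N, forall n, (N <= n)%N -> mu (s n) <= M.
  move=> hs; have [M M0 [N hN]] := cauchy_bounded hs; exists M => //; exists N => n Nn.
  by apply: le_trans (munu _ (hs.1 n)) _; rewrite ltW ?hN.
have idI : two_sided_ideal I.
  split.
  - by move=> a [s [hs _] <-]; apply/carBE; exists s.
  - exists (fun=> 0); last by [].
    split; first exact/cauchy_cst/(car0 alg).
    by move=> e e0; exists 0%N => n _; rewrite (algnorm0 muP).
  - move=> _ _ [s [hs s0] <-] [t [ht t0] <-]; rewrite addB//.
    exists (fun n => s n + t n) => //; split; first exact: cauchyD.
    move=> e e0; have e2 : 0 < e / 2 by rewrite divr_gt0.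
    have [N1 hN1] := s0 _ e2; have [N2 hN2] := t0 _ e2.
    exists (maxn N1 N2) => n; rewrite geq_max => /andP[n1 n2].
    apply: le_lt_trans (nuD muP (hs.1 n) (ht.1 n)) _.
    by rewrite [e]splitr ltrD ?hN1 ?hN2.
  - move=> c _ [s [hs s0] <-]; rewrite scaleB//.
    exists (fun n => c *: s n) => //; split; first exact: cauchyZ.
    move=> e e0; have [d d0 hd] := scale_small c e0.
    have [N hN] := s0 _ d0; exists N => n Nn.
    by rewrite (nuZ muP _ (hs.1 n)) hd// hN.
  - move=> _ _ /carBE[s hs <-] [t [ht t0] <-]; rewrite mulB//.
    exists (fun n => prod (s n) (t n)) => //; split; first exact: cauchyM.
    have [M M0 [N1 hN1]] := cauchy_mubd _ hs.
    move=> e e0; have [N2 hN2] := t0 (e / M) (divr_gt0 e0 M0).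
    exists (maxn N1 N2) => n; rewrite geq_max => /andP[n1 n2].
    apply: le_lt_trans (nuM muP (hs.1 n) (ht.1 n)) _.
    apply: (@le_lt_trans _ _ (M * mu (t n))).
      by rewrite ler_wpM2r ?(nu_ge0 muP) ?hN1.
    by rewrite mulrC -ltr_pdivlMr ?hN2.
  - move=> _ _ [t [ht t0] <-] /carBE[s hs <-]; rewrite mulB//.
    exists (fun n => prod (t n) (s n)) => //; split; first exact: cauchyM.
    have [M M0 [N1 hN1]] := cauchy_mubd _ hs.
    move=> e e0; have [N2 hN2] := t0 (e / M) (divr_gt0 e0 M0).
    exists (maxn N1 N2) => n; rewrite geq_max => /andP[n1 n2].
    apply: le_lt_trans (nuM muP (ht.1 n) (hs.1 n)) _.
    apply: (@le_lt_trans _ _ (mu (t n) * M)).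
      by rewrite ler_wpM2l ?(nu_ge0 muP) ?hN1.
    by rewrite -ltr_pdivlMr ?hN2.
have clI : norm_closed I.
  move=> _ /carBE[s hs <-] h; exists s => //; split=> // e e0.
  have e2 : 0 < e / 2 by rewrite divr_gt0.
  have [_ [t [ht t0] <-]] := h _ e2; rewrite distB// => /(normB_ltP (cauchyBs hs ht)).
  move=> [N1 hN1]; have [N2 hN2] := t0 _ e2.
  exists (maxn N1 N2) => n; rewrite geq_max => /andP[n1 n2].
  apply: le_lt_trans (algnorm_le_add muP (hs.1 n) (ht.1 n)) _.
  rewrite [e]splitr ltrD ?hN2//; apply: le_lt_trans (hN1 _ n1).
  by apply: munu; apply: carB; [exact: hs.1|exact: ht.1].
have [I0|IT] := simB _ idI clI; [left=> f cf f0|right=> f cf].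
  have : I (cls (fun=> f)).
    exists (fun=> f) => //; split; first exact: cauchy_cst.
    by move=> e e0; exists 0%N => n _; rewrite f0.
  rewrite I0 => /= Ef; have := cls_self (cauchy_cst cf); rewrite Ef.
  move/(cls_equiv (cauchy_cst (car0 alg))) => h.
  apply: eps_eq0 => [|e /h[N /(_ _ (leqnn N))]]; first exact: (nu_ge0 nuP).
  by rewrite sub0r (algnormN nuP).
have : I (cls (fun=> f)) by rewrite IT; apply/carBE; exists (fun=> f) => //; exact: cauchy_cst.
move=> [s [hs s0] Es]; have := cls_self (cauchy_cst cf); rewrite -Es.
move/(cls_equiv hs) => h; apply: eps_eq0 => [|e e0]; first exact: (nu_ge0 muP).
have e2 : 0 < e / 2 by rewrite divr_gt0.
have [N1 hN1] := s0 _ e2; have [N2 hN2] := h _ e2.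
have := algnorm_le_add muP cf (hs.1 (maxn N1 N2)); move/le_lt_trans; apply.
rewrite [e]splitr addrC ltrD ?hN1 ?leq_maxl// (algnormB muP cf (hs.1 _)).
apply: le_lt_trans (hN2 _ (leq_maxr N1 N2)).
by apply: munu; apply: carB => //; exact: hs.1.
Qed.

(* [Q f e] stands for: the norm of the image of [f] in a quotient by a closed
   ideal of the completion is less than [e]. *)
Record is_quotnorm (Q : V -> R -> Prop) : Prop := {
  quot_car : forall f a, Q f a -> car f;
  quotD : forall f g a b, Q f a -> Q g b -> Q (f + g) (a + b);
  quotZ : forall c f a, c != 0 -> Q f a -> Q (c *: f) (normc c * a);
  quotM : forall f g a b, Q f a -> Q g b -> Q (prod f g) (a * b);
  quot_norm : forall f a, car f -> nu f < a -> Q f a }.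

(** For a nonzero closed ideal [I], [Q f e] is taken to mean that some element of [I] is at distance
    less than [e] from [f]. The sequence [s] represents a nonzero element of [I]. Once all of [car]
    is arbitrarily close to [I], so is the completion, and closedness of [I] concludes. *)
Lemma simple_criterion :
  (forall Q, is_quotnorm Q ->
    (exists s, [/\ forall n, car (s n),
      forall e : R, 0 < e -> exists N, forall m n, (N <= m)%N -> (N <= n)%N ->
        nu (s m - s n) < e,
      ~ (forall e : R, 0 < e -> exists N, forall n, (N <= n)%N -> nu (s n) < e) &
      forall e : R, 0 < e -> exists N, forall n, (N <= n)%N -> Q (s n) e]) ->
    forall f e, car f -> 0 < e -> Q f e) ->
  simple (completion A).
Proof.
move=> crit I idI clI.
have [I0|] := pselect (I `<=` [set alg_zero B]).
  by left; apply/seteqP; split=> // _ ->; exact: (ideal0 idI).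
move=> /existsNP[a /not_implyP[Ia a0]]; right; apply/seteqP; split; first exact: (ideal_sub idI).
have /carBE[s hs Es] := ideal_sub idI Ia.
pose Q f e := car f /\ exists2 s, cauchy s /\ I (cls s) &
    exists N, forall n, (N <= n)%N -> nu (f - s n) < e.
have QP : is_quotnorm Q.
  split.
  - by move=> f e [].
  - move=> f g a1 b1 [cf [s1 [hs1 I1] [N1 hN1]]] [cg [s2 [hs2 I2] [N2 hN2]]].
    split; first exact: (carD alg).
    exists (fun n => s1 n + s2 n).
      by split; [exact: cauchyD|rewrite -addB//; exact: (idealD idI)].
    exists (maxn N1 N2) => n; rewrite geq_max => /andP[n1 n2].
    rewrite opprD addrACA; apply: le_lt_trans (nuD nuP _ _) _.
    + by apply: carB => //; exact: hs1.1.
    + by apply: carB => //; exact: hs2.1.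
    + by rewrite ltrD ?hN1 ?hN2.
  - move=> c f a1 c0 [cf [s1 [hs1 I1] [N1 hN1]]]; split; first exact: (carZ alg).
    exists (fun n => c *: s1 n).
      by split; [exact: cauchyZ|rewrite -scaleB//; exact: (idealZ idI)].
    exists N1 => n n1; rewrite -scalerBr (nuZ nuP) ?ltr_pM2l ?normc_gt0 ?hN1//.
    by apply: carB => //; exact: hs1.1.
  - move=> f g a1 b1 [cf [s1 [hs1 I1] [N1 hN1]]] [cg [s2 [hs2 I2] [N2 hN2]]].
    split; first exact: (carM alg).
    have hf := cauchy_cst cf; have hg := cauchy_cst cg.
    (* Chosen so that fg - w = (f - s1)(g - s2); each of the three products in [w] has a factor from
       the ideal. *)
    pose w n := prod f (s2 n) + (prod (s1 n) g - prod (s1 n) (s2 n)).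
    have cI1 : @alg_car R B (cls s1) by apply/carBE; exists s1.
    have cIf : @alg_car R B (cls (fun=> f)) by apply/carBE; exists (fun=> f).
    have cIg : @alg_car R B (cls (fun=> g)) by apply/carBE; exists (fun=> g).
    have h12 := cauchyM hs1 hs2; have h1g := cauchyM hs1 hg; have hf2 := cauchyM hf hs2.
    have hN12 := cauchyZ (-1) h12.
    have wE : w = (fun n => prod f (s2 n) + (prod (s1 n) g + (-1) *: prod (s1 n) (s2 n))).
      by apply/funext => n; rewrite scaleN1r.
    exists w.
      rewrite wE; split; first by apply: cauchyD => //; exact: cauchyD.
      rewrite -(addB hf2 (cauchyD h1g hN12)) -(addB h1g hN12) -(scaleB (-1) h12).
      rewrite -(mulB hs1 hs2) -(mulB hs1 hg) -(mulB hf hs2).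
      apply: (idealD idI); first exact: (idealMl idI cIf I2).
      apply: (idealD idI); first exact: (Defs.idealMr idI I1 cIg).
      by apply: (idealZ idI); exact: (idealMl idI cI1 I2).
    exists (maxn N1 N2) => n; rewrite geq_max => /andP[n1 n2].
    have c1 := hs1.1 n; have c2 := hs2.1 n.
    have -> : prod f g - w n = prod (f - s1 n) (g - s2 n).
      have hB x y z : car x -> car y -> car z -> prod (x - y) z = prod x z - prod y z.
        move=> cx cy cz; have cN : car (- y) by rewrite -scaleN1r; exact: (carZ alg).
        by rewrite (prodDl alg cx cN cz) -[X in _ + prod X z]scaleN1r (prodZl alg _ cy cz) scaleN1r.
      have hB' x y z : car x -> car y -> car z -> prod x (y - z) = prod x y - prod x z.
        move=> cx cy cz; have cN : car (- z) by rewrite -scaleN1r; exact: (carZ alg).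
        by rewrite (prodDr alg cx cy cN) -[X in _ + prod x X]scaleN1r (prodZr alg _ cx cz) scaleN1r.
      rewrite hB ?hB'//; last exact: carB.
      by rewrite /w !opprD !opprK !addrA.
    apply: le_lt_trans (nuM nuP _ _) _; [exact: carB|exact: carB|].
    by rewrite ltr_pM ?(nu_ge0 nuP) ?hN1 ?hN2.
  - move=> f a1 cf fa; split=> //; exists (fun=> 0).
      by split; [exact/cauchy_cst/(car0 alg)|exact: (ideal0 idI)].
    by exists 0%N => n _; rewrite subr0.
have QT : forall f e, car f -> 0 < e -> Q f e.
  apply: crit => //; exists s; split; [exact: hs.1|exact: hs.2| |].
    move=> s0; apply: a0 => /=; rewrite -Es; apply: cls_eq => //.
      exact/cauchy_cst/(car0 alg).
    by move=> e /s0[N hN]; exists N => n Nn; rewrite subr0 hN.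
  move=> e /(hs.2)[N hN]; exists N => n Nn; split; first exact: hs.1.
  exists s; first by rewrite Es; split.
  by exists N => m Nm; exact: hN.
move=> b cb; have /carBE[t ht Et] := cb; apply: clI => // e e0.
(* Two quarters add up to the bound [e / 2] that [normB_lt] requires of the terms. *)
have e4 : 0 < e / 4 by rewrite divr_gt0.
have [N1 hN1] := ht.2 _ e4.
have [_ [r [hr Ir] [N2 hN2]]] := QT _ _ (ht.1 N1) e4.
exists (cls r) => //; rewrite -Et distB//; apply: normB_lt => //; first exact: cauchyBs.
exists (maxn N1 N2) => n; rewrite geq_max => /andP[n1 n2].
apply: le_trans (algnorm_triangle nuP (ht.1 n) (hr.1 n) (ht.1 N1)) _.
have -> : e / 2 = e / 4 + e / 4 by field.
by rewrite lerD ?ltW ?hN1 ?hN2.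
Qed.

End Completion.
End NormedAlgebra.

(** * Groupoids and twists *)

Section Groupoid.
Variables (G : Type) (gG : groupoid G).
Local Notation s := (src gG).
Local Notation r := (rng gG).
Local Notation m := (mul gG).
Local Notation v := (inv gG).

Lemma units_src x : units gG (s x). Proof. exact: src_src. Qed.
Lemma units_rng x : units gG (r x). Proof. exact: src_rng. Qed.
Lemma rng_unit x : units gG x -> r x = x.
Proof. by move=> xu; rewrite -[in LHS]xu rng_src xu. Qed.
Hint Resolve units_src units_rng : core.

Lemma mulKg x y : s x = r y -> m (v x) (m x y) = y.
Proof.
by move=> h; rewrite -mulA ?src_inv// ?inv_mul ?h ?mul_rng.
Qed.

Lemma mulgK x y : s x = r y -> m (m x y) (v y) = x.
Proof. by move=> h; rewrite mulA ?rng_inv// mul_inv -h mul_src. Qed.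

Lemma mulgKV x y : s x = s y -> m (m x (v y)) y = x.
Proof. by move=> h; rewrite mulA ?src_inv ?rng_inv// inv_mul -h mul_src. Qed.

Lemma mulKVg x y : r x = r y -> m x (m (v x) y) = y.
Proof. by move=> h; rewrite -mulA ?src_inv ?rng_inv// mul_inv h mul_rng. Qed.

Lemma mulgI x y z : s x = r y -> s x = r z -> m x y = m x z -> y = z.
Proof. by move=> h1 h2 /(congr1 (m (v x))); rewrite !mulKg. Qed.

Lemma mulIg x y z : s x = r z -> s y = r z -> m x z = m y z -> x = y.
Proof. by move=> h1 h2 /(congr1 (m^~ (v z))); rewrite !mulgK. Qed.

Lemma inv_uniq x y : s x = r y -> m x y = r x -> y = v x.
Proof. by move=> h1 h2; apply: (@mulgI x); rewrite ?rng_inv// h2 mul_inv. Qed.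

Lemma inv_inv x : v (v x) = x.
Proof. by apply/esym/inv_uniq; rewrite ?src_inv// inv_mul rng_inv. Qed.

Lemma inv_unit x : units gG x -> v x = x.
Proof.
move=> xu; apply/esym/inv_uniq; first by rewrite rng_unit.
by rewrite -[X in m _ X]xu mul_src rng_unit.
Qed.

Lemma invM x y : s x = r y -> v (m x y) = m (v y) (v x).
Proof.
move=> h; have h' : s (v y) = r (v x) by rewrite src_inv rng_inv.
apply/esym/inv_uniq; first by rewrite src_mul// rng_mul// rng_inv.
have h1 : s (m x y) = r (v y) by rewrite src_mul// rng_inv.
by rewrite -(mulA h1 h') mulgK// mul_inv rng_mul.
Qed.

Lemma idem_unit x : s x = r x -> m x x = x -> units gG x.
Proof.
move=> h e; have := mulKg h; rewrite e inv_mul; exact.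
Qed.

End Groupoid.

(** * Phases and the fibres of [q] *)

Section TwistAlgebra.
Variables (R : realType) (G E : topologicalType).
Variables (gG : groupoid G) (gE : groupoid E).
Variables (i : G * C R -> E) (q : E -> G).
Hypothesis T : twist gG gE i q.
Local Notation s := (src gE).
Local Notation r := (rng gE).
Local Notation m := (mul gE).
Local Notation v := (inv gE).
Local Notation ph := (phase gE i q).
Implicit Types (e a b : E) (z w : C R).

Lemma q_mul a b : s a = r b -> q (m a b) = mul gG (q a) (q b).
Proof. by move=> h; case: (twist_q_hom T h). Qed.

Lemma q_composable a b : s a = r b -> src gG (q a) = rng gG (q b).
Proof. by move=> h; case: (twist_q_hom T h). Qed.

(** A unit is idempotent and composable with itself; [q] preserves both properties, and in a
    groupoid they force a unit. *)
Lemma q_unit a : units gE a -> units gG (q a).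
Proof.
move=> ua; have h : s a = r a by rewrite ua rng_unit.
apply: idem_unit; first exact: q_composable.
by rewrite -q_mul// -[X in m _ X]ua mul_src.
Qed.

Lemma q_src e : q (s e) = src gG (q e).
Proof.
rewrite (@q_composable e (s e)) ?rng_src// rng_unit//.
exact/q_unit/units_src.
Qed.

Lemma q_rng e : q (r e) = rng gG (q e).
Proof.
rewrite -(@q_composable (r e) e) ?src_rng//.
by apply/esym/q_unit/units_rng.
Qed.

Lemma q_inv e : q (v e) = inv gG (q e).
Proof.
apply: inv_uniq; first by apply: q_composable; rewrite rng_inv.
by rewrite -q_mul ?rng_inv// mul_inv q_rng.
Qed.

Lemma q_units_inj a b : units gE a -> units gE b -> q a = q b -> a = b.
Proof.
move=> ua ub; have [[_ h _] _ _] := twist_q_units T.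
by apply: h; rewrite inE.
Qed.

Lemma q_i x z : units gG x -> circle z -> q (i (x, z)) = x.
Proof.
move=> ux cz; have : (i @` ([set x] `*` @circle R)) (i (x, z)) by exists (x, z).
by rewrite (twist_fibre T ux).
Qed.

Lemma units_i1 x : units gG x -> units gE (i (x, 1)).
Proof. by move=> ux; rewrite (twist_units T); exists (x, 1). Qed.

Lemma units_E u : units gE u -> i (q u, 1) = u.
Proof.
move=> uu; have uq := q_unit uu.
by apply: q_units_inj => //; [exact: units_i1|rewrite q_i//; exact: circle1].
Qed.

Lemma src_i x z : units gG x -> circle z -> s (i (x, z)) = i (x, 1).
Proof.
move=> ux cz; apply: q_units_inj; [exact: units_src|exact: units_i1|].
by rewrite q_src !q_i//; exact: circle1.
Qed.

Lemma rng_i x z : units gG x -> circle z -> r (i (x, z)) = i (x, 1).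
Proof.
move=> ux cz; apply: q_units_inj; [exact: units_rng|exact: units_i1|].
by rewrite q_rng !q_i ?rng_unit//; exact: circle1.
Qed.

Let uqr e : units gG (q (r e)).
Proof. exact/q_unit/units_rng. Qed.

Lemma src_i_rng e z : circle z -> s (i (q (r e), z)) = r e.
Proof. by move=> cz; rewrite src_i// units_E//; exact: units_rng. Qed.

Lemma rng_i_rng e z : circle z -> r (i (q (r e), z)) = r e.
Proof. by move=> cz; rewrite rng_i// units_E//; exact: units_rng. Qed.

Lemma src_phase z e : circle z -> s (ph z e) = s e.
Proof. by move=> cz; rewrite src_mul// src_i_rng. Qed.

Lemma rng_phase z e : circle z -> r (ph z e) = r e.
Proof. by move=> cz; rewrite rng_mul ?src_i_rng// rng_i_rng. Qed.

Lemma q_phase z e : circle z -> q (ph z e) = q e.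
Proof.
by move=> cz; rewrite q_mul ?src_i_rng// q_i// q_rng mul_rng.
Qed.

Lemma phase1 e : ph 1 e = e.
Proof. by rewrite /phase units_E ?mul_rng//; exact: units_rng. Qed.

Lemma phaseM z w e : circle z -> circle w -> ph z (ph w e) = ph (z * w) e.
Proof.
move=> cz cw; rewrite {1}/phase rng_phase// /phase.
have [h ->] := twist_i_hom T (uqr e) cz cw.
by rewrite mulA// src_i_rng.
Qed.

Lemma phaseK z e : circle z -> ph z^-1 (ph z e) = e.
Proof.
by move=> cz; rewrite phaseM ?mulVf ?circle_neq0 ?phase1//; exact: circleV.
Qed.

Lemma phase_mull z a b : circle z -> s a = r b -> m (ph z a) b = ph z (m a b).
Proof. by move=> cz h; rewrite /phase mulA ?src_i_rng// rng_mul. Qed.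

Lemma phase_mulr z a b : circle z -> s a = r b -> m a (ph z b) = ph z (m a b).
Proof.
move=> cz h; rewrite -phase_mull// /phase (twist_central T a)//.
by rewrite h mulA// ?rng_i_rng// src_i_rng.
Qed.

Lemma phase_inv z a : circle z -> v (ph z a) = ph z^-1 (v a).
Proof.
move=> cz; have cz' := circleV cz.
apply/esym/inv_uniq; first by rewrite src_phase// rng_phase// rng_inv.
rewrite phase_mulr// ?src_phase ?rng_inv//.
by rewrite phase_mull ?rng_inv// phaseK// mul_inv rng_phase.
Qed.

Lemma q_eq_src a b : q a = q b -> s a = s b.
Proof.
by move=> h; apply: q_units_inj; rewrite ?q_src ?h//; exact: units_src.
Qed.

Lemma q_eq_rng a b : q a = q b -> r a = r b.
Proof.
by move=> h; apply: q_units_inj; rewrite ?q_rng ?h//; exact: units_rng.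
Qed.

(** The product of [b] with the inverse of [a] lies over a unit, where the fibre of [q] is the image
    of the circle under [i]. *)
Lemma q_fibre a b : q a = q b -> exists2 z, circle z & b = ph z a.
Proof.
move=> h; have sab := q_eq_src h; have rab := q_eq_rng h.
have qc : q (m b (v a)) = q (r a).
  by rewrite q_mul ?rng_inv// q_inv -h mul_inv q_rng.
have : (q @^-1` [set q (r a)]) (m b (v a)) by [].
rewrite -(twist_fibre T (uqr a)) => -[[x z] [/= -> cz] hz].
by exists z => //; rewrite /phase hz mulgKV.
Qed.

Lemma phase_inj z w a : circle z -> circle w -> ph z a = ph w a -> z = w.
Proof.
move=> cz cw h0; have h := mulIg (src_i_rng a cz) (src_i_rng a cw) h0.
have := @twist_i_inj _ _ _ _ _ _ _ T (q (r a), z) (q (r a), w).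
by rewrite !inE => /(_ (conj (uqr a) cz) (conj (uqr a) cw) h) [].
Qed.

Lemma q_surj x : exists e, q e = x.
Proof. by have [e _ <-] := @twist_q_surj _ _ _ _ _ _ _ T x I; exists e. Qed.

Lemma q_fibre_point u x : q (fibre_point q u x) = x.
Proof.
have [e he] := q_surj x.
by have : (q @^-1` [set x]) (fibre_point q u x) by apply: xgetPex; exists e.
Qed.

Lemma src_fibre_point u x : units gE u -> src gG x = q u ->
  s (fibre_point q u x) = u.
Proof.
move=> uu xu; apply: q_units_inj => //; first exact: units_src.
by rewrite q_src q_fibre_point.
Qed.

End TwistAlgebra.

(** * Integration over the fibres of the twist *)

Section WithinContinuity.
Variables (X Y : topologicalType).

(** Multiplication and [i] are continuous only within a subset; to compose with them, the inner map
    must eventually take its values there. *)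
Lemma cvg_within_comp (A : set X) (f : X -> Y) (T : Type) (F : set_system T)
    {FF : Filter F} (g : T -> X) x :
  {within A, continuous f} -> A x -> (\forall t \near F, A (g t)) ->
  g @ F --> x -> (fun t => f (g t)) @ F --> f x.
Proof.
move=> /subspace_continuousP/(_ x) cf Ax nA gx W /(cf Ax) /= h.
have /gx hW : nbhs x (fun y => A y -> W (f y)) by [].
by apply: filterS2 nA hW => t At; exact.
Qed.

End WithinContinuity.

Section TopGroupoid.
Variables (E : topologicalType) (gE : groupoid E).
Hypothesis tgE : topological_groupoid gE.
Local Notation s := (src gE).
Local Notation r := (rng gE).
Local Notation m := (mul gE).
Local Notation v := (inv gE).

Lemma cvg_mulg (T : Type) (F : set_system T) {FF : Filter F} (f g : T -> E) a b :
  f @ F --> a -> g @ F --> b -> (\forall t \near F, s (f t) = r (g t)) ->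
  s a = r b -> (fun t => m (f t) (g t)) @ F --> m a b.
Proof.
move=> fa gb nc ab.
apply: (@cvg_within_comp _ _ (composable gE) (fun p => m p.1 p.2) _ F _
  (fun t => (f t, g t)) (a, b)) => //; first exact: tgE.1.
exact: cvg_pair.
Qed.

Lemma cvg_invg (T : Type) (F : set_system T) {FF : Filter F} (f : T -> E) a :
  f @ F --> a -> (fun t => v (f t)) @ F --> v a.
Proof. by move=> fa; apply: (cvg_comp _ _ fa); exact: tgE.2. Qed.

Lemma continuous_src : continuous s.
Proof.
move=> a; have -> : s = fun e => m (v e) e by apply/funext => e; rewrite inv_mul.
apply: cvg_mulg => //; first by apply: cvg_invg.
  by apply: nearW => e; rewrite src_inv.
by rewrite src_inv.
Qed.

Lemma continuous_rng : continuous r.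
Proof.
move=> a; have -> : r = fun e => m e (v e) by apply/funext => e; rewrite mul_inv.
apply: cvg_mulg => //; first by apply: cvg_invg.
  by apply: nearW => e; rewrite rng_inv.
by rewrite rng_inv.
Qed.

End TopGroupoid.

Section HaarParametrisation.
Variable R : realType.

Definition expi (t : R) : C R :=
  (cos (pi *+ 2 * t) +i* sin (pi *+ 2 * t))%C.

Lemma circle_expi t : circle (expi t).
Proof. by apply/circleE; rewrite /= cos2Dsin2 sqrtr1. Qed.

Lemma continuous_expi : continuous expi.
Proof.
move=> t; apply: continuous_cplx.
  apply: continuous_comp; last exact: continuous_cos.
  by apply: cvgM; [exact: cvg_cst|exact: cvg_id].
apply: continuous_comp; last exact: continuous_sin.
by apply: cvgM; [exact: cvg_cst|exact: cvg_id].
Qed.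

End HaarParametrisation.

Section Integral.
Variables (R : realType) (G E : topologicalType).
Variables (gG : groupoid G) (gE : groupoid E).
Variables (i : G * C R -> E) (q : E -> G).
Hypothesis etG : hausdorff_etale gG.
Hypothesis T : twist gG gE i q.
Local Notation s := (src gE).
Local Notation r := (rng gE).
Local Notation ph := (phase gE i q).
Local Notation fp := (fibre_point q).

Let tgE : topological_groupoid gE := twist_topological T.

Lemma cvg_phase (X : Type) (F : set_system X) {FF : Filter F}
    (z : X -> C R) (f : X -> E) w e :
  z @ F --> w -> f @ F --> e -> (\forall x \near F, circle (z x)) ->
  circle w -> (fun x => ph (z x) (f x)) @ F --> ph w e.
Proof.
move=> zw fe nz cw; have qf : (fun x => q (r (f x))) @ F --> q (r e).
  apply: (cvg_comp _ _ (cvg_comp _ _ fe (continuous_rng tgE (x := e)))).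
  exact: (twist_q_continuous T).
apply: cvg_mulg => //; last by rewrite (src_i_rng T).
- apply: (@cvg_within_comp _ _ (units gG `*` @circle R) i _ F _
    (fun x => (q (r (f x)), z x)) (q (r e), w)) => //.
  + exact: (twist_i_continuous T).
  + by split => //=; exact/(q_unit T)/units_rng.
  + by apply: filterS nz => x cz; split => //=; exact/(q_unit T)/units_rng.
  + exact: (cvg_pair qf zw).
- by apply: filterS nz => x cz; rewrite (src_i_rng T).
Qed.

Lemma continuous_orbit e : continuous (fun t : R => ph (expi t) e).
Proof.
move=> t; apply: cvg_phase.
- exact: continuous_expi.
- exact: cvg_cst.
- by apply: nearW => x; exact: circle_expi.
- exact: circle_expi.
Qed.

Lemma fibre_discrete (x : G) :
  exists O : set G, [/\ open O, O x & forall y, O y -> src gG y = src gG x -> y = x].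
Proof.
have [U [oO Ox _ [[_ h _] _ _]]] := etale_src etG x.
by exists U; split=> // y Oy; apply: h; rewrite inE.
Qed.

(** On [E_u] a phase-invariant condition depends only on [q e], and the source fibres of [G] are
    discrete; hence a union of preimages of open sets cuts it out. Every phase-invariant function on
    [E_u] is Borel for this reason. *)
Lemma invariant_rel_open (u : E) (P : E -> Prop) :
  (forall z e, circle z -> s e = u -> P e -> P (ph z e)) ->
  exists2 O, open O & forall e, s e = u -> (O e <-> P e).
Proof.
move=> iP; have [B hB] := choice fibre_discrete.
exists (\bigcup_(e in [set e | s e = u /\ P e]) q @^-1` (B (q e))).
  apply: bigcup_open => e _; apply: open_comp; last by have [] := hB (q e).
  by move=> ? _; exact: (twist_q_continuous T).
move=> e se; split=> [[e' [se' Pe'] /= Be]|Pe]; last by exists e => //=; have [] := hB (q e).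
have [_ _ h] := hB (q e'); have qe := h _ Be.
have [|z cz ->] := @q_fibre _ _ _ _ _ _ _ T e' e; last exact: iP.
by rewrite qe// -!(q_src T) se se'.
Qed.

Lemma closed_src_fibre u : closed (src_fibre gE u).
Proof.
apply: (@preimage_closed _ _ s [set u]) => [e _|]; first exact: continuous_src.
exact/accessible_closed_set1/hausdorff_accessible/(twist_hausdorff T).
Qed.

Lemma open_borel u (A : set E) : open A -> measurable (A : set (borel_at u)).
Proof. by move=> oA; apply: sub_sigma_algebra. Qed.

Lemma measurable_src_fibre u : measurable (src_fibre gE u : set (borel_at u)).
Proof.
rewrite -[src_fibre _ _]setCK; apply: measurableC; apply: open_borel.
by rewrite openC; exact: closed_src_fibre.
Qed.

Lemma measurable_invariant d' (Y : measurableType d') u (h : E -> Y) :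
  (forall z e, circle z -> s e = u -> h (ph z e) = h e) ->
  measurable_fun (T := borel_at u) (src_fibre gE u) h.
Proof.
move=> ih mD B mB; have [|U oO hO] := @invariant_rel_open u (h @^-1` B).
  by move=> z e cz se /=; rewrite ih.
rewrite (_ : _ `&` _ = src_fibre gE u `&` U); last first.
  by apply/seteqP; split=> e [se /= h']; split=> //; apply/hO.
by apply: measurableI; [exact: measurable_src_fibre|exact: open_borel].
Qed.

Lemma measurable_orbit u e :
  measurable_fun [set: R] ((fun t => ph (expi t) e) : R -> borel_at u).
Proof.
apply: (@measurability _ _ _ (borel_at u) setT _ (@open E) erefl).
move=> _ [A oA <-]; rewrite setTI; apply: open_measurable.
by apply: open_comp => // t _; exact: continuous_orbit.
Qed.

Let m01 : measurable (`[0, 1[%classic : set R). Proof. exact: measurable_itv. Qed.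

(** Haar measure carried by the single fibre of [q] through [e], bundled as a measure so that
    integration theorems apply; [lambda] is only a set function. *)
Definition orbit_measure u e : {measure set (borel_at u) -> \bar R} :=
  measure_function_pushforward__canonical__measure_function_Measure
    (mrestr (@lebesgue_measure R) m01) (@measurable_orbit u e).

Lemma lambda_orbit u (A : set E) :
  lambda gG gE i q u A =
  \esum_(x in src_fibre gG (q u)) orbit_measure u (fp u x) A.
Proof.
apply: eq_esum => x _; congr lebesgue_measure.
by apply/seteqP; split=> t /=; rewrite in_itv /= andbC => -[].
Qed.

(** Each point of the fibre is isolated in it by a member of a countable base, and distinct points
    get distinct members. *)
Lemma countable_src_fibre (w : G) : countable (src_fibre gG w).
Proof.
have [B cB [Bo Bn]] := etale_second_countable etG.
have [D hD] := choice fibre_discrete.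
have hU x : exists U, [/\ B U, U x & U `<=` D x].
  have [oD Dx _] := hD x.
  have /Bn[U [BU Ux] UD] : nbhs x (D x) by apply: open_nbhs_nbhs.
  by exists U.
have [f hf] := choice hU.
have /countable_injP[k kI] := cB.
apply/countable_injP; exists (k \o f) => x y; rewrite !inE => /= hx hy fxy.
have [Bx fx _] := hf x; have [By _ fy] := hf y; have [_ _ h] := hD y.
have {}fxy : f x = f y by apply: kI; rewrite ?inE.
by apply: h; [apply: fy; rewrite -fxy|rewrite hx hy].
Qed.

(** The integrand is constant along the orbit, which has total mass 1. *)
Lemma integral_orbit u e (h : E -> \bar R) : s e = u ->
  (forall a, s a = u -> (0 <= h a)%E) ->
  (forall z a, circle z -> s a = u -> h (ph z a) = h a) ->
  (\int[orbit_measure u e]_(a in src_fibre gE u) h a = h e)%E.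
Proof.
move=> se h0 ih; rewrite ge0_integral_pushforward.
- rewrite (_ : _ @^-1` _ = setT); last first.
    apply/seteqP; split=> t //= _; rewrite /preimage /src_fibre /= (src_phase T)//.
    exact: circle_expi.
  rewrite (@eq_integral _ _ _ _ _ (cst (h e))); last first.
    by move=> t _ /=; rewrite ih//; exact: circle_expi.
  rewrite integral_cst//= /mrestr setTI lebesgue_measure_itv/= lte_fin ltr01.
  by rewrite sube0 mule1.
- exact: measurable_orbit.
- exact: measurable_src_fibre.
- exact: measurable_invariant.
- by move=> a; rewrite inE => /h0.
Qed.

Lemma lambda_series u (S := src_fibre gG (q u)) : exists (f : G -> nat) (g : nat -> G),
  [/\ forall x, S x -> g (f x) = x,
      forall a : G -> \bar R, (forall x, S x -> (0 <= a x)%E) ->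
        \esum_(x in S) a x = (\sum_(n <oo) if n \in f @` S then a (g n) else 0)%E &
      lambda gG gE i q u = mseries (fun n =>
        if n \in f @` S then orbit_measure u (fp u (g n)) else mzero) 0].
Proof.
have /countable_injP[f fI] := countable_src_fibre (q u).
pose g n := xget (q u) [set x | S x /\ f x = n].
have gf x : S x -> g (f x) = x.
  move=> Sx; rewrite /g; case: xgetP => [y _ [Sy fyx]|/(_ x)[]//].
  by apply: fI; rewrite ?inE.
have esumE (a : G -> \bar R) : (forall x, S x -> (0 <= a x)%E) ->
    \esum_(x in S) a x = (\sum_(n <oo) if n \in f @` S then a (g n) else 0)%E.
  move=> a0; rewrite nneseries_esumT; last first.
    move=> n; case: ifPn => //; rewrite inE => -[x Sx <-].
    by rewrite gf// a0.
  rewrite -(@esum_mkcond _ _ (f @` S) (fun n => a (g n))) esum_image.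
    by apply: eq_esum => x Sx; rewrite gf.
  by [].
exists f, g; split=> //.
apply/funext => A; rewrite lambda_orbit esumE; last by move=> x _; exact: measure_ge0.
by rewrite /mseries; apply: eq_eseriesr => n _; case: ifP.
Qed.

Lemma integral_invariant u (h : E -> \bar R) : units gE u ->
  (forall a, s a = u -> (0 <= h a)%E) ->
  (forall z a, circle z -> s a = u -> h (ph z a) = h a) ->
  integral_at gG gE i q u h = \esum_(x in src_fibre gG (q u)) h (fp u x).
Proof.
move=> uu h0 ih; have [f [g [gf esumE lamE]]] := lambda_series u.
rewrite /integral_at lamE ge0_integral_measure_series//.
- rewrite esumE; last by move=> x Sx; apply: h0; rewrite (src_fibre_point T).
  apply: eq_eseriesr => n _; case: ifPn => [|_].
    rewrite inE => -[x Sx <-]; rewrite gf//; apply: integral_orbit => //.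
    by rewrite (src_fibre_point T).
  by rewrite integral_measure_zero.
- exact: measurable_src_fibre.
- exact: measurable_invariant.
Qed.

Lemma esum_fsupp (I : choiceType) (S X : set I) (a : I -> \bar R) :
  (forall x, S x -> (0 <= a x)%E) -> finite_set X -> X `<=` S ->
  (forall x, S x -> ~ X x -> a x = 0%E) ->
  \esum_(x in S) a x = (\sum_(x <- fset_set X) a x)%E.
Proof.
move=> a0 fX XS aX; rewrite (esumID X)// [X in (_ + X)%E]esum1; last first.
  by move=> x [Sx Xx]; exact: aX.
rewrite adde0 (setIidr XS) esum_fset//; last by move=> x; rewrite inE => /XS/a0.
by rewrite fsbig_finite.
Qed.

(** Positive and negative parts are again phase-invariant and vanish off [X], so the nonnegative
    case applies to each. *)
Lemma integral_fsupp u (k : E -> R) (X : set G) : units gE u ->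
  (forall z a, circle z -> s a = u -> k (ph z a) = k a) ->
  finite_set X -> X `<=` src_fibre gG (q u) ->
  (forall x, src_fibre gG (q u) x -> ~ X x -> k (fp u x) = 0) ->
  integral_at gG gE i q u (fun e => (k e)%:E) =
  (\sum_(x <- fset_set X) k (fp u x))%:E.
Proof.
move=> uu ik fX XS kX; have [f [g [_ _ lamE]]] := lambda_series u.
have iE (h : E -> \bar R) : integral_at gG gE i q u h =
    (integral_at gG gE i q u (h^\+)%E - integral_at gG gE i q u (h^\-)%E)%E.
  by rewrite /integral_at lamE integralE.
pose K e := (k e)%:E.
have neg0 z a : circle z -> s a = u -> (K^\-)%E (ph z a) = (K^\-)%E a.
  by move=> cz sa; rewrite !funenegE /K ik.
have pos0 z a : circle z -> s a = u -> (K^\+)%E (ph z a) = (K^\+)%E a.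
  by move=> cz sa; rewrite !funeposE /K ik.
rewrite iE !integral_invariant// !(@esum_fsupp _ _ X)//.
- rewrite (eq_bigr (fun x => (Num.max (k (fp u x)) 0)%:E)); last first.
    by move=> x _; rewrite !funeposE -EFin_max.
  rewrite [X in (_ - X)%E](eq_bigr (fun x => (Num.max (- k (fp u x)) 0)%:E)); last first.
    by move=> x _; rewrite !funenegE -EFin_max.
  rewrite !sumEFin /= -EFinB -sumrB; congr EFin; apply: eq_bigr => x _.
  by case: (leP (k (fp u x)) 0) => h; case: (leP (- k (fp u x)) 0) => h'; lra.
- by move=> x Sx Xx; rewrite !funenegE kX// oppe0 maxxx.
- by move=> x Sx Xx; rewrite !funeposE kX// maxxx.
Qed.

Lemma cintegral_fsupp u (h : E -> C R) (X : set G) : units gE u ->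
  (forall z a, circle z -> s a = u -> h (ph z a) = h a) ->
  finite_set X -> X `<=` src_fibre gG (q u) ->
  (forall x, src_fibre gG (q u) x -> ~ X x -> h (fp u x) = 0) ->
  cintegral_at gG gE i q u h = \sum_(x <- fset_set X) h (fp u x).
Proof.
move=> uu ih fX XS hX; rewrite /cintegral_at !(@integral_fsupp u _ X)//=.
- rewrite -!raddf_sum; by case: (\sum_(_ <- _) _).
- by move=> z a cz sa; rewrite ih.
- by move=> x Sx Xx; rewrite hX.
- by move=> z a cz sa; rewrite ih.
- by move=> x Sx Xx; rewrite hX.
Qed.

End Integral.

(** * Convolution *)

Section Convolution.
Variables (R : realType) (G E : topologicalType).
Variables (gG : groupoid G) (gE : groupoid E).
Variables (i : G * C R -> E) (q : E -> G).
Hypothesis etG : hausdorff_etale gG.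
Hypothesis T : twist gG gE i q.
Local Notation s := (src gE).
Local Notation r := (rng gE).
Local Notation m := (mul gE).
Local Notation v := (inv gE).
Local Notation ph := (phase gE i q).
Local Notation fp := (fibre_point q).
Local Notation equiv := (equivariant_on gE i q).
Local Notation conv := (conv gG gE i q).
Implicit Types (f g : E -> C R) (e : E).

Let sS x : units gE (s x). Proof. exact: units_src. Qed.
Let sV a b : s a = s b -> s a = r (v b). Proof. by rewrite rng_inv. Qed.

(** The factor [z^-1] from [f] cancels the factor [z] from [g]. The integrand thus lives on a source
    fibre of [G], and the integral becomes a sum over that fibre. *)
Lemma conv_integrand f g e : equiv setT f -> equiv (src_fibre gE (s e)) g ->
  forall z y, circle z -> s y = s e ->
    f (m e (v (ph z y))) * g (ph z y) = f (m e (v y)) * g y.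
Proof.
move=> ef eg z y cz sy; rewrite (phase_inv T)// (phase_mulr T); last 2 first.
- exact: circleV.
- exact: sV.
rewrite ef//; last exact: circleV.
rewrite eg// mulrACA mulVf ?mul1r//; exact: circle_neq0.
Qed.

Lemma conv_fsum f g e (X : set G) : equiv setT f -> equiv (src_fibre gE (s e)) g ->
  finite_set X -> X `<=` src_fibre gG (q (s e)) ->
  (forall x, src_fibre gG (q (s e)) x -> ~ X x ->
     f (m e (v (fp (s e) x))) * g (fp (s e) x) = 0) ->
  conv f g e = \sum_(x <- fset_set X) f (m e (v (fp (s e) x))) * g (fp (s e) x).
Proof.
move=> ef eg fX XS hX.
rewrite /Defs.conv (cintegral_fsupp etG T (X := X))//.
by move=> z a cz sa; apply: conv_integrand.
Qed.

(** Only the fibre of [q] through [b] contributes, with mass 1; any representative [b] of it will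
    do. *)
Lemma conv_one f g e b : equiv setT f -> equiv (src_fibre gE (s e)) g -> s b = s e ->
  (forall y, s y = s e -> q y <> q b -> f (m e (v y)) * g y = 0) ->
  conv f g e = f (m e (v b)) * g b.
Proof.
move=> ef eg sb h; have qb : src_fibre gG (q (s e)) (q b).
  by rewrite /src_fibre /= -sb (q_src T).
rewrite (conv_fsum (X := [set q b]))//.
- rewrite fset_set1 big_seq_fset1.
  have [z cz hz] : exists2 z, circle z & fp (s e) (q b) = ph z b.
    by apply: (q_fibre T); rewrite (q_fibre_point T).
  by rewrite hz conv_integrand.
- by move=> _ ->.
- move=> x Sx xb; apply: h; first by rewrite (src_fibre_point T).
  by rewrite (q_fibre_point T) => xE; apply: xb.
Qed.

Lemma conv_zero f g e : equiv setT f -> equiv (src_fibre gE (s e)) g ->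
  (forall y, s y = s e -> f (m e (v y)) * g y = 0) -> conv f g e = 0.
Proof.
move=> ef eg h; rewrite (conv_one ef eg (b := e))//; first exact: h.
by move=> y sy _; exact: h.
Qed.

(** Finiteness along range fibres, counted modulo phase: the rows of the matrix of [f] have finite
    support, so [conv f g] is a finite sum for every equivariant [g], square-summable or not. *)
Definition row_finite f :=
  forall w, finite_set (q @` [set a | r a = w /\ f a != 0]).

Lemma row_finite_supp f e : row_finite f -> exists X, [/\ finite_set X,
   X `<=` src_fibre gG (q (s e)) &
   forall x, src_fibre gG (q (s e)) x -> ~ X x -> f (m e (v (fp (s e) x))) = 0].
Proof.
move=> /(_ (r e)) fX.
exists [set x | src_fibre gG (q (s e)) x /\ f (m e (v (fp (s e) x))) != 0].
split; last 2 first.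
- by move=> x [].
- by move=> x Sx /not_andP[//|/negP]; rewrite negbK => /eqP.
(* The column [x] is recovered from the arrow y = q(e) x^-1 as y^-1 q(e). *)
apply: sub_finite_set (finite_image (fun y => mul gG (inv gG y) (q e)) fX).
move=> x [Sx fx]; exists (q (m e (v (fp (s e) x)))).
  exists (m e (v (fp (s e) x))) => //; split=> //.
  by rewrite rng_mul// rng_inv (src_fibre_point T).
have sfp := src_fibre_point T (sS e) Sx.
rewrite -(q_inv T) -(q_mul T).
  rewrite invM ?rng_inv ?sfp// inv_inv mulA ?rng_inv ?src_inv// ?sfp//.
  rewrite inv_mul -[X in m _ X]sfp mul_src (q_fibre_point T)//.
by rewrite src_inv rng_mul// rng_inv sfp.
Qed.

Lemma conv_addl f f' g e : equiv setT f -> equiv setT f' -> row_finite f -> row_finite f' ->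
  equiv (src_fibre gE (s e)) g -> conv (f + f') g e = conv f g e + conv f' g e.
Proof.
move=> ef ef' rf rf' eg.
have [X [fX XS hX]] := row_finite_supp e rf.
have [X' [fX' XS' hX']] := row_finite_supp e rf'.
have fU : finite_set (X `|` X') by rewrite finite_setU.
have US : X `|` X' `<=` src_fibre gG (q (s e)) by move=> x [/XS|/XS'].
have eff : equiv setT (f + f').
  by move=> z a cz _; rewrite -[LHS]/(f _ + f' _) ef// ef'// -mulrDr.
rewrite !(@conv_fsum _ _ _ (X `|` X'))// -?big_split /=.
- by apply: eq_bigr => x _; rewrite -[(f + f') _]/(f _ + f' _) mulrDl.
- by move=> x Sx /not_orP[_ h]; rewrite hX'// mul0r.
- by move=> x Sx /not_orP[h _]; rewrite hX// mul0r.
- move=> x Sx /not_orP[h h']; rewrite -[(f + f') _]/(f _ + f' _).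
  by rewrite hX// hX'// addr0 mul0r.
Qed.

Lemma conv_addr f g g' e : equiv setT f -> row_finite f ->
  equiv (src_fibre gE (s e)) g -> equiv (src_fibre gE (s e)) g' ->
  conv f (g + g') e = conv f g e + conv f g' e.
Proof.
move=> ef rf eg eg'; have [X [fX XS hX]] := row_finite_supp e rf.
have egg : equiv (src_fibre gE (s e)) (g + g').
  by move=> z a cz sa; rewrite -[LHS]/(g _ + g' _) eg// eg'// -mulrDr.
rewrite !(@conv_fsum _ _ _ X)// -?big_split /=;
  try by move=> x Sx h; rewrite hX// mul0r.
by apply: eq_bigr => x _; rewrite -[(g + g') _]/(g _ + g' _) mulrDr.
Qed.

Lemma conv_scalel (c : C R) f g e : equiv setT f -> row_finite f ->
  equiv (src_fibre gE (s e)) g -> conv (fun a => c * f a) g e = c * conv f g e.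
Proof.
move=> ef rf eg; have [X [fX XS hX]] := row_finite_supp e rf.
have ecf : equiv setT (fun a => c * f a).
  by move=> z a cz _; rewrite ef// mulrCA.
rewrite !(@conv_fsum _ _ _ X)// ?big_distrr /=;
  try by move=> x Sx h; rewrite hX// ?mulr0 mul0r.
by apply: eq_bigr => x _; rewrite mulrA.
Qed.

Lemma conv_scaler (c : C R) f g e : equiv setT f -> row_finite f ->
  equiv (src_fibre gE (s e)) g -> conv f (fun a => c * g a) e = c * conv f g e.
Proof.
move=> ef rf eg; have [X [fX XS hX]] := row_finite_supp e rf.
have ecg : equiv (src_fibre gE (s e)) (fun a => c * g a).
  by move=> z a cz sa; rewrite eg// mulrCA.
rewrite !(@conv_fsum _ _ _ X)// ?big_distrr /=;
  try by move=> x Sx h; rewrite hX// mul0r.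
by apply: eq_bigr => x _; rewrite mulrCA.
Qed.

Lemma equiv_conv f g u : equiv setT f -> row_finite f ->
  equiv (src_fibre gE u) g -> equiv (src_fibre gE u) (conv f g).
Proof.
move=> ef rf eg z e cz se; have eg' : equiv (src_fibre gE (s e)) g by rewrite se.
have [X [fX XS hX]] := row_finite_supp e rf.
have sph : s (ph z e) = s e by rewrite (src_phase T).
have fE x : src_fibre gG (q (s e)) x ->
    f (m (ph z e) (v (fp (s e) x))) = z * f (m e (v (fp (s e) x))).
  by move=> Sx; rewrite (phase_mull T) ?rng_inv ?(src_fibre_point T)// ef.
rewrite (@conv_fsum _ _ e X)//; last by move=> x Sx h; rewrite hX// mul0r.
rewrite (@conv_fsum _ _ (ph z e) X)// ?sph//; last first.
  by move=> x Sx h; rewrite fE// hX// mulr0 mul0r.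
rewrite big_distrr /= !big_seq; apply: eq_bigr => x.
by rewrite in_fset_set// inE => /XS Sx; rewrite fE// mulrA.
Qed.

End Convolution.

(** * Local trivialisations and measurability of vectors *)

Section LocalCoordinate.
Variables (R : realType) (G E : topologicalType).
Variables (gG : groupoid G) (gE : groupoid E).
Variables (i : G * C R -> E) (q : E -> G).
Hypothesis etG : hausdorff_etale gG.
Hypothesis T : twist gG gE i q.
Local Notation s := (src gE).
Local Notation m := (mul gE).
Local Notation ph := (phase gE i q).
Local Notation fp := (fibre_point q).
Local Notation equiv := (equivariant_on gE i q).
Implicit Types (f g : E -> C R) (e : E).

(** [zeta] is the circle coordinate of the inverse chart: its continuity is the openness of the
    chart, and the preimage of [K] is the image of the compact product of [K] with the circle. *)
Lemma local_coordinate (a : G) : exists (U : set G) (P : G -> E) (zeta : E -> C R),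
  [/\ open U /\ U a,
      forall b, U b -> q (P b) = b /\ {for b, continuous P},
      forall e, U (q e) -> circle (zeta e) /\ e = ph (zeta e) (P (q e)),
      forall e, U (q e) -> {for e, continuous zeta} &
      forall K, compact K -> K `<=` U -> compact (q @^-1` K)].
Proof.
have [U [P [oU Ua cP qP [bijP ch oh]]]] := twist_locally_trivial T a.
have hE b z : U b -> m (i (rng gG b, z)) (P b) = ph z (P b).
  by move=> Ub; rewrite /phase (q_rng T) qP.
have zex e : exists z : C R, U (q e) -> circle z /\ e = ph z (P (q e)).
  have [Ue|nUe] := pselect (U (q e)); last by exists 1.
  by have [z cz ez] := q_fibre T (qP _ Ue); exists z.
have [zeta hz] := choice zex.
exists U, P, zeta; split=> //.
- move=> b Ub; split; first exact: qP.
  by move: cP; rewrite continuous_open_subspace// => /(_ b); rewrite inE; exact.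
- move=> e0 Ue0 W Wz; rewrite nbhs_filterE.
  move: Wz; rewrite nbhsE => -[W' [oW' W'z] W'W].
  have oS : open ((fun p : G * C R => p.2) @^-1` W').
    by apply: open_comp => // p _; exact: cvg_snd.
  have [V1 oO1 hO1] := oh _ oS.
  have [cz0 e0E] := hz _ Ue0.
  have Oe0 : (V1 `&` q @^-1` U) e0.
    rewrite setIC -hO1; exists (q e0, zeta e0) => //=.
    by rewrite hE.
  have oO : open (V1 `&` q @^-1` U).
    apply: openI => //; apply: open_comp => // ? _; exact: (twist_q_continuous T).
  apply: (filterS _ (open_nbhs_nbhs (conj oO Oe0))) => e [Oe Ue] /=.
  have : (q @^-1` U `&` V1) e by [].
  rewrite -hO1 => -[[b z] [[/= Ub cz] /= Wz]]; rewrite hE// => eE.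
  apply: W'W; suff -> : zeta e = z by [].
  have [cze eE'] := hz _ Ue.
  have qb : q e = b by rewrite -eE (q_phase T)// qP.
  by apply: (phase_inj T (a := P b)) => //; rewrite -{1}qb -eE' -eE.
- move=> K cK KU.
  have -> : q @^-1` K = (fun p => m (i (rng gG p.1, p.2)) (P p.1)) @` (K `*` @circle R).
    apply/seteqP; split=> e /=.
      move=> Ke; have Ue := KU _ Ke; have [cz eE] := hz _ Ue.
      by exists (q e, zeta e) => //=; rewrite hE.
    move=> [[b z] [/= Kb cz] <-]; rewrite hE; last exact: KU.
    by rewrite (q_phase T)// qP//; exact: KU.
  apply: continuous_compact; last by apply: compact_setX => //; exact: circle_compact.
  by apply: continuous_subspaceW ch => -[b z] [/= /KU Ub cz].
Qed.

(** The part of [E_u] where [f] exceeds [x] is the trace of an open set: the interior of the set of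
    points that satisfy the inequality or lie off [E_u]. *)
Lemma measurable_locally_continuous u (f : E -> R) :
  (forall e, s e = u -> exists2 g : E -> R, {for e, continuous g} &
     \forall a \near e, s a = u -> f a = g a) ->
  measurable_fun (T := borel_at u) (src_fibre gE u) f.
Proof.
move=> hf mD; apply: (measurability _ (RGenOInfty.measurableE R)) => //.
move=> _ [_ [x ->] <-].
rewrite (_ : _ `&` _ = src_fibre gE u `&` interior [set a | s a = u -> x < f a]).
  apply: measurableI; first exact: (measurable_src_fibre T).
  by apply: open_borel; exact: open_interior.
apply/seteqP; split=> e [se /=]; last first.
  move=> /interior_subset /= /(_ se) h; split=> //.
  by rewrite in_itv/= andbT.
rewrite in_itv/= andbT => xf; split=> //; have [g cg fg] := hf _ se.
have ge : f e = g e by exact: (nbhs_singleton fg).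
have : \forall a \near e, x < g a.
  by apply: (cvgr_gt (g e)); [exact: cg|rewrite -ge].
by apply: filterS2 fg => a fga xg sa; rewrite fga.
Qed.

(** By discreteness, the points of [E_u] near [e] are all phases of [P (q e)]; there [xi] is [zeta]
    times a constant. *)
Lemma equiv_locally u (xi : E -> C R) e : equiv (src_fibre gE u) xi -> s e = u ->
  exists2 g : E -> C R, {for e, continuous g} &
    \forall a \near e, s a = u -> xi a = g a.
Proof.
move=> exi se; have [U [P [zeta [[oU Ue] hP hz cz _]]]] := local_coordinate (q e).
have [B [oB Be hB]] := fibre_discrete etG (q e).
have sP : s (P (q e)) = u by rewrite -se; apply: (q_eq_src T); case: (hP _ Ue).
exists (fun a => zeta a * xi (P (q e))).
  apply: cvgMl => /=; exact: cz.
have : \forall a \near e, U (q a) /\ B (q a).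
  apply: (open_nbhs_nbhs (conj _ _)) => /=; last by split.
  by apply: (@open_comp _ _ q (U `&` B)) => [? _|];
    [exact: (twist_q_continuous T)|exact: openI].
apply: filterS => a [Ua Ba] sa; have [cza aE] := hz _ Ua.
have qa : q a = q e by apply: hB => //; rewrite -!(q_src T) sa se.
by rewrite {1}aE exi// qa.
Qed.

Lemma measurable_equiv u (xi : E -> C R) : equiv (src_fibre gE u) xi ->
  measurable_fun (T := borel_at u) (src_fibre gE u) (fun e => complex.Re (xi e)) /\
  measurable_fun (T := borel_at u) (src_fibre gE u) (fun e => complex.Im (xi e)).
Proof.
move=> exi; split; apply: measurable_locally_continuous => e se;
  have [g cg hg] := equiv_locally exi se.
- exists (fun a => complex.Re (g a)).
    by apply: continuous_comp; [exact: cg|exact: continuous_Re].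
  by apply: filterS hg => a h /h ->.
- exists (fun a => complex.Im (g a)).
    by apply: continuous_comp; [exact: cg|exact: continuous_Im].
  by apply: filterS hg => a h /h ->.
Qed.

Definition sqsum u (xi : E -> C R) : \bar R :=
  \esum_(x in src_fibre gG (q u)) (normc (xi (fp u x)) ^+ 2)%:E.

Lemma l2normE u xi : units gE u -> equiv (src_fibre gE u) xi ->
  l2norm gG gE i q u xi = sqrte (sqsum u xi).
Proof.
move=> uu exi; rewrite /l2norm (integral_invariant etG T)//.
- by move=> a _; rewrite lee_fin sqr_ge0.
- by move=> z a cz sa; rewrite exi// normcM (circleE z).1// mul1r.
Qed.

Lemma sqsum_ge0 u xi : (0 <= sqsum u xi)%E.
Proof. by apply: esum_ge0 => x _; rewrite lee_fin sqr_ge0. Qed.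

Lemma L2P u xi : units gE u ->
  L2 gG gE i q u xi <-> equiv (src_fibre gE u) xi /\ (sqsum u xi < +oo)%E.
Proof.
move=> uu; split.
  move=> [_ _ exi]; rewrite l2normE// => h; split=> //.
  rewrite ltey; apply: contraTneq h => ->; by rewrite /sqrte/= ?ltxx.
move=> [exi h]; have [m1 m2] := measurable_equiv exi; split=> //.
rewrite l2normE//; move: h (sqsum_ge0 u xi); case: (sqsum u xi) => [x||]//= _ _.
exact: ltry.
Qed.

End LocalCoordinate.

Lemma near_continuous (X Y : topologicalType) (f g : X -> Y) x :
  (\forall y \near x, f y = g y) -> {for x, continuous g} -> {for x, continuous f}.
Proof.
move=> fg cg W; rewrite (nbhs_singleton fg) => /cg gW.
by rewrite /= nbhs_filterE; apply: filterS2 fg gW => y /= ->.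
Qed.

(** * Compactly supported equivariant functions *)

Section LocallyCompactHausdorff.
Variables (R : realType) (X : topologicalType).
Hypothesis lcX : locally_compact [set: X].
Hypothesis hX : hausdorff_space X.

Lemma bump_function (x : X) (U : set X) : open U -> U x ->
  exists phi : X -> R, [/\ continuous phi, forall y, 0 <= phi y, phi x = 1 &
    forall y, phi y != 0 -> U y].
Proof.
move=> oU Ux; have cU : closed (~` U) by rewrite closedC.
have nUx : ~ (~` U) x by [].
have /(@uniform_separatorP _ R)[f [cf f01 fx fU]] :=
  @locally_compact_completely_regular X R lcX hX x _ cU nUx.
exists (fun y => 1 - f y); split.
- by move=> y; apply: cvgB; [exact: cvg_cst|exact: cf].
- move=> y; have : range f (f y) by exists y.
  by move/f01; rewrite /= in_itv/= subr_ge0 => /andP[].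
- have -> : f x = 0 by apply: fx; exists x.
  by rewrite subr0.
- move=> y; apply: contra_neqP => nUy.
  by have -> : f y = 1; [apply: fU; exists y|rewrite subrr].
Qed.

(** A bump function is nonzero only inside [U], but the closure of that set may leave [U]; its
    superlevel set at 1/2 is closed and stays inside. *)
Lemma compact_neighbourhood (x : X) (U : set X) : open U -> U x ->
  exists K, [/\ compact K, closed K, K `<=` U & nbhs x K].
Proof.
move=> oU Ux; have [phi [cphi phi0 phix phiU]] := bump_function oU Ux.
have [K0] := lcX (I : [set: X] x); rewrite withinET => K0x [cK0 clK0].
have cl : closed [set y | 1 / 2 <= phi y].
  apply: (@preimage_closed _ _ phi [set t : R | 1 / 2 <= t]) => [y _|]; first exact: cphi.
  exact: closed_ge.
exists (K0 `&` [set y | 1 / 2 <= phi y]); split.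
- exact: compact_closedI.
- exact: closedI.
- move=> y [_ /= h]; apply: phiU; apply: lt0r_neq0; apply: lt_le_trans h.
  by rewrite divr_gt0.
- apply: filterI => //; have h : phi x > 1 / 2 by rewrite phix; lra.
  have : \forall y \near x, 1 / 2 < phi y by apply: (cvgr_gt (phi x)) => //; exact: cphi.
  by apply: filterS => y /= /ltW.
Qed.

End LocallyCompactHausdorff.

Lemma closed_equalizer (X Y : topologicalType) (f g : X -> Y) :
  hausdorff_space Y -> continuous f -> continuous g -> closed [set x | f x = g x].
Proof.
move=> hY cf cg; rewrite -openC openE => x /= nfg.
move: hY; rewrite open_hausdorff => /(_ (f x) (g x)).
have /eqP fg : f x <> g x by [].
move=> /(_ fg)[[A B] /= [Af Bg] [oA oB /eqP/seteqP[AB _]]].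
rewrite !inE in Af Bg.
have fA : nbhs x (f @^-1` A) by apply: cf; exact: open_nbhs_nbhs.
have gB : nbhs x (g @^-1` B) by apply: cg; exact: open_nbhs_nbhs.
apply: filterS2 fA gB => y /= Ay By fgy; apply: (AB (f y)); split=> //.
by rewrite fgy.
Qed.

(* The library states compact_cover for pointed spaces only. *)
Lemma compact_finite_cover (X : topologicalType) (I : choiceType) (K : set X)
    (f : I -> set X) : compact K -> (forall j, open (f j)) ->
  (forall x, K x -> exists j, f j x) ->
  exists D : {fset I}, forall x, K x -> exists2 j, j \in D & f j x.
Proof.
move=> /compact_near_coveringP cK oF cov.
(* The filter of finite index sets directed by inclusion: compactness in its near-covering form
   yields a property of all sufficiently large [D]. *)
pose F : set_system {fset I} :=
  [set S | exists D0 : {fset I}, forall D : {fset I}, {subset D0 <= D} -> S D].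
have FF : Filter F.
  split.
  - by exists fset0.
  - move=> P Q [A hA] [B hB]; exists (A `|` B)%fset => D AB; split.
    + by apply: hA => j jA; apply: AB; rewrite inE jA.
    + by apply: hB => j jB; apply: AB; rewrite inE jB orbT.
  - by move=> P Q PQ [A hA]; exists A => D /hA/PQ.
have := cK {fset I} F (fun D x => exists2 j, j \in D & f j x) FF.
case.
  move=> x Kx; have [j fx] := cov x Kx.
  exists (f j, [set D : {fset I} | j \in D]) => /=.
    split; first by apply: open_nbhs_nbhs; split.
    by exists [fset j]%fset => D /(_ j); rewrite inE eqxx; exact.
  by move=> [y D] /= [fy jD]; exists j.
by move=> D hD; exists D => x; apply: hD.
Qed.

Section SigmaC.
Variables (R : realType) (G E : topologicalType).
Variables (gG : groupoid G) (gE : groupoid E).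
Variables (i : G * C R -> E) (q : E -> G).
Hypothesis etG : hausdorff_etale gG.
Hypothesis T : twist gG gE i q.
Local Notation r := (rng gE).
Local Notation ph := (phase gE i q).
Local Notation equiv := (equivariant_on gE i q).
Local Notation Sc := (Sigma_c gE i q).
Implicit Types (f g : E -> C R) (e : E).

Let lcG := etale_locally_compact etG.
Let hG := etale_hausdorff etG.
Let cq : continuous q := twist_q_continuous T.

Lemma Sigma_c_compact f (K : set E) : continuous f -> compact K ->
  (forall e, f e != 0 -> K e) -> equiv setT f -> Sc f.
Proof.
move=> cf cK fK ef; split=> //; apply: (subclosed_compact _ cK).
  exact: closed_closure.
have clK : closed K by apply: compact_closed => //; exact: (twist_hausdorff T).
by rewrite [X in _ `<=` X]((closure_id K).1 clK); apply: closureS => e /= /fK.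
Qed.

Lemma Sigma_c0 : Sc 0.
Proof.
apply: (@Sigma_c_compact _ set0).
- by move=> e; exact: cvg_cst.
- exact: compact0.
- by move=> e; rewrite eqxx.
- by move=> z e _ _; rewrite [RHS]mulr0.
Qed.

Lemma Sigma_cD f g : Sc f -> Sc g -> Sc (f + g).
Proof.
move=> [cf kf ef] [cg kg eg].
apply: (@Sigma_c_compact _ (closure [set e | f e != 0] `|` closure [set e | g e != 0])).
- by move=> e; apply: cvgD; [exact: cf|exact: cg].
- exact: compactU.
- move=> e fg; have [f0|f0] := eqVneq (f e) 0; last first.
    by left; exact: subset_closure.
  right; apply: subset_closure => /=; apply: contra fg => /eqP g0.
  by rewrite -[(f + g) e]/(f e + g e) f0 g0 addr0.
- by move=> z e cz _; rewrite -[LHS]/(f _ + g _) ef// eg// -mulrDr.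
Qed.

(** Continuity of [h] is asked only on the closed support of [f]; this permits division by functions
    that vanish elsewhere. *)
Lemma Sigma_c_mul f (h : E -> C R) : Sc f ->
  (forall z e, circle z -> h (ph z e) = h e) ->
  (forall e, closure [set e | f e != 0] e -> {for e, continuous h}) ->
  Sc (fun e => h e * f e).
Proof.
move=> [cf kf ef] ih ch.
apply: (Sigma_c_compact _ kf) => [e|e|z e cz _].
- have [Ke|nKe] := pselect (closure [set e | f e != 0] e).
    by apply: cvgM; [exact: ch|exact: cf].
  have oK : open (~` closure [set e | f e != 0]) by rewrite openC; exact: closed_closure.
  apply: (near_continuous (g := fun=> 0)); last exact: cvg_cst.
  apply: filterS (open_nbhs_nbhs (conj oK nKe)) => a na.
  suff -> : f a = 0 by rewrite mulr0.
  by apply/eqP/negPn/negP => fa; apply: na; exact: subset_closure.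
- by move=> hf; apply: subset_closure => /=; apply: contra_neq hf => ->; rewrite mulr0.
- by rewrite ih// ef// mulrCA.
Qed.

Lemma Sigma_cZ c f : Sc f -> Sc (c *: f).
Proof. by move=> sf; apply: (Sigma_c_mul (h := fun=> c)) => // e _; exact: cvg_cst. Qed.

(** The coordinate [zeta] is itself equivariant over its chart; a bump function living in a compact
    part of the chart extends it by 0. *)
Lemma Sigma_c_section (a : G) (O' : set G) : open O' -> O' a ->
  exists F, [/\ Sc F, forall e, F e != 0 -> O' (q e) & forall e, q e = a -> F e != 0].
Proof.
move=> oO' O'a; have [U [P [zeta [[oU Ua] hP hz cz cK]]]] := local_coordinate T a.
have oV : open (O' `&` U) by exact: openI.
have Va : (O' `&` U) a by [].
have [K [kK clK KV Ka]] := compact_neighbourhood R lcG hG oV Va.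
have [phi [cphi phi0 phia phiK]] :=
  bump_function R lcG hG (@open_interior _ K) Ka.
have phiK' e : phi (q e) != 0 -> K (q e) by move/phiK/interior_subset.
pose F e : C R := (phi (q e))%:C%C * zeta e.
have FK e : F e != 0 -> K (q e).
  by move=> h; apply: phiK'; apply: contra_neq h => h; rewrite /F h mul0r.
exists F; split; last 2 first.
- by move=> e /FK/KV[].
- move=> e ea; have Ue : U (q e) by rewrite ea.
  have [cze _] := hz _ Ue.
  by rewrite /F ea phia mul1r; exact: circle_neq0.
apply: (Sigma_c_compact _ (cK _ kK _)).
- move=> e; have [Ue|nUe] := pselect (U (q e)).
    apply: cvgM; last exact: cz.
    apply: (@continuous_cplx _ _ (fun e => phi (q e)) (fun=> 0)); last exact: cvg_cst.
    by apply: continuous_comp; [exact: cq|exact: cphi].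
  apply: (near_continuous (g := fun=> 0)); last exact: cvg_cst.
  have oK : open (q @^-1` (~` K)) by apply: open_comp => [? _|]; [exact: cq|rewrite openC].
  have nKe : (q @^-1` (~` K)) e by move=> /KV[].
  apply: filterS (open_nbhs_nbhs (conj oK nKe)) => b /= nKb.
  by apply/eqP/negPn/negP => /FK.
- by move=> e /KV[].
- by move=> e /FK.
- move=> z e cz' _; have [Ue|nUe] := pselect (U (q e)); last first.
    have F0 b : ~ U (q b) -> F b = 0.
      by move=> nU; apply/eqP/negPn/negP => /FK/KV[].
    by rewrite !F0 ?mulr0// (q_phase T).
  have [cze eE] := hz _ Ue.
  have [czp pE] : circle (zeta (ph z e)) /\ ph z e = ph (zeta (ph z e)) (P (q e)).
    by have := hz (ph z e); rewrite (q_phase T)//; exact.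
  rewrite /F (q_phase T)// mulrCA; congr (_ * _).
  apply: (phase_inj T (a := P (q e))) => //; first exact: circleM.
  by rewrite -pE -(phaseM T)// -eE.
Qed.

(** Partition of unity: finitely many bump functions have a sum [Phi] that is positive on the closed
    support of [f]. The weights factor through [q], hence preserve equivariance. *)
Lemma Sigma_c_local (P : (E -> C R) -> Prop) : P 0 ->
  (forall f g, Sc f -> Sc g -> P f -> P g -> P (f + g)) ->
  (forall a : G, exists U, [/\ open U, U a &
     forall f, Sc f -> (forall e, f e != 0 -> U (q e)) -> P f]) ->
  forall f, Sc f -> P f.
Proof.
move=> P0 PD PU f sf; have [cf kf ef] := sf; pose K := closure [set e | f e != 0].
have [U hU] := choice PU.
have hphi a : exists phi : G -> R, [/\ continuous phi, forall y, 0 <= phi y, phi a = 1 &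
    forall y, phi y != 0 -> U a y].
  by have [oU Ua _] := hU a; exact: (bump_function R lcG hG).
have [phi {}hphi] := choice hphi.
have [|e _|D KD] := @compact_finite_cover E G K (fun a => [set e | phi a (q e) != 0]) kf.
- move=> a; have [cphi _ _ _] := hphi a.
  apply: (@open_comp _ _ (fun e => phi a (q e)) [set t : R | t != 0]).
    by move=> e _; apply: continuous_comp; [exact: cq|exact: cphi].
  exact: open_neq.
- exists (q e) => //=; have [_ _ -> _] := hphi (q e).
  exact: oner_neq0.
pose Phi e := \sum_(a <- D) phi a (q e).
have Phi_gt0 e : K e -> 0 < Phi e.
  move=> /KD[a /= aD pa]; have [_ phi0 _ _] := hphi a.
  rewrite /Phi (big_fsetD1 a)//=; apply: ltr_pwDl.
    by rewrite lt_def pa phi0.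
  by apply: sumr_ge0 => b _; have [_ h _ _] := hphi b.
pose w a e : C R := (phi a (q e) / Phi e)%:C%C.
have cphiq a : continuous (fun e => phi a (q e)).
  move=> e; have [cphi _ _ _] := hphi a.
  by apply: continuous_comp; [exact: cq|exact: cphi].
have cPhi : continuous Phi.
  rewrite (_ : Phi = \sum_(a <- D) (fun e => phi a (q e))).
    apply: (big_ind (fun h : E -> R => continuous h)) => //.
    - by move=> e; exact: cvg_cst.
    - by move=> h k ch ck e; apply: cvgD; [exact: ch|exact: ck].
  by apply/funext => e; rewrite /Phi fct_sumE.
have sw a : Sc (fun e => w a e * f e).
  apply: Sigma_c_mul => //.
  - by move=> z e cz; rewrite /w /Phi (q_phase T).
  - move=> e Ke; apply: (@continuous_cplx _ _ _ (fun=> 0)); last exact: cvg_cst.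
    apply: cvgM; first exact: cphiq.
    by apply: cvgV; [rewrite gt_eqF ?Phi_gt0|exact: cPhi].
have fE : f = \sum_(a <- D) (fun e => w a e * f e).
  apply/funext => e; rewrite fct_sumE -mulr_suml.
  have [->|f0] := eqVneq (f e) 0; first by rewrite mulr0.
  rewrite /w -rmorph_sum -mulr_suml mulfV ?mul1r//.
  by rewrite gt_eqF// Phi_gt0//; exact: subset_closure.
suff : Sc (\sum_(a <- D) (fun e => w a e * f e)) /\ P (\sum_(a <- D) (fun e => w a e * f e)).
  by rewrite -fE => -[].
apply: (big_ind (fun g => Sc g /\ P g)).
- by split => //; exact: Sigma_c0.
- by move=> g h [sg Pg] [sh Ph]; split; [exact: Sigma_cD|exact: PD].
- move=> a _; split=> //; have [_ _] := hU a; apply=> // e we.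
  have [_ _ _ h] := hphi a; apply: h; apply: contra_neq we => h.
  by rewrite /w h mul0r mul0r.
Qed.

Definition bisection (U : set G) :=
  [/\ open U, set_inj U (src gG) & set_inj U (rng gG)].

Lemma bisection_at a : exists2 U, bisection U & U a.
Proof.
have [U [oU Ua _ [[_ iU _] _ _]]] := etale_src etG a.
have [W [oW Wa _ [[_ iW _] _ _]]] := etale_rng etG a.
exists (U `&` W); last by [].
split; first exact: openI.
  by move=> x y; rewrite !inE => -[Ux _] [Uy _]; apply: iU; rewrite inE.
by move=> x y; rewrite !inE => -[_ Wx] [_ Wy]; apply: iW; rewrite inE.
Qed.

(** A compact [K] is recorded besides the bisection because its range is closed, which the
    continuity of convolutions relies on. *)
Lemma Sigma_c_ind (P : (E -> C R) -> Prop) : P 0 ->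
  (forall f g, Sc f -> Sc g -> P f -> P g -> P (f + g)) ->
  (forall U K f, bisection U -> compact K -> K `<=` U -> Sc f ->
     (forall e, f e != 0 -> K (q e)) -> P f) ->
  forall f, Sc f -> P f.
Proof.
move=> P0 PD PU; apply: Sigma_c_local => // a.
have [U bU Ua] := bisection_at a; have [oU _ _] := bU.
have [K [kK _ KU Ka]] := compact_neighbourhood R lcG hG oU Ua.
exists (interior K); split => //; first exact: open_interior.
by move=> f sf fK; apply: (PU U K) => // e /fK/interior_subset.
Qed.

Lemma Sigma_c_equiv f : Sc f -> equiv setT f. Proof. by case. Qed.

Lemma Sigma_c_equiv_fibre f u : Sc f -> equiv (src_fibre gE u) f.
Proof. by move=> [_ _ h] z e cz _; exact: h. Qed.

Lemma Sigma_c_row_finite f : Sc f -> row_finite gE q f.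
Proof.
move: f; apply: Sigma_c_ind => [w|f g _ _ hf hg w|U K f [_ _ iU] _ KU _ fK w].
- by rewrite (_ : [set _ | _] = set0) ?image_set0// -subset0 => a [_]; rewrite eqxx.
- apply: (@sub_finite_set _ _ (q @` [set a | r a = w /\ f a != 0] `|`
      q @` [set a | r a = w /\ g a != 0])); last by rewrite finite_setU.
  move=> _ [a [ra fg] <-]; have [f0|f0] := eqVneq (f a) 0; last first.
    by left; exists a.
  right; exists a => //; split=> //; apply: contra fg => /eqP g0.
  by rewrite -[(f + g) a]/(f a + g a) f0 g0 addr0.
have [[a [ra fa]]|n] := pselect (exists a, r a = w /\ f a != 0).
  apply: (@sub_finite_set _ _ [set q a]); last exact: finite_set1.
  move=> _ [b [rb fb] <-] /=; apply: iU; rewrite ?inE; [exact/KU/fK|exact/KU/fK|].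
  by rewrite -!(q_rng T) ra rb.
rewrite (_ : [set _ | _] = set0) ?image_set0// -subset0 => a h.
by apply: n; exists a.
Qed.

End SigmaC.

(** * Closure of the equivariant functions under convolution *)

Section SigmaCAlgebra.
Variables (R : realType) (G E : topologicalType).
Variables (gG : groupoid G) (gE : groupoid E).
Variables (i : G * C R -> E) (q : E -> G).
Hypothesis etG : hausdorff_etale gG.
Hypothesis oU0 : open (units gG).
Hypothesis T : twist gG gE i q.
Local Notation s := (src gE).
Local Notation r := (rng gE).
Local Notation m := (mul gE).
Local Notation v := (inv gE).
Local Notation equiv := (equivariant_on gE i q).
Local Notation conv := (conv gG gE i q).
Local Notation Sc := (Sigma_c gE i q).
Implicit Types (f g : E -> C R) (e : E).

Let hG := etale_hausdorff etG.
Let tgE : topological_groupoid gE := twist_topological T.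
Let tgG : topological_groupoid gG := etale_topological etG.
Let cq : continuous q := twist_q_continuous T.

(** Where the integrand is nonzero, the arrow e y^-1 lies over [U] and has the range of [a], hence
    lies over [q a]; so [y] is a phase of a^-1 e. *)
Lemma conv_bisection (U : set G) f g e a : set_inj U (rng gG) -> equiv setT f ->
  (forall b, f b != 0 -> U (q b)) -> equiv (src_fibre gE (s e)) g ->
  r a = r e -> U (q a) -> conv f g e = f a * g (m (v a) e).
Proof.
move=> iU ef fU eg rae Ua; have sva : s (v a) = r e by rewrite src_inv.
have sb : s (m (v a) e) = s e by rewrite src_mul.
rewrite (conv_one etG T ef eg (b := m (v a) e))//.
  rewrite invM// inv_inv -mulA ?rng_inv// ?mul_inv -?rae ?mul_rng//.
  by rewrite src_inv -rae.
move=> y sy qy; have [->|f0] := eqVneq (f (m e (v y))) 0; first by rewrite mul0r.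
have sev : s e = r (v y) by rewrite rng_inv.
exfalso; apply: qy; have qa : q (m e (v y)) = q a.
  by apply: iU; rewrite ?inE//; [exact: fU|rewrite -!(q_rng T) rng_mul// rae].
by rewrite (q_mul T)// (q_inv T) -qa -(q_inv T) -(q_mul T) invM ?inv_inv//
   ?mulgKV// src_mul ?src_inv ?rng_inv ?sy.
Qed.

Lemma conv_eq0 f g e : equiv setT f -> equiv (src_fibre gE (s e)) g ->
  (forall a, r a = r e -> f a = 0) -> conv f g e = 0.
Proof.
move=> ef eg f0; apply: (conv_zero etG T) => // y sy.
by rewrite f0 ?mul0r// rng_mul// rng_inv.
Qed.

Lemma rng_open_map a (W : set G) : open W -> W a ->
  exists O' : set G, [/\ open O', O' (rng gG a) &
    forall w, O' w -> exists2 b, W b & rng gG b = w].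
Proof.
move=> oW Wa; have [U [oU Ua oUr [_ _ oimg]]] := etale_rng etG a.
have [D1 oD1 hD1] := oUr; have [D2 oD2 hD2] := oimg _ oW.
exists (units gG `&` D1 `&` D2); split.
- by apply: openI => //; exact: openI.
- by rewrite -hD1 -hD2; exists a.
- by move=> w; rewrite -hD1 -hD2 => -[b [_ Wb] <-]; exists b.
Qed.

Lemma rng_section (U : set G) a : bisection gG U -> U a ->
  exists tau : G -> G, [/\ {for rng gG a, continuous tau}, tau (rng gG a) = a &
    \forall w \near rng gG a, U (tau w) /\ rng gG (tau w) = w].
Proof.
move=> [oU _ iU] Ua.
have tex w : exists b, (exists2 c, U c & rng gG c = w) -> U b /\ rng gG b = w.
  have [[c Uc cw]|n] := pselect (exists2 c, U c & rng gG c = w); first by exists c.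
  by exists a => /n.
have [tau htau] := choice tex.
have taua : tau (rng gG a) = a.
  have [|h1 h2] := htau (rng gG a); first by exists a.
  by apply: iU; rewrite ?inE.
exists tau; split => //.
- move=> W; rewrite taua nbhsE => -[W' [oW' W'a] W'W].
  have [D [oD Da hD]] := rng_open_map (openI oU oW') (conj Ua W'a).
  rewrite /= nbhs_filterE; apply: filterS (open_nbhs_nbhs (conj oD Da)) => w.
  move=> /hD[b [Ub W'b] bw]; apply: W'W.
  have [|h1 h2] := htau w; first by exists b.
  by rewrite (_ : tau w = b)//; apply: iU; rewrite ?inE// h2.
- have [D [oD Da hD]] := rng_open_map oU Ua.
  apply: filterS (open_nbhs_nbhs (conj oD Da)) => w /hD[b Ub bw].
  by apply: htau; exists b.
Qed.

(** Makes the arrow [a] of [conv_bisection] depend continuously on the point: the range map is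
    inverted on [U], and the result is lifted to [E] by a local section. *)
Lemma rng_lift (U : set G) e a : bisection gG U -> U a -> rng gG a = q (r e) ->
  exists sigma : E -> E, [/\ {for e, continuous sigma}, q (sigma e) = a &
    \forall b \near e, U (q (sigma b)) /\ r (sigma b) = r b].
Proof.
move=> bU Ua ae; have [tau [ctau taua htau]] := rng_section bU Ua.
have [W [P [zeta [[oW Wa] hP _ _ _]]]] := local_coordinate T a.
have crq : {for e, continuous (fun b => q (r b))}.
  by apply: continuous_comp; [exact: continuous_rng|exact: cq].
have ctq : {for e, continuous (fun b => tau (q (r b)))}.
  by apply: continuous_comp; [exact: crq|rewrite -ae; exact: ctau].
have taue : tau (q (r e)) = a by rewrite -ae.
exists (fun b => P (tau (q (r b)))); split.
- apply: (continuous_comp (f := fun b => tau (q (r b))) ctq).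
  by rewrite taue; case: (hP _ Wa).
- by rewrite taue; case: (hP _ Wa).
- have Wn : \forall b \near e, W (tau (q (r b))).
    by have /ctq : nbhs (tau (q (r e))) W by rewrite taue; exact: open_nbhs_nbhs.
  have tn : \forall b \near e, U (tau (q (r b))) /\ rng gG (tau (q (r b))) = q (r b).
    have /crq : nbhs (q (r e)) [set w | U (tau w) /\ rng gG (tau w) = w] by rewrite -ae.
    by [].
  apply: filterS2 Wn tn => b Wb [Ub rb]; have [qP _] := hP _ Wb.
  split; first by rewrite qP.
  by apply: (q_units_inj T); [exact: units_rng|exact: units_rng|rewrite (q_rng T) qP].
Qed.

(** If [U] has an arrow with the range of [e], [rng_lift] turns [conv_bisection] into a continuous
    formula near [e]. Otherwise [e] has its range off the closed range of [K], and the convolution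
    vanishes near [e]. *)
Lemma conv_bisection_continuous U K f g : bisection gG U -> compact K -> K `<=` U ->
  Sc f -> (forall e, f e != 0 -> K (q e)) -> Sc g -> continuous (conv f g).
Proof.
move=> bU cK KU sf fK sg e; have [oU iUs iUr] := bU.
have [cf kf ef] := sf; have [cg kg eg0] := sg.
have eg b := @Sigma_c_equiv_fibre _ _ _ _ _ _ _ b sg.
have fU b : f b != 0 -> U (q b) by move=> /fK/KU.
have [[a Ua ae]|na] := pselect (exists2 a, U a & rng gG a = q (r e)).
  have [sigma [csig qsig hsig]] := rng_lift bU Ua ae.
  apply: (near_continuous (g := fun b => f (sigma b) * g (m (v (sigma b)) b))).
    by apply: filterS hsig => b [Ub rb]; apply: (conv_bisection iUr).
  have [_ rse] := nbhs_singleton hsig.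
  apply: cvgM; first by apply: continuous_comp; [exact: csig|exact: cf].
  apply: (@cvg_comp _ _ _ (fun b => m (v (sigma b)) b) g _
    (nbhs (m (v (sigma e)) e))); last exact: cg.
  apply: (cvg_mulg tgE).
  - exact: (cvg_invg tgE).
  - exact: cvg_id.
  - by apply: filterS hsig => b [_ rb]; rewrite src_inv.
  - by rewrite src_inv.
apply: (near_continuous (g := fun=> 0)); last exact: cvg_cst.
have clK : closed (rng gG @` K).
  apply: compact_closed => //; apply: continuous_compact => //.
  by apply: continuous_subspaceT => b; exact: continuous_rng.
have oO : open ((fun b => q (r b)) @^-1` (~` (rng gG @` K))).
  apply: open_comp; last by rewrite openC.
  by move=> b _; apply: continuous_comp; [exact: continuous_rng|exact: cq].
have Oe : ((fun b => q (r b)) @^-1` (~` (rng gG @` K))) e.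
  by move=> [a Ka ae]; apply: na; exists a => //; exact: KU.
apply: filterS (open_nbhs_nbhs (conj oO Oe)) => b /= nb.
apply: conv_eq0 => // a rab; apply/eqP/negPn/negP => /fK Ka; apply: nb.
by exists (q a) => //; rewrite -(q_rng T) rab.
Qed.

Lemma closed_composable : closed (composable gE).
Proof.
apply: (@closed_equalizer (E * E)%type E (fun p => s p.1) (fun p => r p.2)).
- exact: (twist_hausdorff T).
- by move=> p; apply: continuous_comp; [exact: cvg_fst|exact: continuous_src].
- by move=> p; apply: continuous_comp; [exact: cvg_snd|exact: continuous_rng].
Qed.

Lemma Sigma_c_conv f g : Sc f -> Sc g -> Sc (conv f g).
Proof.
move=> sf sg; have [cf kf ef] := sf; have [cg kg eg] := sg.
have egf u := @Sigma_c_equiv_fibre _ _ _ _ _ _ _ u sg.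
have rf := Sigma_c_row_finite etG T sf.
pose K := (closure [set e | f e != 0] `*` closure [set e | g e != 0]) `&` composable gE.
have cK : compact K.
  apply: (subclosed_compact _ (compact_setX kf kg)); last by move=> ? [].
  apply: closedI; last exact: closed_composable.
  rewrite (_ : _ `*` _ = fst @^-1` closure [set e | f e != 0] `&`
    snd @^-1` closure [set e | g e != 0])//.
  by apply: closedI; apply: preimage_closed => [p _|];
    [exact: cvg_fst|exact: closed_closure|exact: cvg_snd|exact: closed_closure].
apply: (Sigma_c_compact T (K := (fun p => m p.1 p.2) @` K)).
- move: f sf {ef kf cf rf K cK}; apply: (Sigma_c_ind etG T);
    [|move=> f f' sf sf' h h'|move=> U K f bU cK KU sf fK].
  + rewrite (_ : conv 0 g = fun=> 0); first by move=> e; exact: cvg_cst.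
    by apply/funext => e; apply: conv_eq0 => //; case: (Sigma_c0 T).
  + rewrite (_ : conv (f + f') g = conv f g + conv f' g).
      by move=> e; apply: cvgD; [exact: h|exact: h'].
    apply/funext => e; rewrite (conv_addl etG T)//.
    * by case: sf.
    * by case: sf'.
    * exact: (Sigma_c_row_finite etG T).
    * exact: (Sigma_c_row_finite etG T).
  + exact: (conv_bisection_continuous bU cK KU sf fK sg).
- apply: continuous_compact => //.
  by apply: continuous_subspaceW tgE.1 => p [].
- move=> e; apply: contra_neqP => ne; apply: (conv_zero etG T) => // y sy.
  have sev : s e = r (v y) by rewrite rng_inv.
  apply/eqP/negPn/negP; rewrite mulf_eq0 => /norP[f0 g0]; apply: ne.
  exists (m e (v y), y); last by rewrite /= mulgKV.
  split; last by rewrite /composable /= src_mul// src_inv.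
  by split; exact: subset_closure.
- move=> z e cz _; apply: (equiv_conv etG T (u := s e)) => //.
Qed.

End SigmaCAlgebra.

(** * The reduced norm *)

Section OperatorBounds.
Variables (R : realType) (G E : topologicalType).
Variables (gG : groupoid G) (gE : groupoid E).
Variables (i : G * C R -> E) (q : E -> G).
Hypothesis etG : hausdorff_etale gG.
Hypothesis oU0 : open (units gG).
Hypothesis T : twist gG gE i q.
Local Notation s := (src gE).
Local Notation r := (rng gE).
Local Notation m := (mul gE).
Local Notation v := (inv gE).
Local Notation ph := (phase gE i q).
Local Notation fp := (fibre_point q).
Local Notation equiv := (equivariant_on gE i q).
Local Notation conv := (conv gG gE i q).
Local Notation Sc := (Sigma_c gE i q).
Implicit Types (f g xi : E -> C R) (e u : E) (K : set E) (M N B : R).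

(* [l2le u xi B]: the squared norm of [xi] in L^2(G_u; E_u) is at most [B]. *)
Definition l2le u xi B := forall X : {fset G},
  (forall x, x \in X -> src_fibre gG (q u) x) ->
  \sum_(x <- X) normc (xi (fp u x)) ^+ 2 <= B.

Lemma l2le_ge0 u xi B : l2le u xi B -> 0 <= B.
Proof. by move=> /(_ fset0); rewrite big_seq_fset0; apply => x; rewrite inE. Qed.

Lemma l2leW u xi B B' : B <= B' -> l2le u xi B -> l2le u xi B'.
Proof. by move=> BB' h X /h/le_trans; apply. Qed.

Lemma sqsum_le u xi B : (sqsum gG q u xi <= B%:E)%E <-> l2le u xi B.
Proof.
split=> [h X XS|h].
  have fX : finite_set [set` X] by exact: finite_fset.
  have : ((\sum_(x <- X) normc (xi (fp u x)) ^+ 2)%:E <= sqsum gG q u xi)%E.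
    apply: ereal_sup_ubound; exists [set` X]; first by split=> // x /= /XS.
    by rewrite fsbig_finite//= set_fsetK -sumEFin.
  by move=> /le_trans/(_ h); rewrite lee_fin.
apply: ge_ereal_sup => _ [X [fX XS] <-].
rewrite fsbig_finite//= sumEFin lee_fin; apply: h => x.
by rewrite in_fset_set// inE => /XS.
Qed.

Lemma sqsum_lty u xi : (sqsum gG q u xi < +oo)%E <-> exists B, l2le u xi B.
Proof.
split=> [h|[B /sqsum_le h]]; last by rewrite (le_lt_trans h)// ltry.
exists (fine (sqsum gG q u xi)); apply/sqsum_le; rewrite fineK//.
by rewrite ge0_fin_numE//; exact: sqsum_ge0.
Qed.

Lemma l2norm_le u xi M : units gE u -> equiv (src_fibre gE u) xi -> 0 <= M ->
  (l2norm gG gE i q u xi <= M%:E)%E <-> l2le u xi (M ^+ 2).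
Proof.
move=> uu exi M0; rewrite (l2normE etG T)// -sqsum_le.
have -> : M%:E = sqrte ((M ^+ 2)%:E) by rewrite /sqrte/= sqrtr_sqr ger0_norm.
by rewrite lee_sqrt// lee_fin sqr_ge0.
Qed.

(* [opbound K f M]: the operator norm of pi_u(f) is at most [M] for [u] in [K]. *)
Definition opbound K f M := forall u xi B, K u -> equiv (src_fibre gE u) xi ->
  l2le u xi B -> l2le u (conv f xi) (M ^+ 2 * B).

(** [reduced_norm] is the case where [K] is [units gE]; smaller [K] serve for invariant sets. *)
Definition norm_on K f : \bar R :=
  maxe 0%E (ereal_sup [set pi_norm gG gE i q u f | u in K]).

Lemma l2leZ u xi B (c : C R) : l2le u xi B ->
  l2le u (fun e => c * xi e) (normc c ^+ 2 * B).
Proof.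
move=> h X XS; under eq_bigr do rewrite normcM exprMn.
by rewrite -big_distrr/= ler_wpM2l ?sqr_ge0// h.
Qed.

Lemma l2le_eq u xi xi' B : units gE u -> (forall e, s e = u -> xi e = xi' e) ->
  l2le u xi B -> l2le u xi' B.
Proof.
move=> uu h hB X XS; apply: le_trans (hB X XS).
rewrite le_eqVlt; apply/orP; left; apply/eqP; rewrite !big_seq; apply: eq_bigr => x /XS Sx.
by rewrite h// (src_fibre_point T).
Qed.

Lemma opboundW K f M N : 0 <= M -> M <= N -> opbound K f M -> opbound K f N.
Proof.
move=> M0 MN h u xi B Ku exi hB; apply: l2leW (h u xi B Ku exi hB).
rewrite ler_wpM2r ?(l2le_ge0 hB)//; apply: lerXn2r; rewrite ?nnegrE//.
exact: le_trans MN.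
Qed.

Lemma norm_on_le K f M : K `<=` units gE -> Sc f -> 0 <= M ->
  (norm_on K f <= M%:E)%E <-> opbound K f M.
Proof.
move=> Ku sf M0; have ef := Sigma_c_equiv sf; have rf := Sigma_c_row_finite etG T sf.
have ecf u xi : equiv (src_fibre gE u) xi -> equiv (src_fibre gE u) (conv f xi).
  exact: (equiv_conv etG T).
split=> h.
- move=> u xi B Kuu exi hB X XS.
  have uu := Ku _ Kuu; have B0 := l2le_ge0 hB.
  apply/ler_addgt0Pr => e e0.
  have M2 : 0 < M ^+ 2 + 1 by rewrite ltr_wpDl// sqr_ge0.
  (* The operator norm is a supremum over the unit ball, so [xi] has to be normalised; since [B] may
     be 0, it is replaced by a slightly larger [B'] whose excess contributes at most [e]. *)
  pose B' := B + e / (M ^+ 2 + 1); have B'0 : 0 < B' by rewrite ltr_wpDl// divr_gt0.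
  have sB' : 0 < Num.sqrt B' by rewrite sqrtr_gt0.
  pose c : C R := (Num.sqrt B')^-1%:C%C; pose xi' a := c * xi a.
  have nc : normc c = (Num.sqrt B')^-1 by rewrite normc_real ger0_norm// invr_ge0 ltW.
  have exi' : equiv (src_fibre gE u) xi' by move=> z a cz sa; rewrite /xi' exi// mulrCA.
  have hxi' : l2le u xi' (1 ^+ 2).
    have := l2leZ c (l2leW (_ : B <= B') hB); rewrite nc exprVn sqr_sqrtr ?(ltW B'0)//.
    by rewrite mulVf ?gt_eqF// expr1n; apply; rewrite lerDl divr_ge0// ltW.
  have L2xi' : L2 gG gE i q u xi'.
    by apply/(L2P etG T) => //; split=> //; apply/sqsum_lty; exists (1 ^+ 2).
  have : (l2norm gG gE i q u (conv f xi') <= M%:E)%E.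
    apply: le_trans h; rewrite /norm_on le_max; apply/orP; right.
    apply: le_trans (ereal_sup_ubound _); last by exists u; [exact: Kuu|reflexivity].
    apply: ereal_sup_ubound; exists xi' => //; split=> //=.
    by apply/l2norm_le.
  move/l2norm_le => /(_ uu (ecf _ _ exi') M0) hc.
  have := l2leZ (Num.sqrt B')%:C%C hc => hcc.
  have {hcc} : l2le u (conv f xi) (B' * M ^+ 2).
    move: hcc; rewrite normc_real ger0_norm ?sqrtr_ge0// sqr_sqrtr ?(ltW B'0)//.
    apply: l2le_eq => // a sa; rewrite (conv_scaler etG T)//; last by rewrite sa.
    by rewrite mulrA -rmorphM /= mulfV ?gt_eqF// mul1r.
  move=> /(_ X XS)/le_trans; apply.
  rewrite /B' mulrDl mulrC lerD2l mulrAC ler_pdivrMr//.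
  by rewrite ler_pM2l// lerDl.
- rewrite /norm_on ge_max lee_fin M0 /=; apply: ge_ereal_sup => _ [u Kuu <-].
  have uu := Ku _ Kuu.
  apply: ge_ereal_sup => _ [xi [/(L2P etG T)-/(_ uu)[exi _] /= xi1] <-].
  have /l2norm_le : (l2norm gG gE i q u xi <= 1%:E)%E by [].
  move=> /(_ uu exi ler01); rewrite expr1n => hxi.
  apply/l2norm_le => //; first exact: ecf.
  by have := h u xi 1 Kuu exi hxi; rewrite mulr1.
Qed.

(** For [f] over a bisection, both sides are [f a] times a convolution by [g] at b = a^-1 e, and the
    finite row support of [g] at [b] serves for both sums. [xi] is equivariant only along [E_u],
    whence the restriction on [e]. *)
Lemma conv_assoc f g xi u : Sc f -> Sc g -> equiv (src_fibre gE u) xi ->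
  forall e, s e = u -> conv (conv f g) xi e = conv f (conv g xi) e.
Proof.
move=> sf sg exi; have eg := Sigma_c_equiv sg; have rg := Sigma_c_row_finite etG T sg.
have egx : equiv (src_fibre gE u) (conv g xi) by exact: (equiv_conv etG T).
have esg w := @Sigma_c_equiv_fibre _ _ _ _ _ _ _ w sg.
move: f sf; apply: (Sigma_c_ind etG T) => [e se|f f' sf sf' h h' e se|U K f bU cK KU sf fK e se].
- have e0 : equiv setT (0 : E -> C R) by case: (Sigma_c0 T).
  have c0 : conv 0 g = 0 by apply/funext => a; apply: (conv_eq0 etG T).
  by rewrite c0 !(conv_eq0 etG T)// se.
- have rf := Sigma_c_row_finite etG T sf; have rf' := Sigma_c_row_finite etG T sf'.
  have ef := Sigma_c_equiv sf; have ef' := Sigma_c_equiv sf'.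
  have -> : conv (f + f') g = conv f g + conv f' g.
    by apply/funext => a; rewrite (conv_addl etG T).
  have sfg := Sigma_c_conv etG oU0 T sf sg; have sfg' := Sigma_c_conv etG oU0 T sf' sg.
  rewrite (conv_addl etG T (Sigma_c_equiv sfg) (Sigma_c_equiv sfg'))//; last 3 first.
  + exact: (Sigma_c_row_finite etG T).
  + exact: (Sigma_c_row_finite etG T).
  + by rewrite se.
  by rewrite h// h'// (conv_addl etG T)// se.
- have ef := Sigma_c_equiv sf; have [oU iUs iUr] := bU.
  have fU b : f b != 0 -> U (q b) by move=> /fK/KU.
  have sfg := Sigma_c_conv etG oU0 T sf sg.
  have exe : equiv (src_fibre gE (s e)) xi by rewrite se.
  have egxe : equiv (src_fibre gE (s e)) (conv g xi) by rewrite se.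
  have [[a [Ua ra]]|na] := pselect (exists a, U (q a) /\ r a = r e); last first.
    have f0 a : r a = r e -> f a = 0.
      by move=> ra; apply/eqP/negPn/negP => /fU Ua; apply: na; exists a.
    rewrite (conv_eq0 etG T ef egxe)// (conv_eq0 etG T (Sigma_c_equiv sfg) exe)//.
    by move=> a ra; rewrite (conv_eq0 etG T)// => b rb; rewrite f0// rb.
  rewrite (conv_bisection etG T iUr ef fU egxe ra Ua).
  set b := m (v a) e; have sb : s b = s e by rewrite src_mul// src_inv.
  have exb : equiv (src_fibre gE (s b)) xi by rewrite sb.
  have [X [fX XS hX]] := row_finite_supp T b rg.
  have fgE x : src_fibre gG (q (s e)) x -> conv f g (m e (v (fp (s e) x))) =
      f a * g (m b (v (fp (s e) x))).
    move=> Sx; have sx := src_fibre_point T (units_src gE e) Sx.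
    have sev : s e = r (v (fp (s e) x)) by rewrite rng_inv sx.
    rewrite (conv_bisection etG T iUr ef fU _ _ Ua)//; last by rewrite rng_mul.
    by rewrite /b mulA// src_inv.
  rewrite (conv_fsum etG T eg exb fX XS); last by move=> x Sx nx; rewrite hX// mul0r.
  rewrite sb in XS hX *.
  rewrite (conv_fsum etG T (Sigma_c_equiv sfg) exe fX XS); last first.
    by move=> x Sx nx; rewrite fgE// hX// mulr0 mul0r.
  rewrite big_distrr /= !big_seq; apply: eq_bigr => x.
  by rewrite in_fset_set// inE => /XS Sx; rewrite fgE// mulrA.
Qed.

Lemma opboundM K f g M N : K `<=` units gE -> Sc f -> Sc g ->
  opbound K f M -> opbound K g N -> opbound K (conv f g) (M * N).
Proof.
move=> Ku sf sg hf hg u xi B Kuu exi hB.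
apply: (@l2le_eq _ (conv f (conv g xi))); first exact: Ku.
  by move=> e se; rewrite (conv_assoc sf sg exi).
rewrite exprMn -mulrA; apply: hf => //; last exact: hg.
by apply: (equiv_conv etG T) => //; [exact: Sigma_c_equiv sg|exact: (Sigma_c_row_finite etG T)].
Qed.

Lemma opboundD K f g M N : K `<=` units gE -> Sc f -> Sc g -> 0 < M -> 0 < N ->
  opbound K f M -> opbound K g N -> opbound K (f + g) (M + N).
Proof.
move=> Ku sf sg M0 N0 hf hg u xi B Kuu exi hB X XS.
have h1 := hf _ _ _ Kuu exi hB X XS; have h2 := hg _ _ _ Kuu exi hB X XS.
(* |a + b|^2 <= (1 + N / M) |a|^2 + (1 + M / N) |b|^2 *)
have ab (a b : R) : (a + b) ^+ 2 <= (1 + N / M) * a ^+ 2 + (1 + M / N) * b ^+ 2.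
  have -> : (1 + N / M) * a ^+ 2 + (1 + M / N) * b ^+ 2 =
      (a + b) ^+ 2 + (N * a - M * b) ^+ 2 / (M * N).
    by field; rewrite !gt_eqF.
  by rewrite lerDl divr_ge0 ?sqr_ge0// mulr_ge0// ltW.
apply: (@le_trans _ _ (\sum_(x <- X) ((1 + N / M) * normc (conv f xi (fp u x)) ^+ 2 +
    (1 + M / N) * normc (conv g xi (fp u x)) ^+ 2))).
  rewrite !big_seq; apply: ler_sum => x /XS Sx; apply: le_trans (ab _ _).
  rewrite (conv_addl etG T); [|exact: Sigma_c_equiv sf|exact: Sigma_c_equiv sg|
    exact: (Sigma_c_row_finite etG T)..|by rewrite (src_fibre_point T (Ku _ Kuu) Sx)].
  apply: lerXn2r; rewrite ?nnegrE ?normcD//; first exact: normc_ge0.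
  by rewrite addr_ge0 ?normc_ge0.
rewrite big_split/= -!big_distrr/=.
(* The weights are those for which (1 + N/M) M^2 + (1 + M/N) N^2 = (M + N)^2; this gives the
   triangle inequality without inner products. *)
apply: (@le_trans _ _ ((1 + N / M) * (M ^+ 2 * B) + (1 + M / N) * (N ^+ 2 * B))).
  by rewrite lerD// ler_wpM2l// addr_ge0// divr_ge0// ltW.
by rewrite le_eqVlt; apply/orP; left; apply/eqP; field; rewrite !gt_eqF.
Qed.

Lemma opboundZ K f M (c : C R) : K `<=` units gE -> Sc f ->
  opbound K f M -> opbound K (c *: f) (normc c * M).
Proof.
move=> Ku sf hf u xi B Kuu exi hB.
apply: (@l2le_eq _ (fun e => c * conv f xi e)); first exact: Ku.
  move=> e se; rewrite -(conv_scalel etG T)//; last by rewrite se.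
  - exact: Sigma_c_equiv sf.
  - exact: (Sigma_c_row_finite etG T).
by rewrite exprMn -mulrA; apply: l2leZ; exact: hf.
Qed.

(** The row [x] has at most one contributing column [y x], reached by the arrow [al x] of [U] with
    the range of [x]. Injectivity of the source on [U] makes [y] injective, so no column is counted
    twice. *)
Lemma opbound_bisection K (U : set G) f M : K `<=` units gE ->
  set_inj U (src gG) -> set_inj U (rng gG) -> equiv setT f ->
  (forall e, f e != 0 -> U (q e)) -> (forall e, normc (f e) <= M) -> opbound K f M.
Proof.
move=> Ku iUs iUr ef fU fM u xi B Kuu exi hB X XS; have uu := Ku _ Kuu.
pose P x a := U (q a) /\ r a = r (fp u x).
have alx x : exists a, (exists b, P x b) -> P x a.
  have [[a Pa]|n] := pselect (exists a, P x a); first by exists a.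
  by exists u => /n.
have [al hal] := choice alx.
pose p x := `[< exists a, P x a >].
pose y x := q (m (v (al x)) (fp u x)).
have sfx x : x \in X -> s (fp u x) = u by move=> /XS Sx; rewrite (src_fibre_point T).
have pal x : p x -> P x (al x) by move=> /asboolP /hal.
have sva x : p x -> s (v (al x)) = r (fp u x) by move=> /pal[_ h]; rewrite src_inv.
have yinj : {in [seq x <- X | p x] &, injective y}.
  move=> x x'; rewrite !mem_filter => /andP[px Xx] /andP[px' Xx'] yy.
  have [Ua ra] := pal _ px; have [Ua' ra'] := pal _ px'.
  have aa' : q (al x) = q (al x').
    apply: iUs; rewrite ?inE//.
    have := congr1 (rng gG) yy; rewrite /y -!(q_rng T) !rng_mul ?sva// !rng_inv.
    by rewrite !(q_src T).
  have : mul gG (q (al x)) (y x) = mul gG (q (al x')) (y x') by rewrite aa' yy.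
  rewrite /y -!(q_mul T) ?rng_mul ?rng_inv ?sva// !mulKVg//.
  by rewrite !(q_fibre_point T).
apply: (@le_trans _ _ (\sum_(x <- X | p x) M ^+ 2 * normc (xi (fp u (y x))) ^+ 2)).
  rewrite [leRHS]big_mkcond !big_seq; apply: ler_sum => x Xx; have sx := sfx _ Xx.
  have exx : equiv (src_fibre gE (s (fp u x))) xi by rewrite sx.
  case: ifPn => [px|/asboolPn npx]; last first.
    rewrite (conv_eq0 etG T ef exx) ?normc0 ?expr0n// => a ra.
    by apply/eqP/negPn/negP => /fU Ua; apply: npx; exists a.
  have [Ua ra] := pal _ px.
  rewrite (conv_bisection etG T iUr ef fU exx ra Ua) normcM exprMn.
  have [z cz ->] : exists2 z, circle z & fp u (y x) = ph z (m (v (al x)) (fp u x)).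
    by apply: (q_fibre T); rewrite (q_fibre_point T).
  rewrite exi//; last by rewrite /src_fibre/= src_mul ?sva.
  rewrite normcM (circleE z).1// mul1r ler_wpM2r ?sqr_ge0//.
  have M0 : 0 <= M by apply: le_trans (fM u); exact: normc_ge0.
  by apply: lerXn2r; rewrite ?nnegrE ?normc_ge0.
rewrite -big_distrr/= ler_wpM2l ?sqr_ge0//.
rewrite -big_filter -(big_map y xpredT (fun t => normc (xi (fp u t)) ^+ 2)).
have uY : uniq [seq y x | x <- [seq x <- X | p x]].
  by rewrite map_inj_in_uniq// filter_uniq// fset_uniq.
pose Y := [fset t in [seq y x | x <- [seq x <- X | p x]]]%fset.
have := hB Y; rewrite (perm_big [seq y x | x <- [seq x <- X | p x]]).
  apply=> t; rewrite inE/= => /mapP[x]; rewrite mem_filter => /andP[px Xx] ->.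
  rewrite /src_fibre/= /y -(q_src T) src_mul ?sva// sfx//.
apply: uniq_perm => //; first exact: fset_uniq.
by move=> t; rewrite !inE.
Qed.

(** The unit vector at [u], an equivariant section cut down to the fibre of [q] through [u] and
    normalised, is mapped to a vector whose value at [e] is [f e]. *)
Lemma opbound_point K f M e : Sc f -> 0 <= M -> K (s e) -> K `<=` units gE ->
  opbound K f M -> normc (f e) <= M.
Proof.
move=> sf M0 Ke Ku hM; set u := s e; have uu : units gE u by exact: units_src.
have ef := Sigma_c_equiv sf.
have [F [sF _ Fu]] := Sigma_c_section etG T openT (I : [set: G] (q u)).
pose xi a : C R := if q a == q u then F a / F u else 0.
have exi : equiv (src_fibre gE u) xi.
  move=> z a cz _; rewrite /xi (q_phase T)//; case: ifP; last by rewrite mulr0.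
  by rewrite (Sigma_c_equiv sF)// mulrA.
have xiu : xi u = 1 by rewrite /xi eqxx mulfV// Fu.
have hxi : l2le u xi 1.
  move=> X XS; have [uX|uX] := boolP (q u \in X).
    rewrite (big_fsetD1 (q u))//= big1_seq ?addr0.
      have [z cz ->] : exists2 z, circle z & fp u (q u) = ph z u.
        by apply: (q_fibre T); rewrite (q_fibre_point T).
      by rewrite exi// ?xiu ?mulr1 ?(circleE z).1 ?expr1n// /src_fibre/= uu.
    move=> x /=; rewrite !inE => /andP[xu _].
    by rewrite /xi (q_fibre_point T) (negPf xu) normc0 expr0n.
  rewrite big1_seq// => x /= Xx; rewrite /xi (q_fibre_point T).
  by case: eqP => [xu|_]; [move: uX; rewrite -xu Xx|rewrite normc0 expr0n].
have := hM u xi 1 Ke exi hxi; rewrite mulr1 => /(_ [fset (q e)]%fset).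
rewrite big_seq_fset1; have [z cz ->] : exists2 z, circle z & fp u (q e) = ph z e.
  by apply: (q_fibre T); rewrite (q_fibre_point T).
have ec : equiv (src_fibre gE u) (conv f xi).
  by apply: (equiv_conv etG T) => //; exact: (Sigma_c_row_finite etG T).
rewrite ec// normcM (circleE z).1// mul1r.
rewrite (conv_one etG T ef exi (b := u)) ?uu//; last first.
  by move=> y _ /eqP/negPf yu; rewrite /xi yu mulr0.
rewrite xiu mulr1 inv_unit// mul_src => h.
have := h _ ; rewrite -[leRHS]/(M ^+ 2) => h'.
rewrite -(@ler_pXn2r _ 2) ?nnegrE ?normc_ge0//; apply: h' => x.
by rewrite inE => /eqP ->; rewrite /src_fibre/= (q_src T).
Qed.

End OperatorBounds.

Lemma cvg_sum_seq (K : numFieldType) (V : normedModType K) (X : Type)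
    (F : set_system X) {FF : Filter F} (I : eqType) (l : seq I)
    (f : I -> X -> V) (a : I -> V) :
  (forall j, j \in l -> f j @ F --> a j) ->
  (fun x => \sum_(j <- l) f j x) @ F --> \sum_(j <- l) a j.
Proof.
elim: l => [_|j l IH h].
  by rewrite big_nil; under eq_fun do rewrite big_nil; exact: cvg_cst.
rewrite big_cons; under eq_fun do rewrite big_cons.
apply: cvgD; first by apply: h; rewrite inE eqxx.
by apply: IH => k kl; apply: h; rewrite inE kl orbT.
Qed.

(** * Real-valued norms over a set of units *)

Section ReducedNorm.
Variables (R : realType) (G E : topologicalType).
Variables (gG : groupoid G) (gE : groupoid E).
Variables (i : G * C R -> E) (q : E -> G).
Hypothesis etG : hausdorff_etale gG.
Hypothesis oU0 : open (units gG).
Hypothesis T : twist gG gE i q.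
Local Notation s := (src gE).
Local Notation m := (mul gE).
Local Notation v := (inv gE).
Local Notation fp := (fibre_point q).
Local Notation equiv := (equivariant_on gE i q).
Local Notation conv := (conv gG gE i q).
Local Notation Sc := (Sigma_c gE i q).
Local Notation opb := (opbound gG gE i q).
Implicit Types (f g xi : E -> C R) (e u : E) (K : set E) (M N B : R).

Lemma Sigma_c_bounded f : Sc f -> exists M, forall e, normc (f e) <= M.
Proof.
move=> [cf kf ef].
have cK : compact ((fun e => normc (f e)) @` closure [set e | f e != 0]).
  apply: continuous_compact => //; apply: continuous_subspaceT => e.
  by apply: continuous_comp; [exact: cf|exact: continuous_normc].
have [M [_ hM]] := compact_bounded cK.
exists (`|M| + 1) => e; have [->|f0] := eqVneq (f e) 0.
  by rewrite normc0 addr_ge0.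
rewrite -[leLHS]ger0_norm ?normc_ge0//.
apply: (hM (`|M| + 1)) => /=; first by rewrite (le_lt_trans (ler_norm M))// ltrDl.
by exists e => //; exact: subset_closure.
Qed.

Lemma opbound_ex K f : K `<=` units gE -> Sc f -> exists2 M, 0 < M & opb K f M.
Proof.
move=> Ku; move: f; apply: (Sigma_c_ind etG T).
- exists 1 => //; apply: (opbound_bisection etG T (U := set0) Ku) => //.
  + by move=> x y; rewrite inE.
  + by move=> x y; rewrite inE.
  + by case: (Sigma_c0 T).
  + by move=> e; rewrite eqxx.
  + by move=> e; rewrite normc0.
- move=> f g sf sg [M M0 hM] [N N0 hN]; exists (M + N); first exact: addr_gt0.
  exact: opboundD.
- move=> U L f [oU iUs iUr] _ LU sf fL.
  have [M hM] := Sigma_c_bounded sf; exists (`|M| + 1); first by rewrite ltr_wpDl.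
  apply: (opbound_bisection etG T Ku iUs iUr (Sigma_c_equiv sf)).
    by move=> e /fL/LU.
  by move=> e; apply: le_trans (hM e) _; rewrite (le_trans (ler_norm M))// lerDl.
Qed.

Definition rnorm K f : R := fine (norm_on gG gE i q K f).

Lemma norm_on_ge0 K f : (0 <= norm_on gG gE i q K f)%E.
Proof. by rewrite /norm_on le_max lexx. Qed.

Lemma rnorm_ge0 K f : 0 <= rnorm K f.
Proof. by rewrite /rnorm fine_ge0// norm_on_ge0. Qed.

Lemma norm_onE K f : K `<=` units gE -> Sc f ->
  norm_on gG gE i q K f = (rnorm K f)%:E.
Proof.
move=> Ku sf; have [M M0 hM] := opbound_ex Ku sf.
rewrite fineK// ge0_fin_numE ?norm_on_ge0//.
by apply: le_lt_trans (ltry M); apply/(norm_on_le etG T Ku sf (ltW M0)).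
Qed.

Lemma rnorm_le K f M : K `<=` units gE -> Sc f -> 0 <= M ->
  rnorm K f <= M <-> opb K f M.
Proof. by move=> Ku sf M0; rewrite -(norm_on_le etG T Ku sf M0) norm_onE. Qed.

Lemma opb_rnorm K f : K `<=` units gE -> Sc f -> opb K f (rnorm K f).
Proof. by move=> Ku sf; apply/rnorm_le => //; exact: rnorm_ge0. Qed.

Lemma normc_le_rnorm K f e : K `<=` units gE -> Sc f -> K (s e) ->
  normc (f e) <= rnorm K f.
Proof.
move=> Ku sf Ke; apply: (opbound_point etG T sf (rnorm_ge0 K f) Ke Ku).
exact: opb_rnorm.
Qed.

Lemma rnorm_bisection K (U : set G) f M : K `<=` units gE -> Sc f ->
  set_inj U (src gG) -> set_inj U (rng gG) -> 0 <= M ->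
  (forall e, f e != 0 -> U (q e)) -> (forall e, normc (f e) <= M) -> rnorm K f <= M.
Proof.
move=> Ku sf iUs iUr M0 fU fM; apply/rnorm_le => //.
exact: (opbound_bisection etG T Ku iUs iUr (Sigma_c_equiv sf)).
Qed.

Lemma Sigma_cB f g : Sc f -> Sc g -> Sc (f - g).
Proof.
move=> sf sg; have -> : f - g = f + (-1) *: g.
  by apply/funext => e; rewrite -[RHS]/(f e + -1 * g e) mulN1r.
exact: (Sigma_cD T sf (Sigma_cZ T (-1) sg)).
Qed.

Lemma Sigma_c_algebra : @is_algebra R (E -> C R) Sc conv.
Proof.
have ee f u : Sc f -> equiv (src_fibre gE u) f by exact: Sigma_c_equiv_fibre.
split.
- exact: (Sigma_c0 T).
- by move=> f g; exact: (Sigma_cD T).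
- by move=> c f; exact: (Sigma_cZ T).
- by move=> f g; exact: (Sigma_c_conv etG oU0 T).
- move=> f g h sf sg sh; apply/funext => e.
  by apply: (conv_addl etG T); [case: sf|case: sg|exact: (Sigma_c_row_finite etG T)..|exact: ee].
- move=> f g h sf sg sh; apply/funext => e.
  by apply: (conv_addr etG T); [case: sf|exact: (Sigma_c_row_finite etG T)|exact: ee..].
- move=> c f g sf sg; apply/funext => e.
  by apply: (conv_scalel etG T); [case: sf|exact: (Sigma_c_row_finite etG T)|exact: ee].
- move=> c f g sf sg; apply/funext => e.
  by apply: (conv_scaler etG T); [case: sf|exact: (Sigma_c_row_finite etG T)|exact: ee].
Qed.

Lemma rnorm_algnorm K : K `<=` units gE -> @is_algnorm R (E -> C R) Sc conv (rnorm K).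
Proof.
move=> Ku.
have leZ c f : Sc f -> rnorm K (c *: f) <= normc c * rnorm K f.
  move=> sf; apply/rnorm_le => //; first exact: (Sigma_cZ T).
    by rewrite mulr_ge0 ?normc_ge0 ?rnorm_ge0.
  by apply: (opboundZ etG T) => //; exact: opb_rnorm.
split.
- exact: rnorm_ge0.
- move=> f g sf sg; apply/ler_addgt0Pr => e e0.
  have e2 : 0 < e / 2 by rewrite divr_gt0.
  (* [opboundD] needs positive bounds, while the norms may vanish; the slack [e / 2] on each side
     provides them. *)
  have -> : rnorm K f + rnorm K g + e = (rnorm K f + e / 2) + (rnorm K g + e / 2).
    by rewrite addrACA -splitr.
  have posf h : 0 < rnorm K h + e / 2 by rewrite ltr_wpDl ?rnorm_ge0.
  apply/rnorm_le => //; first exact: (Sigma_cD T).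
    by rewrite addr_ge0// ltW.
  apply: (opboundD etG T) => //.
    by apply: opboundW (opb_rnorm Ku sf); rewrite ?rnorm_ge0// lerDl ltW.
  by apply: opboundW (opb_rnorm Ku sg); rewrite ?rnorm_ge0// lerDl ltW.
- move=> c f sf; apply/eqP; rewrite eq_le leZ//=.
  have [->|c0] := eqVneq c 0; first by rewrite normc0 mul0r rnorm_ge0.
  have := leZ c^-1 (c *: f) (Sigma_cZ T c sf).
  rewrite scalerA mulVf// scale1r normcV mulrC ler_pdivlMr ?normc_gt0//.
  by rewrite mulrC.
- move=> f g sf sg; apply/rnorm_le => //; first exact: (Sigma_c_conv etG oU0 T).
    by rewrite mulr_ge0 ?rnorm_ge0.
  by apply: (opboundM etG oU0 T) => //; exact: opb_rnorm.
Qed.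

(* Matrix coefficients of pi_u(f) are values of f; a finitely supported vector
   is mapped by the sequence to a vector tending to 0 pointwise, so the Cauchy
   estimate passes to the limit in each finite block of coefficients. *)
Lemma rnorm_pointwise_null (K := units gE) (S : nat -> E -> C R) :
  (forall n, Sc (S n)) ->
  (forall eps : R, 0 < eps -> exists k, forall j n, (k <= j)%N -> (k <= n)%N ->
     rnorm K (S j - S n) < eps) ->
  (forall e, (fun n => S n e) @ \oo --> (0 : C R)) ->
  forall eps : R, 0 < eps -> exists k, forall n, (k <= n)%N -> rnorm K (S n) < eps.
Proof.
move=> sS cS S0 eps eps0; have eps2 : 0 < eps / 2 by rewrite divr_gt0.
have [k hk] := cS _ eps2; exists k => n kn.
apply: (@le_lt_trans _ _ (eps / 2)); last by rewrite ltr_pdivrMr// mulr_natr mulr2n ltrDl.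
apply/rnorm_le => //; first exact: ltW.
move=> u xi B uu exi hB X XS.
have hsupp x : exists Y, src_fibre gG (q u) x -> [/\ finite_set Y,
    Y `<=` src_fibre gG (q u) &
    forall y, src_fibre gG (q u) y -> ~ Y y -> S n (m (fp u x) (v (fp u y))) = 0].
  have [Sx|nS] := pselect (src_fibre gG (q u) x); last by exists set0.
  have [Y] := row_finite_supp T (fp u x) (Sigma_c_row_finite etG T (sS n)).
  by rewrite (src_fibre_point T)// => hY; exists Y.
have [Yx hYx] := choice hsupp.
(* The columns met by the rows in [X] of the matrix of [S n]. Truncating [xi] to [Y] leaves these
   rows of the product unchanged, and makes every [S j] act on the truncation by the same finite
   index set. *)
pose Y := \bigcup_(x in [set` X]) Yx x.
have fY : finite_set Y.
  by apply: bigcup_finite => [|x /= /XS Sx]; [exact: finite_fset|have [] := hYx x Sx].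
have YS : Y `<=` src_fibre gG (q u).
  by move=> y [x /= /XS Sx]; have [_ h _] := hYx x Sx; exact: h.
pose xi' a : C R := if q a \in Y then xi a else 0.
have exi' : equiv (src_fibre gE u) xi'.
  move=> z a cz sa; rewrite /xi' (q_phase T)//; case: ifP; last by rewrite mulr0.
  by rewrite exi.
have hB' : l2le gG q u xi' B.
  move=> Z ZS; apply: le_trans (hB Z ZS); apply: ler_sum => z _; rewrite /xi'.
  by case: ifP => // _; rewrite normc0 expr0n/= sqr_ge0.
have exis x : src_fibre gG (q u) x -> equiv (src_fibre gE (s (fp u x))) xi.
  by move=> Sx; rewrite (src_fibre_point T).
have exi's x : src_fibre gG (q u) x -> equiv (src_fibre gE (s (fp u x))) xi'.
  by move=> Sx; rewrite (src_fibre_point T).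
have xi'E y : Y y -> xi' (fp u y) = xi (fp u y).
  by move=> Yy; rewrite /xi' (q_fibre_point T) mem_set.
have convE f x : Sc f -> src_fibre gG (q u) x ->
    conv f xi' (fp u x) = \sum_(y <- fset_set Y) f (m (fp u x) (v (fp u y))) * xi' (fp u y).
  move=> sf Sx; have sx := src_fibre_point T uu Sx.
  have := conv_fsum etG T (Sigma_c_equiv sf) (exi's x Sx) fY; rewrite sx; apply => //.
  by move=> y _ nYy; rewrite /xi' (q_fibre_point T) memNset ?mulr0.
rewrite (_ : \sum_(x <- X) _ = \sum_(x <- X) normc (conv (S n) xi' (fp u x)) ^+ 2); last first.
  rewrite !big_seq; apply: eq_bigr => x Xx; have Sx := XS _ Xx.
  congr (normc _ ^+ 2); rewrite convE//.
  have sx := src_fibre_point T uu Sx.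
  have := conv_fsum etG T (Sigma_c_equiv (sS n)) (exis x Sx) fY; rewrite sx => -> //.
    rewrite !big_seq; apply: eq_bigr => y; rewrite in_fset_set// inE => Yy.
    by rewrite xi'E.
  move=> y Sy nYy; have [_ _ h] := hYx x Sx; rewrite h ?mul0r// => yy.
  by apply: nYy; exists x.
(* With [n] fixed and [j] growing, the coefficients of [S j] in this finite block tend to 0, so the
   bound on [S n - S j] passes to [S n]. *)
have lim0 : (fun j => \sum_(x <- X) normc (conv (S n - S j) xi' (fp u x)) ^+ 2) @ \oo -->
    \sum_(x <- X) normc (conv (S n) xi' (fp u x)) ^+ 2.
  apply: cvg_sum_seq => x Xx; have Sx := XS _ Xx.
  have sB j : Sc (S n - S j) by exact: Sigma_cB.
  apply: (@cvg_comp _ _ _ (fun j => conv (S n - S j) xi' (fp u x)) (fun z : C R => normc z ^+ 2)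
     _ (nbhs (conv (S n) xi' (fp u x)))); last first.
    by apply: cvgM; exact: continuous_normc.
  rewrite convE//; under eq_fun do rewrite convE//.
  apply: (@cvg_sum_seq R[i] (C R) nat \oo _ G (fset_set Y)
    (fun y j => (S n - S j) (m (fp u x) (v (fp u y))) * xi' (fp u y))
    (fun y => S n (m (fp u x) (v (fp u y))) * xi' (fp u y))) => y _.
  have h : (fun j => S n (m (fp u x) (v (fp u y))) - S j (m (fp u x) (v (fp u y)))) @ \oo
      --> S n (m (fp u x) (v (fp u y))).
    rewrite -[X in _ --> X]subr0.
    by apply: cvgB; [exact: cvg_cst|exact: S0].
  exact: (@cvgMr_tmp _ _ _ _ _ _ (xi' (fp u y)) h).
apply: (cvgr_to_le lim0); exists k => // j /= kj.
have sB : Sc (S n - S j) by exact: Sigma_cB.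
have /(rnorm_le _ sB (ltW eps2)) hb : rnorm K (S n - S j) <= eps / 2 by rewrite ltW// hk.
exact: (hb _ u xi' B uu exi' hB' X XS).
Qed.

End ReducedNorm.

(** * Functions supported on the units *)

Section UnitFunctions.
Variables (R : realType) (G E : topologicalType).
Variables (gG : groupoid G) (gE : groupoid E).
Variables (i : G * C R -> E) (q : E -> G).
Hypothesis etG : hausdorff_etale gG.
Hypothesis oU0 : open (units gG).
Hypothesis T : twist gG gE i q.
Local Notation s := (src gE).
Local Notation r := (rng gE).
Local Notation ph := (phase gE i q).
Local Notation equiv := (equivariant_on gE i q).
Local Notation conv := (conv gG gE i q).
Local Notation Sc := (Sigma_c gE i q).
Implicit Types (f g xi : E -> C R) (e u : E).

Let tgE : topological_groupoid gE := twist_topological T.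
Let tgG : topological_groupoid gG := etale_topological etG.

Lemma src_open_map a (W : set G) : open W -> W a ->
  exists O' : set G, [/\ open O', O' (src gG a) &
    forall w, O' w -> exists2 b, W b & src gG b = w].
Proof.
move=> oW Wa; have oW' : open (inv gG @^-1` W).
  by apply: open_comp => // b _; exact: tgG.2.
have W'a : (inv gG @^-1` W) (inv gG a) by rewrite /preimage/= inv_inv.
have [D [oD Da hD]] := rng_open_map etG oU0 oW' W'a.
exists D; split=> //; first by rewrite -rng_inv.
by move=> w /hD[b Wb <-]; exists (inv gG b) => //; rewrite src_inv.
Qed.

Lemma closed_units : closed (units gG).
Proof.
apply: closed_equalizer; [exact: etale_hausdorff etG|exact: (continuous_src tgG)|].
by move=> x; exact: cvg_id.
Qed.

(** * Shrinking open sets of units by effectiveness *)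

Section Effective.
Hypothesis effG : effective gG.

(** If an arrow of [U] moves its source in [V], separate source from range and keep only sources of
    arrows of [U] that end in the second set; [U] has one arrow per source. Otherwise all arrows of
    [U] over [V] are isotropy and form an open set, hence are units by effectiveness; so there are
    none. *)
Lemma bisection_shrink (U V : set G) : bisection gG U -> U `&` units gG = set0 ->
  open V -> V !=set0 ->
  exists W, [/\ open W, W !=set0, W `<=` V &
    forall a, U a -> W (src gG a) -> W (rng gG a) -> False].
Proof.
move=> [oU iUs _] U0 oV [x Vx].
have [[a [Ua Va na]]|n] := pselect (exists a, [/\ U a, V (src gG a) & rng gG a <> src gG a]).
  have hG := etale_hausdorff etG; rewrite open_hausdorff in hG.
  have /eqP /hG : src gG a <> rng gG a by move=> h; apply: na.
  move=> [[W1 W2] /= [/set_mem W1a /set_mem W2a] [oW1 oW2 /eqP/seteqP[W12 _]]].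
  have oA : open (U `&` rng gG @^-1` W2).
    by apply: openI => //; apply: open_comp => // b _; exact: (continuous_rng tgG).
  have [D [oD Da hD]] := src_open_map oA (conj Ua W2a).
  exists (V `&` W1 `&` D); split.
  - by apply: openI => //; exact: openI.
  - by exists (src gG a).
  - by move=> y [[]].
  - move=> b Ub [[_ _] /hD[b' [Ub' W2b'] b'b]] [[_ W1b] _].
    have bb' : b' = b by apply: iUs; rewrite ?inE.
    by apply: (W12 (rng gG b)); split=> //; rewrite -bb'.
have noU a : U a -> V (src gG a) -> False.
  move=> Ua Va; have oA : open (U `&` src gG @^-1` V).
    by apply: openI => //; apply: open_comp => // b _; exact: (continuous_src tgG).
  have AI : U `&` src gG @^-1` V `<=` Iso gG.
    by move=> b [Ub Vb]; apply: contrapT => nb; apply: n; exists b.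
  have : interior (Iso gG) a.
    by apply: (filterS AI); apply: open_nbhs_nbhs; split.
  by rewrite effG => ua; have : (U `&` units gG) a by []; rewrite U0.
by exists V; split=> //; [exists x|move=> a Ua Va _; exact: noU Va].
Qed.

(** The units are closed, so [D] is covered by finitely many bisections that avoid them; [V] is
    shrunk once for each. *)
Lemma effective_shrink (D V : set G) : compact D -> D `&` units gG = set0 ->
  open V -> V !=set0 ->
  exists W, [/\ open W, W !=set0, W `<=` V &
    forall a, D a -> W (src gG a) -> W (rng gG a) -> False].
Proof.
move=> cD D0 oV V0.
have hex a : exists U, bisection gG U /\ U a.
  by have [U bU Ua] := bisection_at etG a; exists U.
have [B hB] := choice hex.
have oN : open (~` units gG) by rewrite openC; exact: closed_units.
have bB a : bisection gG (B a `&` ~` units gG).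
  have [[oB iBs iBr] _] := hB a; split; first exact: openI.
    by move=> x y; rewrite !inE => -[Bx _] [By _]; apply: iBs; rewrite inE.
  by move=> x y; rewrite !inE => -[Bx _] [By _]; apply: iBr; rewrite inE.
have [|x Dx|F hF] := @compact_finite_cover G G D (fun a => B a `&` ~` units gG) cD.
- by move=> a; have [] := bB a.
- exists x; split; first by have [] := hB x.
  by move=> ux; have : (D `&` units gG) x by []; rewrite D0.
have [W [oW W0 WV hW]] : exists W, [/\ open W, W !=set0, W `<=` V &
    forall b, b \in (F : seq G) -> forall a, (B b `&` ~` units gG) a ->
      W (src gG a) -> W (rng gG a) -> False].
  elim: (F : seq G) => [|b l [W [oW W0 WV hW]]]; first by exists V; split=> // b; rewrite in_nil.
  have [|W' [oW' W'0 W'W hW']] := bisection_shrink (bB b) _ oW W0.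
    by rewrite -setIA setICl setI0.
  exists W'; split=> //; first exact: subset_trans WV.
  move=> c; rewrite inE => /orP[/eqP ->|cl] a Ba Wsa Wra; first exact: (hW' a).
  by apply: (hW c cl a Ba); exact: W'W.
exists W; split=> // a Da Wsa Wra; have [b bF Bb] := hF a Da.
exact: (hW b bF a Bb).
Qed.

End Effective.

Definition unit_supported f := forall e, f e != 0 -> units gG (q e).

Lemma units_src_inj : set_inj (units gG) (src gG).
Proof. by move=> x y; rewrite !inE => xu yu; rewrite xu yu. Qed.

Lemma units_rng_inj : set_inj (units gG) (rng gG).
Proof. by move=> x y; rewrite !inE => xu yu; rewrite !rng_unit. Qed.

Lemma q_rng_unit e : units gG (q e) -> q (r e) = q e.
Proof. by move=> ue; rewrite (q_rng T) rng_unit. Qed.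

Lemma unit_phase e : units gG (q e) -> exists2 z, circle z & e = ph z (r e).
Proof. by move=> ue; apply: (q_fibre T); exact: q_rng_unit. Qed.

Lemma conv_unitl f g e : equiv setT f -> unit_supported f ->
  equiv (src_fibre gE (s e)) g -> conv f g e = f (r e) * g e.
Proof.
move=> ef fU eg; have re : r (r e) = r e by rewrite rng_rng.
rewrite (conv_bisection etG T units_rng_inj ef fU eg re); last first.
  exact/(q_unit T)/units_rng.
by rewrite inv_unit ?mul_rng//; exact: units_rng.
Qed.

Lemma conv_unitr f g e : equiv setT f -> equiv (src_fibre gE (s e)) g ->
  unit_supported g -> conv f g e = f e * g (s e).
Proof.
move=> ef eg gU; rewrite (conv_one etG T ef eg (b := s e)) ?src_src//.
  by rewrite inv_unit ?mul_src//; exact: units_src.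
move=> y sy qy; have [->|g0] := eqVneq (g y) 0; first by rewrite mulr0.
by exfalso; apply: qy; rewrite -(gU _ g0) -(q_src T) sy.
Qed.

Lemma unit_supported_conv f g : Sc f -> Sc g -> unit_supported f -> unit_supported g ->
  unit_supported (conv f g).
Proof.
move=> sf sg fU gU e; rewrite conv_unitl//.
- by rewrite mulf_eq0 => /norP[_ /gU].
- exact: Sigma_c_equiv sf.
- exact: Sigma_c_equiv_fibre.
Qed.

Lemma unit_normc_le f (M : R) : equiv setT f -> unit_supported f -> 0 <= M ->
  (forall u, units gE u -> normc (f u) <= M) -> forall e, normc (f e) <= M.
Proof.
move=> ef fU M0 fM e; have [->|f0] := eqVneq (f e) 0; first by rewrite normc0.
have [z cz ->] := unit_phase (fU _ f0).
by rewrite ef// normcM (circleE z).1// mul1r fM//; exact: units_rng.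
Qed.

Lemma unit_restriction_continuous f x : Sc f -> units gG x ->
  {for x, continuous (fun y => f (i (y, 1)))}.
Proof.
move=> [cf _ _] ux.
have h1 : (fun y : G => y) @ x --> x by exact: cvg_id.
have h2 : (fun=> 1 : C R) @ x --> (1 : C R) by exact: cvg_cst.
have ci : (fun y => i (y, 1 : C R)) @ x --> i (x, 1 : C R).
  apply: (@cvg_within_comp _ _ (units gG `*` @circle R) i _ (nbhs x) _
    (fun y => (y, 1 : C R)) (x, 1)).
  - exact: (twist_i_continuous T).
  - by split => //; exact: circle1.
  - apply: filterS (open_nbhs_nbhs (conj oU0 ux)) => y uy; split => //; exact: circle1.
  - exact: (cvg_pair h1 h2).
exact: (cvg_comp _ _ ci (cf _)).
Qed.

(** With [tau] the square of |F|, normalised to 1 at [u0], the values on units are tau / max(tau,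
    1/2) for [chi] and tau * max(0, tau - 1/2) for [p]. Thus [chi] is 1 wherever tau > 1/2, in
    particular where [p] is nonzero. *)
Lemma unit_cutoff (W : set G) (u0 : E) : open W -> W `<=` units gG -> units gE u0 ->
  W (q u0) -> exists chi p, [/\ Sc chi, Sc p,
    forall a, (chi a != 0) || (p a != 0) -> W (q a),
    p u0 != 0 &
    forall u, units gE u -> normc (chi u) <= 1 /\ (p u != 0 -> chi u = 1)].
Proof.
move=> oW Wu uu Wu0; have [F [sF FW Fu]] := Sigma_c_section etG T oW Wu0.
have F0 := Fu u0 erefl; have [cF _ eF] := sF.
have nF0 : 0 < normc (F u0) ^+ 2 by rewrite exprn_gt0// normc_gt0.
pose tau e : R := normc (F (r e)) ^+ 2 / normc (F u0) ^+ 2.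
have tau0 e : 0 <= tau e by rewrite divr_ge0// sqr_ge0.
have cFr e : {for e, continuous (fun b => F (r b))}.
  by apply: continuous_comp; [exact: (continuous_rng tgE)|exact: cF].
have ctau e : {for e, continuous tau}.
  have cn : {for e, continuous (fun b => normc (F (r b)))}.
    by apply: continuous_comp; [exact: cFr|exact: continuous_normc].
  by apply: cvgMl; apply: cvgM; exact: cn.
(* The factor [F e] provides equivariance and the support, and the conjugate of [F (r e)] makes the
   value at a unit real. *)
pose k (kap : R -> R) e : C R :=
  (conjc (F (r e)) * (kap (tau e) / normc (F u0) ^+ 2)%:C%C) * F e.
have sk kap : continuous kap -> Sc (k kap).
  move=> ckap; apply: (Sigma_c_mul T
    (h := fun e => conjc (F (r e)) * (kap (tau e) / normc (F u0) ^+ 2)%:C%C) sF).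
    by move=> z e cz; rewrite /tau (rng_phase T).
  move=> e _; apply: cvgM.
    by apply: continuous_comp; [exact: cFr|exact: continuous_conjc].
  have ck : {for e, continuous (fun b => kap (tau b) / normc (F u0) ^+ 2)}.
    by apply: cvgMl; apply: continuous_comp; [exact: ctau|exact: ckap].
  exact: (@continuous_cplx R E _ (fun=> 0) e ck (cvg_cst _)).
have kE kap u : units gE u -> k kap u = (tau u * kap (tau u))%:C%C.
  move=> uu'; rewrite /k rng_unit// mulrAC [_^*%C * _]mulrC mulcJ -rmorphM; congr (_%:C%C).
  by rewrite /tau rng_unit// mulrCA mulrC.
have kW kap a : k kap a != 0 -> W (q a).
  by move=> h; apply: FW; apply: contra_neq h => h; rewrite /k h mulr0.
have cmax : continuous (fun t : R => (Num.max t (1 / 2))^-1).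
  move=> t; apply: cvgV; first by rewrite gt_eqF// lt_max; apply/orP; right; rewrite divr_gt0.
  by apply: (@continuous_max _ _ (fun t => t) (fun=> 1 / 2)); [exact: cvg_id|exact: cvg_cst].
have cpos : continuous (fun t : R => Num.max 0 (t - 1 / 2)).
  move=> t; have h2 : {for t, continuous (fun t : R => t - 1 / 2)}.
    by apply: cvgB; [exact: cvg_id|exact: cvg_cst].
  have h1 : {for t, continuous (fun=> 0 : R)} by exact: cvg_cst.
  exact: (continuous_max h1 h2).
exists (k (fun t => (Num.max t (1 / 2))^-1)), (k (fun t => Num.max 0 (t - 1 / 2))); split.
- exact: sk.
- exact: sk.
- by move=> a /orP[|] /kW.
- rewrite kE// (_ : tau u0 = 1); last by rewrite /tau rng_unit// mulfV ?gt_eqF.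
  rewrite mul1r -normc_gt0 normc_real normr_gt0 gt_eqF// lt_max; apply/orP; right.
  by rewrite subr_gt0 ltr_pdivrMr ?mul1r ?ltr1n.
- move=> u uu'; rewrite !kE//; split.
    rewrite normc_real ger0_norm; last first.
      by rewrite mulr_ge0// invr_ge0 le_max tau0.
    rewrite ler_pdivrMr ?mul1r ?le_max ?lexx// lt_max; apply/orP; right.
    by rewrite invr_gt0.
  move=> h; have : tau u * Num.max 0 (tau u - 1 / 2) != 0 by apply: contra_neq h => ->.
  case: (leP 0 (tau u - 1 / 2)) => [t2 _|_]; last by rewrite mulr0 eqxx.
  have tE : Num.max (tau u) (1 / 2) = tau u by apply/max_idPl; rewrite -subr_ge0.
  rewrite tE mulfV// gt_eqF//; move: t2; rewrite subr_ge0; apply: lt_le_trans.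
  by rewrite divr_gt0.
Qed.

End UnitFunctions.

(** * Ideals and invariant sets *)

Section Main.
Variables (R : realType) (G E : topologicalType).
Variables (gG : groupoid G) (gE : groupoid E).
Variables (i : G * C R -> E) (q : E -> G).
Hypothesis etG : hausdorff_etale gG.
Hypothesis effG : effective gG.
Hypothesis T : twist gG gE i q.
Local Notation s := (src gE).
Local Notation r := (rng gE).
Local Notation m := (mul gE).
Local Notation v := (inv gE).
Local Notation equiv := (equivariant_on gE i q).
Local Notation conv := (conv gG gE i q).
Local Notation Sc := (Sigma_c gE i q).
Local Notation rn := (rnorm gG gE i q).
Implicit Types (f g : E -> C R).

Let oU0 : open (units gG).
Proof. by rewrite -effG; exact: open_interior. Qed.

Let alg := Sigma_c_algebra etG oU0 T.
Let nuP K (Ku : K `<=` units gE) := rnorm_algnorm etG oU0 T Ku.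
Let sub_units : units gE `<=` units gE. Proof. by []. Qed.

Lemma reduced_normE f : Sc f -> reduced_norm gG gE i q f = (rn (units gE) f)%:E.
Proof. by move=> sf; rewrite -(norm_onE etG T sub_units sf). Qed.

Lemma simple_minimal : simple (Cstar_r gG gE i q) -> minimal gG.
Proof.
move=> simC U [D oD UE] invU; apply: contrapT => /not_orP[U0 UT].
have oU : open U by rewrite UE; exact: openI.
have Uu : U `<=` units gG by rewrite UE => x [].
have [x0 Ux0] : U !=set0 by apply/set0P/eqP.
have [x1 [ux1 nUx1]] : exists x, units gG x /\ ~ U x.
  by apply: contrapT => n; apply: UT; apply/seteqP; split=> // x ux;
    apply: contrapT => nUx; apply: n; exists x.
pose K := [set u | units gE u /\ ~ U (q u)].
have Ku : K `<=` units gE by move=> u [].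
have muP := nuP Ku.
have munu f : Sc f -> rn K f <= rn (units gE) f.
  move=> sf; apply/(rnorm_le etG T Ku sf (rnorm_ge0 _ _ _ _ _ _)).
  by move=> u xi B [uu _]; exact: (opb_rnorm etG T sub_units sf).
have [h|h] := simple_seminorm alg (st := star gE) (nuP sub_units)
  (fun f => @reduced_normE f) muP munu simC.
(* A function over [U] is annihilated by every representation at a unit outside [U]: a contributing
   arrow [y] would lead from that unit into [U], which invariance applied to its inverse
   excludes. *)
- have [F [sF FU Fx]] := Sigma_c_section etG T oU Ux0.
  have : rn (units gE) F = 0.
    apply: h => //; apply/eqP; rewrite eq_le rnorm_ge0 andbT.
    apply/(rnorm_le etG T Ku sF (lexx 0)) => u xi B [uu nUu] exi hB X XS.
    rewrite expr2 !mul0r big_seq big1// => x /XS Sx.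
    have sx := src_fibre_point T uu Sx.
    rewrite (conv_zero etG T (Sigma_c_equiv sF)) ?normc0 ?expr0n ?sx// => y.
    rewrite ?sx => sy.
    set a := m _ _; have [->|Fa] := eqVneq (F a) 0; first by rewrite mul0r.
    have Ua := FU _ Fa; exfalso; apply: nUu.
    have sa : s a = r y by rewrite src_mul ?src_inv// sx rng_inv sy.
    have Ury : U (rng gG (q y)).
      by rewrite -(q_rng T) -sa (q_src T) (Uu _ Ua).
    have := invU (inv gG (q y)); rewrite src_inv rng_inv => /(_ Ury).
    by rewrite -(q_src T) sy.
  move=> F0; have u0 : units gE (i (x0, 1)) by apply: (units_i1 T); exact: Uu.
  have := normc_le_rnorm etG T (e := i (x0, 1)) sub_units sF.
  rewrite u0 F0 => /(_ u0); apply/negP; rewrite -ltNge normc_gt0.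
  by apply: Fx; rewrite (q_i T)//; [exact: Uu|exact: circle1].
- have [F [sF _ Fx]] := Sigma_c_section etG T oU0 ux1.
  have u1 := units_i1 T ux1.
  have := normc_le_rnorm etG T (e := i (x1, 1)) Ku sF; rewrite h// u1.
  have qx1 : q (i (x1, 1)) = x1 by apply: (q_i T) => //; exact: circle1.
  have K1 : K (i (x1, 1)) by split; rewrite ?qx1.
  move=> /(_ K1); apply/negP; rewrite -ltNge normc_gt0.
  exact: Fx.
Qed.

(** * The quotient by a nonzero closed ideal *)

Section QuotientNorm.
Variable Q : (E -> C R) -> R -> Prop.
Hypothesis QP : is_quotnorm Sc conv (rn (units gE)) Q.

(** In [null_ideal_unit], 1/5 bounds the quotient norm of the error [d], and 4/10 that of the
    compression divided by [c]. *)
Let num1 : (1 / 5 + 4 / 10 <= 3 / 5 :> R). Proof. by lra. Qed.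
Let num2 : (0 <= 3 / 5 :> R). Proof. by lra. Qed.
Let num3 : (3 / 5 < 1 :> R). Proof. by lra. Qed.

Let nu0 : rn (units gE) 0 = 0.
Proof. exact: (algnorm0 alg (nuP sub_units)). Qed.

(** Adding the zero function, for which every positive bound holds, raises the bound from [a] to
    [b]. *)
Lemma quot_mono f (a b : R) : a <= b -> Q f a -> Q f b.
Proof.
rewrite le_eqVlt => /orP[/eqP <-//|ab] Qf.
have Q0 : Q 0 (b - a) by apply: (quot_norm QP); [exact: (Sigma_c0 T)|rewrite nu0 subr_gt0].
by have := quotD QP Qf Q0; rewrite addr0 [a + _]addrC subrK.
Qed.

Definition null_ideal f := Sc f /\ forall eps : R, 0 < eps -> Q f eps.

Let nuS f : Sc f -> Q f (rn (units gE) f + 1).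
Proof. by move=> sf; apply: (quot_norm QP) => //; rewrite ltrDl. Qed.

Let nuS_gt0 f : 0 < rn (units gE) f + 1.
Proof. by rewrite ltr_wpDl// rnorm_ge0. Qed.

Lemma null_ideal0 : null_ideal 0.
Proof.
split; first exact: (Sigma_c0 T).
by move=> eps eps0; apply: (quot_norm QP); rewrite ?nu0//; exact: (Sigma_c0 T).
Qed.

Lemma null_idealD f g : null_ideal f -> null_ideal g -> null_ideal (f + g).
Proof.
move=> [sf hf] [sg hg]; split; first exact: (Sigma_cD T).
move=> eps eps0; have e2 : 0 < eps / 2 by rewrite divr_gt0.
by rewrite [eps]splitr; apply: (quotD QP); [exact: hf|exact: hg].
Qed.

Lemma null_idealMl f g : Sc f -> null_ideal g -> null_ideal (conv f g).
Proof.
move=> sf [sg hg]; split; first exact: (Sigma_c_conv etG oU0 T).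
move=> eps eps0; have := quotM QP (nuS sf) (hg _ (divr_gt0 eps0 (nuS_gt0 f))).
by rewrite mulrC divfK// gt_eqF.
Qed.

Lemma null_idealMr f g : null_ideal f -> Sc g -> null_ideal (conv f g).
Proof.
move=> [sf hf] sg; split; first exact: (Sigma_c_conv etG oU0 T).
move=> eps eps0; have := quotM QP (hf _ (divr_gt0 eps0 (nuS_gt0 g))) (nuS sg).
by rewrite divfK// gt_eqF.
Qed.

(** [Q] gives upper bounds only, so the bound on [f] is multiplied by [a] again and again instead of
    cancelling a norm. *)
Lemma null_ideal_absorb f g (a : R) : Sc f -> 0 <= a -> a < 1 -> Q g a -> conv g f = f ->
  null_ideal f.
Proof.
move=> sf a0 a1 Qg gf; split=> // eps eps0.
have Qn n : Q f (a ^+ n * (rn (units gE) f + 1)).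
  elim: n => [|n IH]; first by rewrite expr0 mul1r; exact: nuS.
  by have := quotM QP Qg IH; rewrite gf mulrA -exprS.
have an : (fun n => a ^+ n * (rn (units gE) f + 1)) @ \oo --> 0 * (rn (units gE) f + 1).
  by apply: cvgMr_tmp; apply: cvg_expr; rewrite ger0_norm.
rewrite mul0r in an; have [n _ /(_ n (leqnn n)) hn] := cvgr_lt 0 an eps eps0.
exact: quot_mono (ltW hn) (Qn n).
Qed.

(* The compression [e f e] of [f] by a cutoff [e] supported in a set [W] that
   no point of the support of [f] off the units carries to itself is [e^2 f]
   restricted to the units; if [f] is nearly constant on [W] then [e^2] is close
   to a multiple of [e f e], hence has small quotient norm. *)
Lemma null_ideal_unit f u0 : Sc f -> units gE u0 -> 0 < normc (f u0) ->
  Q f (normc (f u0) / 10) ->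
  exists p u1, [/\ null_ideal p, unit_supported gG q p, units gE u1 & p u1 != 0].
Proof.
move=> sf uu0 c0 Qf; set c := f u0 in c0 Qf.
have [cf kf ef] := sf; have uq0 := q_unit T uu0.
pose V := [set x | units gG x /\ normc (c - f (i (x, 1))) < normc c / 10].
have oV : open V.
  rewrite openE => x [ux fx]; rewrite /interior.
  have cx := unit_restriction_continuous oU0 T sf ux.
  have cn : {for x, continuous (fun y => normc (c - f (i (y, 1))))}.
    have h : {for x, continuous (fun y => c - f (i (y, 1)))}.
      by apply: cvgB; [exact: cvg_cst|exact: cx].
    by apply: continuous_comp; [exact: h|exact: continuous_normc].
  apply: filterS2 (open_nbhs_nbhs (conj oU0 ux)) (cvgr_lt _ cn _ fx) => y uy fy.
  by split.
have V0 : V (q u0).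
  by split=> //; rewrite (units_E T uu0) subrr normc0 divr_gt0.
pose D := q @` closure [set e | f e != 0] `&` ~` units gG.
have cD : compact D.
  apply: compact_closedI; last by rewrite closedC.
  by apply: continuous_compact => //; apply: continuous_subspaceT; exact: (twist_q_continuous T).
have D0 : D `&` units gG = set0 by rewrite /D -setIA setICl setI0.
have [W [oW [x1 Wx1] WV hW]] := effective_shrink etG oU0 effG cD D0 oV (ex_intro _ _ V0).
have WU : W `<=` units gG by move=> x /WV[].
have u1u := units_i1 T (WU _ Wx1); set u1 := i (x1, 1) in u1u.
have Wu1 : W (q u1) by rewrite (q_i T)//; [exact: WU|exact: circle1].
have [e1 [p [se1 sp eW pu1 e1P]]] := unit_cutoff etG T oW WU u1u Wu1.
have e1W a : e1 a != 0 -> W (q a) by move=> h; apply: eW; rewrite h.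
have pW a : p a != 0 -> W (q a) by move=> h; apply: eW; rewrite h orbT.
have e1U : unit_supported gG q e1 by move=> a /e1W/WU.
have pU : unit_supported gG q p by move=> a /pW/WU.
have ee := Sigma_c_equiv se1.
have eq_f g u : Sc g -> equiv (src_fibre gE u) g by exact: Sigma_c_equiv_fibre.
have e1le : rn (units gE) e1 <= 1.
  apply: (rnorm_bisection etG T sub_units se1 (@units_src_inj _ gG) (@units_rng_inj _ gG)) => //.
  by apply: (unit_normc_le T ee e1U) => // u uu; have [] := e1P u uu.
(* [quot_norm] needs a strict inequality, and the norm of [e1] may be 1. *)
have Qe1 : Q e1 2 by apply: (quot_norm QP) => //; apply: le_lt_trans e1le _; rewrite ltr1n.
have sef := Sigma_c_conv etG oU0 T se1 sf.
pose h := conv (conv e1 f) e1; have sh : Sc h by exact: (Sigma_c_conv etG oU0 T).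
have hE a : h a = e1 (r a) * f a * e1 (s a).
  rewrite /h (conv_unitr etG T) ?(conv_unitl etG T)//.
  - exact: eq_f.
  - exact: Sigma_c_equiv.
  - exact: eq_f.
have hU : unit_supported gG q h.
  move=> a; rewrite hE !mulf_eq0 !negb_or => /andP[/andP[/e1W Wr fa] /e1W Ws].
  apply: contrapT => na; rewrite (q_rng T) in Wr; rewrite (q_src T) in Ws.
  apply: (hW (q a)) => //; split=> //; exists a => //; exact: subset_closure.
pose g2 := conv e1 e1; have sg2 : Sc g2 by exact: (Sigma_c_conv etG oU0 T).
have g2E a : g2 a = e1 (r a) * e1 a by rewrite /g2 (conv_unitl etG T)//; exact: eq_f.
have g2U : unit_supported gG q g2 by exact: (unit_supported_conv etG T).
have cn0 : c != 0 by rewrite -normc_gt0.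
have sch : Sc (- c^-1 *: h) by exact: (Sigma_cZ T).
(* At a unit u its value is e1(u)^2 (1 - f(u) / c), of modulus at most 1/10 by the choice of [V].
   Since [d] is supported on the units, its norm obeys the same bound. *)
pose d := g2 + (- c^-1 *: h); have sd : Sc d by exact: (Sigma_cD T).
have dE a : d a = g2 a - c^-1 * h a by rewrite -[LHS]/(g2 a + - c^-1 * h a) mulNr.
have dU : unit_supported gG q d.
  move=> a; rewrite dE; have [-> |/g2U//] := eqVneq (g2 a) 0.
  have [-> |/hU//] := eqVneq (h a) 0.
  by rewrite mulr0 subr0 eqxx.
have dle : rn (units gE) d <= 1 / 10.
  apply: (rnorm_bisection etG T sub_units sd (@units_src_inj _ gG) (@units_rng_inj _ gG)) => //.
  apply: (unit_normc_le T (Sigma_c_equiv sd) dU) => // u uu.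
  rewrite dE g2E hE !rng_unit// uu.
  have -> : e1 u * e1 u - c^-1 * (e1 u * f u * e1 u) = (e1 u * e1 u) * (c^-1 * (c - f u)).
    by rewrite mulrBr mulVf// mulrBr mulr1; congr (_ - _); ring.
  have [->|eu] := eqVneq (e1 u) 0; first by rewrite !mul0r normc0 divr_ge0.
  rewrite !normcM -[leRHS]mul1r ler_pM ?mulr_ge0 ?normc_ge0//.
    by have [eu1 _] := e1P u uu; rewrite -[leRHS]mul1r ler_pM ?normc_ge0.
  have [_] := WV _ (e1W _ eu); rewrite (units_E T uu) normcV => /ltW h1.
  by rewrite mulrC ler_pdivrMr// [leRHS]mulrC mul1r.
have Qd : Q d (1 / 5).
  by apply: (quot_norm QP) => //; apply: le_lt_trans dle _; lra.
have Qh := quotM QP (quotM QP Qe1 Qf) Qe1.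
have Qch := quotZ QP (invr_neq0 cn0) Qh.
have g2d : g2 = d + c^-1 *: conv (conv e1 f) e1.
  apply/funext => a; rewrite -[RHS]/(d a + c^-1 * h a) dE subrK//.
have Qg2 : Q g2 (3 / 5).
  rewrite g2d; apply: quot_mono (quotD QP Qd Qch).
  rewrite normcV; have -> : (normc c)^-1 * (2 * (normc c / 10) * 2) = 4 / 10.
    by field; rewrite gt_eqF.
  exact: num1.
have g2p : conv g2 p = p.
  apply/funext => a; rewrite (conv_unitl etG T (Sigma_c_equiv sg2) g2U); last exact: eq_f.
  have [->|pa] := eqVneq (p a) 0; first by rewrite mulr0.
  have [z cz aE] := unit_phase T (pU _ pa).
  have pr : p (r a) != 0.
    apply: contra_neq pa => pr; rewrite aE (Sigma_c_equiv sp)// pr mulr0//.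
  have [_ /(_ pr) e1r] := e1P (r a) (units_rng gE a).
  by rewrite g2E rng_rng e1r !mul1r.
exists p, u1; split=> //.
exact: (null_ideal_absorb sp num2 num3 Qg2 g2p).
Qed.

(** Conjugation: [p] is multiplied on the left by [g], living over a bisection through [q a], and on
    the right by [g'], living over the inverse bisection. The value at [r a] is the product of g(a),
    p(s a) and g'(a^-1). *)
Lemma null_ideal_translate p (a : E) : null_ideal p -> unit_supported gG q p ->
  p (s a) != 0 ->
  exists k, [/\ null_ideal k, unit_supported gG q k & k (r a) != 0].
Proof.
move=> Ip pU pa; have [sp _] := Ip.
have [U [oU iUs iUr] Ua] := bisection_at etG (q a).
have [g [sg gU ga]] := Sigma_c_section etG T oU Ua.
have oU' : open (inv gG @^-1` U).
  by apply: open_comp => // b _; exact: (etale_topological etG).2.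
have U'a : (inv gG @^-1` U) (q (v a)) by rewrite /preimage/= (q_inv T) inv_inv.
have [g' [sg' gU' ga']] := Sigma_c_section etG T oU' U'a.
have Ipg := null_idealMr Ip sg'; have [spg _] := Ipg.
have pgE b : conv p g' b = p (r b) * g' b.
  by rewrite (conv_unitl etG T (Sigma_c_equiv sp) pU)//; exact: Sigma_c_equiv_fibre.
have kE b e : r b = r e -> U (q b) -> conv g (conv p g') e = g b * conv p g' (m (v b) e).
  move=> rbe Ub; apply: (conv_bisection etG T iUr (Sigma_c_equiv sg) gU) => //.
  exact: Sigma_c_equiv_fibre.
exists (conv g (conv p g')); split; first exact: null_idealMl.
- move=> e; have [[b [Ub rb]]|n] := pselect (exists b, U (q b) /\ r b = r e); last first.
    rewrite (conv_eq0 etG T (Sigma_c_equiv sg)) ?eqxx//; first exact: Sigma_c_equiv_fibre.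
    by move=> b rb; apply/eqP/negPn/negP => /gU Ub; apply: n; exists b.
  rewrite (kE b)// mulf_eq0 pgE mulf_eq0 !negb_or => /and3P[_ _ /gU'].
  have svb : s (v b) = r e by rewrite src_inv.
  rewrite /preimage/= -(q_inv T) invM// inv_inv => Ub'.
  have sev : s (v e) = r b by rewrite src_inv.
  (* The arrows b and e^-1 b both lie over [U] and have the same source, so they have the same image
     in [G]; this makes [q e] a unit. *)
  have qb : q (m (v e) b) = q b.
    apply: iUs; rewrite ?inE//.
    by rewrite -!(q_src T) src_mul.
  have h : q (v e) = q (r b).
    have := mulgK (q_composable T sev); rewrite -(q_mul T)// qb.
    by rewrite mul_inv -(q_rng T) => ->.
  have -> : q e = inv gG (q (v e)) by rewrite (q_inv T) inv_inv.
  by rewrite h inv_unit; exact/(q_unit T)/units_rng.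
- rewrite (kE a) ?rng_rng//; have -> : m (v a) (r a) = v a by rewrite -src_inv mul_src.
  rewrite pgE rng_inv !mulf_neq0//; [exact: ga|exact: ga'].
Qed.

Lemma null_ideal_full p u1 : minimal gG -> null_ideal p -> unit_supported gG q p ->
  units gE u1 -> p u1 != 0 -> forall f, Sc f -> null_ideal f.
Proof.
move=> minG Ip pU uu1 pu1.
(* The units at which some unit-supported element of the ideal is nonzero: an open set by
   continuity, invariant by [null_ideal_translate], and containing [q u1]. *)
pose U := [set x | units gG x /\
  exists k, [/\ null_ideal k, unit_supported gG q k & k (i (x, 1)) != 0]].
have neq0_near k x : Sc k -> units gG x -> k (i (x, 1)) != 0 ->
    \forall y \near x, units gG y /\ normc (k (i (x, 1))) / 2 < normc (k (i (y, 1))).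
  move=> sk ux kx; have cx := unit_restriction_continuous oU0 T sk ux.
  have cn : {for x, continuous (fun y => normc (k (i (y, 1))))}.
    by apply: continuous_comp; [exact: cx|exact: continuous_normc].
  have lt2 : normc (k (i (x, 1))) / 2 < normc (k (i (x, 1))).
    by rewrite ltr_pdivrMr// mulr_natr mulr2n ltrDl normc_gt0.
  by apply: filterS2 (open_nbhs_nbhs (conj oU0 ux)) (cvgr_gt _ cn _ lt2) => y.
have half_gt0 k x : k (i (x, 1)) != 0 -> 0 < normc (k (i (x, 1)) : C R) / 2.
  by move=> kx; rewrite divr_gt0 ?normc_gt0.
have oU : open U.
  rewrite openE => x [ux [k [Ik kU kx]]]; rewrite /interior.
  apply: filterS (neq0_near k x Ik.1 ux kx) => y [uy ky]; split=> //.
  exists k; split=> //; rewrite -normc_gt0; apply: lt_trans ky; exact: half_gt0.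
have oiU : open_in (units gG) U.
  by exists U => //; apply/seteqP; split=> [x [ux hx]|x []].
have invU : invariant gG U.
  move=> x [_ [k [Ik kU ks]]]; have [a qa] := q_surj T x.
  have sa : k (s a) != 0.
    by move: ks; rewrite -qa -(q_src T) (units_E T)//; exact: units_src.
  have [k' [Ik' kU' kr]] := null_ideal_translate Ik kU sa.
  split; first exact: units_rng.
  exists k'; split=> //; rewrite -qa -(q_rng T) (units_E T)//; exact: units_rng.
have UT : U = units gG.
  have [U0|//] := minG U oiU invU.
  have : U (q u1).
    by split; [exact: (q_unit T)|exists p; split=> //; rewrite (units_E T)].
  by rewrite U0.
apply: (Sigma_c_local etG T); first exact: null_ideal0.
  by move=> f g _ _; exact: null_idealD.
move=> a; have ua : units gG (rng gG a) by exact: units_rng.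
have : U (rng gG a) by rewrite UT.
move=> [_ [k [Ik kU ka]]]; have [sk _] := Ik; have [ck _ ek] := sk.
have crk e : {for e, continuous (fun b => k (r b))}.
  by apply: continuous_comp; [exact: (continuous_rng (twist_topological T))|exact: ck].
have : nbhs (rng gG a) [set y | units gG y /\
    normc (k (i (rng gG a, 1))) / 2 < normc (k (i (y, 1)))] by exact: neq0_near.
rewrite nbhsE => -[D [oD Da] hD].
exists (rng gG @^-1` D); split => //.
  apply: open_comp => // b _; exact: (continuous_rng (etale_topological etG)).
move=> f sf fD; set c := normc (k (i (rng gG a, 1))) / 2 in hD.
have c0 : 0 < c by exact: half_gt0.
have clk : closed [set e | c <= normc (k (r e))].
  apply: (@preimage_closed _ _ (fun e => normc (k (r e))) [set t : R | c <= t]).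
    by move=> e _; apply: continuous_comp; [exact: crk|exact: continuous_normc].
  exact: closed_ge.
(* Being nonzero would not survive the closure, but the inequality [c <= normc (k (r e))] defines a
   closed set; this is why [D] was chosen with a uniform lower bound. *)
have supp_k e : closure [set e | f e != 0] e -> k (r e) != 0.
  move=> fe; have : [set e | c <= normc (k (r e))] e.
    rewrite ((closure_id _).1 clk); apply: closureS fe => b /= /fD /hD[_ /ltW].
    by rewrite -(q_rng T) (units_E T)//; exact: units_rng.
  by move=> /= h; rewrite -normc_gt0; exact: lt_le_trans h.
pose f' e : C R := (k (r e))^-1 * f e.
have sf' : Sc f'.
  apply: (Sigma_c_mul T (h := fun e => (k (r e))^-1) sf).
    by move=> z e cz; rewrite (rng_phase T).
  move=> e fe; have kr := supp_k _ fe.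
  exact: (cvgV kr (crk e)).
suff -> : f = conv k f' by exact: null_idealMr.
apply/funext => e; rewrite (conv_unitl etG T (Sigma_c_equiv sk) kU); last first.
  exact: Sigma_c_equiv_fibre.
have [f0|f0] := eqVneq (f e) 0; first by rewrite /f' f0 !mulr0.
rewrite /f' mulrA mulfV ?mul1r//; apply: supp_k; exact: subset_closure.
Qed.

Lemma quotnorm_eq0 : minimal gG -> forall S : nat -> E -> C R,
  (forall n, Sc (S n)) ->
  (forall eps : R, 0 < eps -> exists k, forall j n, (k <= j)%N -> (k <= n)%N ->
     rn (units gE) (S j - S n) < eps) ->
  ~ (forall eps : R, 0 < eps -> exists k, forall n, (k <= n)%N ->
     rn (units gE) (S n) < eps) ->
  (forall eps : R, 0 < eps -> exists k, forall n, (k <= n)%N -> Q (S n) eps) ->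
  forall f, Sc f -> null_ideal f.
Proof.
move=> minG S sS cS nS QS.
have [e0 he0] : exists e, ~ ((fun n => S n e) @ \oo --> (0 : C R)).
  apply/existsNP => h; apply: nS; exact: (rnorm_pointwise_null etG T sS cS h).
(* The values at [e0] exceed [eta] for arbitrarily large indices, so [n] can be taken where the
   quotient norm of [S n] is already small compared with [eta]. *)
have [eta eta0 heta] : exists2 eta : R, 0 < eta &
    forall k, exists2 n, (k <= n)%N & eta <= normc (S n e0).
  apply: contrapT => h; apply: he0; apply/cvg_normcP => eps eps0.
  apply: contrapT => nn; apply: h; exists eps => // k; apply: contrapT => h.
  apply: nn; exists k => // n /= kn; rewrite sub0r normcN ltNge; apply/negP => le.
  by apply: h; exists n.
have [U bU Ue] := bisection_at etG (q (v e0)); have [oU iUs iUr] := bU.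
have [g [sg gU ge]] := Sigma_c_section etG T oU Ue.
have ga : 0 < normc (g (v e0)) by rewrite normc_gt0 ge.
pose M := rn (units gE) g + 1.
(* Multiplication by [g] costs a factor [M] in the quotient norm, and turns the value [S n e0] into
   [g (v e0) * S n e0] at the unit [s e0]; what remains is the ratio 1/10 that [null_ideal_unit]
   asks for. *)
have eps0 : 0 < normc (g (v e0)) * eta / 10 / M.
  by rewrite !divr_gt0// ?mulr_gt0// /M nuS_gt0.
have [k hk] := QS _ eps0; have [n kn hn] := heta k.
pose f := conv g (S n); have sf : Sc f by exact: (Sigma_c_conv etG oU0 T).
have fE : f (s e0) = g (v e0) * S n e0.
  rewrite /f (conv_bisection etG T iUr (Sigma_c_equiv sg) gU (a := v e0))//.
  - by rewrite inv_inv mul_src.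
  - exact: Sigma_c_equiv_fibre.
  - by rewrite rng_inv rng_src.
have fn : normc (g (v e0)) * eta <= normc (f (s e0)).
  by rewrite fE normcM ler_wpM2l ?normc_ge0.
have Qf : Q f (normc (f (s e0)) / 10).
  apply: quot_mono (quotM QP (nuS sg) (hk n kn)).
  rewrite -/M mulrC divfK ?gt_eqF ?nuS_gt0//.
  by rewrite ler_wpM2r ?invr_ge0.
have f0 : 0 < normc (f (s e0)) by apply: lt_le_trans fn; rewrite mulr_gt0.
have [p [u1 [Ip pU uu1 pu1]]] := null_ideal_unit sf (units_src gE e0) f0 Qf.
exact: (null_ideal_full minG Ip pU uu1 pu1).
Qed.

End QuotientNorm.

Lemma minimal_simple : minimal gG -> simple (Cstar_r gG gE i q).
Proof.
move=> minG; apply: (simple_criterion alg (st := star gE) (nuP sub_units)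
  (fun f => @reduced_normE f)) => Q QP [S [sS cS nS QS]] f eps sf eps0.
by have [_] := quotnorm_eq0 QP minG sS cS nS QS sf; apply.
Qed.

End Main.

Theorem corollary6p9 (R : realType) (G E : topologicalType)
    (gG : groupoid G) (gE : groupoid E) (i : G * (R[i]^o)%type -> E) (q : E -> G) :
  hausdorff_etale gG -> effective gG -> twist gG gE i q ->
  (simple (Cstar_r gG gE i q) <-> minimal gG).
Proof.
move=> etG effG T; split; first exact: simple_minimal.
exact: minimal_simple.
Qed.
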